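(* Let $(M_1\times_fM_2,F)$ be a twisted product Finsler manifold. Then the coefficients of the Riemannian curvature $\mathbf R^{\ a}_{b\ cd}$ are as follows: $$\mathbf R^{\ i}_{j\ kl}=R^{\ i}_{j\ kl}-\Big\{\Big\{M^r_l\tfrac{\partial F^i_{jk}}{\partial y^r}+\tfrac{\delta^tM^i_{jk}}{\delta^tx^l}+F^i_{lh}M^h_{jk}+M^i_{lh}F^h_{jk}-M^i_{lh}M^h_{jk}+f^{-2}g^{\alpha\gamma}\mathbf G^r_\alpha\mathbf G^m_\gamma C^i_{lr}C_{jkm}\Big\}-\mathfrak C^k_l\Big\},$$ $$\mathbf R^{\ i}_{\alpha\ kl}=\Big\{-\tfrac{\delta^t}{\delta^tx^l}(\mathbf G^r_\alpha C^i_{kr})-(F^i_{rl}-M^i_{rl})\mathbf G^m_\alpha C^r_{km}-f^{-1}\mathbf G^r_\beta C^i_{lr}f_k\delta^\beta_\alpha+\mathbf G^r_\beta\mathbf G^\mu_kC^i_{lr}C^\beta_{\alpha\mu}\Big\}-\mathfrak C^k_l,$$ $$\mathbf R^{\ i}_{j\ \beta\lambda}=\Big\{-\tfrac{\delta^t}{\delta^tu^\lambda}(\mathbf G^r_\beta C^i_{jr})+\mathbf G^m_\lambda\mathbf G^l_\beta C^i_{rm}C^r_{jl}-(f^ig_{\alpha\lambda}-f\mathbf G^\mu_hg^{ih}C_{\alpha\lambda\mu})(f_j\delta^\alpha_\beta-f\mathbf G^\nu_jC^\alpha_{\beta\nu})\Big\}-\mathfrak C^\beta_\lambda,$$ $$\begin{aligned}\mathbf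 R^{\ i}_{\alpha\ \beta l}={}&\tfrac{\delta^t}{\delta^tu^\beta}(\mathbf G^r_\alpha C^i_{lr})-\tfrac{\delta^t}{\delta^tx^l}\big[f(f^ig_{\alpha\beta}-f\mathbf G^\lambda_hg^{ih}C_{\alpha\beta\lambda})\big]-\mathbf G^m_\beta\mathbf G^s_\alpha C^i_{rm}C^r_{ls}\\&+(f^ig_{\mu\beta}-f\mathbf G^\lambda_hg^{ih}C_{\mu\beta\lambda})(f_l\delta^\mu_\alpha-f\mathbf G^\nu_lC^\mu_{\alpha\nu})-fg^{rh}(F^i_{rl}-M^i_{rl})(f_hg_{\alpha\beta}-f\mathbf G^\lambda_hC_{\alpha\beta\lambda})\\&-\mathbf G^r_\mu C^i_{lr}(F^\mu_{\alpha\beta}+N^\mu_{\alpha\beta}-M^\mu_{\alpha\beta}),\end{aligned}$$ $$\begin{aligned}\mathbf R^{\ i}_{j\ \beta l}={}&-\tfrac{\delta^t}{\delta^tx^l}(\mathbf G^r_\beta C^i_{jr})-\tfrac{\delta^t}{\delta^tu^\beta}(F^i_{jl}-M^i_{jl})-(F^i_{lr}-M^i_{lr})\mathbf G^s_\beta C^r_{js}-f^{-1}\mathbf G^r_\alpha C^i_{lr}(f_j\delta^\alpha_\beta-f\mathbf G^\mu_jC^\alpha_{\beta\mu})\\&+\mathbf G^s_\beta C^i_{rs}(F^r_{jl}-M^r_{jl})+f^{-1}\mathbf G^r_\mu C_{jlr}(f^i\delta^\mu_\beta-f\mathbf G^\lambda_hg^{ih}C^\mu_{\beta\lambda}),\end{aligned}$$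 $$\begin{aligned}\mathbf R^{\ i}_{\alpha\ \beta\lambda}=\Big\{&-\tfrac{\delta^t}{\delta^tu^\lambda}(ff^ig_{\alpha\beta}-f^2g^{ih}\mathbf G^\mu_hC_{\alpha\beta\mu})+f\mathbf G^s_\lambda C^i_{rs}(f^rg_{\alpha\beta}-f\mathbf G^\mu_lC_{\alpha\beta\mu}g^{rl})\\&-f(f^ig_{\lambda\mu}-fg^{ih}\mathbf G^\kappa_hC_{\lambda\mu\kappa})(F^\mu_{\alpha\beta}+N^\mu_{\alpha\beta}-M^\mu_{\alpha\beta})\Big\}-\mathfrak C^\beta_\lambda,\end{aligned}$$ $$\mathbf R^{\ \gamma}_{j\ kl}=\Big\{\tfrac{\delta^t}{\delta^tx^l}(f^{-2}g^{\gamma\lambda}\mathbf G^r_\lambda C_{jkr})+f^{-2}g^{\gamma\lambda}\mathbf G^s_\lambda C_{lrs}(F^r_{jk}-M^r_{jk})+f^{-3}\mathbf G^r_\mu C_{jkr}(f_lg^{\gamma\mu}-f\mathbf G^\alpha_lC^{\gamma\mu}_\alpha)\Big\}-\mathfrak C^k_l,$$ $$\begin{aligned}\mathbf R^{\ \gamma}_{j\ \beta l}={}&\tfrac{\delta^t}{\delta^tx^l}(f^{-1}f_j\delta^\gamma_\beta-\mathbf G^\alpha_jC^\gamma_{\alpha\beta})-\tfrac{\delta^t}{\delta^tu^\beta}(f^{-2}g^{\gamma\lambda}\mathbf G^r_\lambda C_{jlr})-f^{-2}g^{\gamma\lambda}\mathbf G^s_\lambda\mathbf G^m_\beta C^h_{ls}C_{hjm}\\&+f^{-2}(f_l\delta^\gamma_\mu-f\mathbf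 G^\alpha_lC^\gamma_{\mu\alpha})(f_j\delta^\mu_\beta-f\mathbf G^\nu_jC^\mu_{\beta\nu})-f^{-1}(f_r\delta^\gamma_\beta-f\mathbf G^\alpha_rC^\gamma_{\beta\alpha})(F^r_{jl}-M^r_{jl})\\&-f^{-2}g^{\mu\lambda}\mathbf G^r_\lambda C_{jlr}(F^\gamma_{\beta\mu}+N^\gamma_{\beta\mu}-M^\gamma_{\beta\mu}),\end{aligned}$$ $$\begin{aligned}\mathbf R^{\ \gamma}_{\alpha\ \beta l}={}&\tfrac{\delta^t}{\delta^tx^l}(F^\gamma_{\alpha\beta}+N^\gamma_{\alpha\beta}-M^\gamma_{\alpha\beta})-\tfrac{\delta^t}{\delta^tu^\beta}(f^{-1}f_l\delta^\gamma_\alpha-\mathbf G^\mu_lC^\gamma_{\alpha\mu})-f^{-1}g^{\gamma\lambda}\mathbf G^s_\lambda C^h_{ls}(f_hg_{\alpha\beta}-f\mathbf G^\mu_hC_{\alpha\beta\mu})\\&+f^{-1}(f_l\delta^\gamma_\mu-f\mathbf G^\kappa_lC^\gamma_{\mu\kappa})(F^\mu_{\alpha\beta}+N^\mu_{\alpha\beta}-M^\mu_{\alpha\beta})+f^{-1}\mathbf G^s_\alpha C^r_{ls}(f_r\delta^\gamma_\beta-f\mathbf G^\kappa_rC^\gamma_{\beta\kappa})\\&-f^{-1}(f_l\delta^\mu_\alpha-f\mathbf G^\kappa_lC^\mu_{\alpha\kappa})(F^\gamma_{\beta\mu}+N^\gamma_{\beta\mu}-M^\gamma_{\beta\mu}),\end{aligned}$$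 $$\begin{aligned}\mathbf R^{\ \gamma}_{j\ \beta\lambda}=\Big\{&\tfrac{\delta^t}{\delta^tu^\lambda}(f^{-1}f_j\delta^\gamma_\beta-\mathbf G^\alpha_jC^\gamma_{\alpha\beta})+f^{-1}(F^\gamma_{\alpha\lambda}+N^\gamma_{\alpha\lambda}-M^\gamma_{\alpha\lambda})(f_j\delta^\alpha_\beta-f\mathbf G^\nu_jC^\alpha_{\beta\nu})\\&-f^{-1}\mathbf G^m_\beta C^r_{jm}(f_r\delta^\gamma_\lambda-f\mathbf G^\alpha_rC^\gamma_{\lambda\alpha})\Big\}-\mathfrak C^\beta_\lambda,\end{aligned}$$ $$\begin{aligned}\mathbf R^{\ \gamma}_{\alpha\ kl}=\Big\{&\tfrac{\delta^t}{\delta^tx^l}(f^{-1}f_k\delta^\gamma_\alpha-\mathbf G^\mu_kC^\gamma_{\alpha\mu})+f^{-2}(f_l\delta^\gamma_\beta-f\mathbf G^\kappa_lC^\gamma_{\beta\kappa})(f_k\delta^\beta_\alpha-f\mathbf G^\nu_kC^\beta_{\alpha\nu})\\&-f^{-2}\mathbf G^s_\mu\mathbf G^m_\alpha g^{\gamma\mu}C^h_{ls}C_{hkm}\Big\}-\mathfrak C^k_l,\end{aligned}$$ $$\begin{aligned}\mathbf R^{\ \gamma}_{\alpha\ \beta\lambda}=R^{\ \gamma}_{\alpha\ \beta\lambda}-\Big\{\Big\{&M^\kappa_\lambda\tfrac{\partial F^\gamma_{\alpha\beta}}{\partial v^\kappa}+\tfrac{\delta^tM^\gamma_{\alpha\beta}}{\delta^tu^\lambda}+F^\gamma_{\lambda\mu}M^\mu_{\alpha\beta}+M^\gamma_{\lambda\mu}F^\mu_{\alpha\beta}-M^\gamma_{\lambda\mu}M^\mu_{\alpha\beta}+\tfrac{\delta^tN^\gamma_{\alpha\lambda}}{\delta^tu^\beta}+F^\gamma_{\beta\mu}N^\mu_{\alpha\lambda}\\&+N^\gamma_{\beta\mu}F^\mu_{\alpha\lambda}+N^\gamma_{\beta\mu}N^\mu_{\alpha\lambda}+N^\gamma_{\lambda\mu}M^\mu_{\alpha\beta}+N^\mu_{\alpha\beta}M^\gamma_{\lambda\mu}\\&+(g^{rs}\delta^\gamma_\lambda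 f_s-fg^{rs}\mathbf G^\kappa_sC^\gamma_{\lambda\kappa})(g_{\alpha\beta}f_r-f\mathbf G^\mu_rC_{\alpha\beta\mu})\Big\}-\mathfrak C^\beta_\lambda\Big\}.\end{aligned}$$
   Context: Let $(M_1,F_1)$, $(M_2,F_2)$ be Finsler manifolds (metrics smooth on the slit tangent bundle, positively 1-homogeneous on fibres, with positive definite fundamental tensor) and $f:M_1\times M_2\to\mathbb{R}^+$ smooth. The twisted product $M_1\times_f M_2$ is $M=M_1\times M_2$ with $F=\sqrt{F_1^2(x,y)+f^2(x,u)F_2^2(u,v)}$, considered where $y\ne0$, $v\ne 0$. Local coordinates are $\mathbf{x}^a=(x^i,u^\alpha)$ with fibre coordinates $\mathbf{y}^a=(y^i,v^\alpha)$; Latin indices $i,j,\dots$ refer to $M_1$, Greek to $M_2$, and $a,b,\dots$ to $M$. Bold objects belong to $F$; non-bold ones belong to $F_1$ (Latin) or $F_2$ (Greek). For $F$: $\mathbf g_{ab}=\frac12\frac{\partial^2F^2}{\partial\mathbf y^a\partial\mathbf y^b}$, $\mathbf G^a=\frac14\mathbf g^{ab}\big(\frac{\partial^2F^2}{\partial\mathbf y^b\partial\mathbf x^c}\mathbf y^c-\frac{\partial F^2}{\partial\mathbf x^b}\big)$, $\mathbf G^a_b=\frac{\partial\mathbf G^a}{\partial\mathbf y^b}$, $\frac{\delta^t}{\delta^t\mathbf x^a}=\frac{\partial}{\partial\mathbf x^a}-\mathbf G^b_a\frac{\partial}{\partial\mathbf y^b}$ (written $\frac{\delta^t}{\delta^tx^i}$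 or $\frac{\delta^t}{\delta^tu^\alpha}$), $\mathbf F^c_{ab}=\frac12\mathbf g^{ce}\big(\frac{\delta^t\mathbf g_{ea}}{\delta^t\mathbf x^b}+\frac{\delta^t\mathbf g_{eb}}{\delta^t\mathbf x^a}-\frac{\delta^t\mathbf g_{ab}}{\delta^t\mathbf x^e}\big)$, and $$\mathbf R^{\ a}_{b\ cd}=\frac{\delta^t\mathbf F^a_{bc}}{\delta^t\mathbf x^d}-\frac{\delta^t\mathbf F^a_{bd}}{\delta^t\mathbf x^c}+\mathbf F^a_{de}\mathbf F^e_{bc}-\mathbf F^a_{ce}\mathbf F^e_{bd}.$$ The non-bold $g_{ij}$, $G^i_j$, $\frac{\delta}{\delta x^i}=\frac{\partial}{\partial x^i}-G^j_i\frac{\partial}{\partial y^j}$, $F^k_{ij}$, $R^{\ i}_{j\ kl}$ are defined by the same formulas from $F_1$, and $g_{\alpha\beta}$, $F^\gamma_{\alpha\beta}$, $R^{\ \gamma}_{\alpha\ \beta\lambda}$ etc. from $F_2$. Cartan tensors: $C_{ijk}=\frac12\frac{\partial g_{ij}}{\partial y^k}$, $C_{\alpha\beta\gamma}=\frac12\frac{\partial g_{\alpha\beta}}{\partial v^\gamma}$, with indices raised by $g^{ij}$, $g^{\alpha\beta}$ respectively; $v_\alpha=g_{\alpha\beta}v^\beta$. $f_i=\frac{\partial f}{\partial x^i}$, $f_\alpha=\frac{\partial f}{\partial u^\alpha}$, $f^i=g^{ih}f_h$. Further $$M^r_i=C^{rh}_iff_hF_2^2,\qquad M^\mu_\alpha=f^{-1}(C^{\mu\gamma}_\alpha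 f_\gamma F_2^2+f_ry^r\delta^\mu_\alpha+f_\gamma v^\gamma\delta^\mu_\alpha-g^{\mu\gamma}f_\gamma v_\alpha+f_\alpha v^\mu),$$ $$M^i_{jk}=M^r_kC^i_{jr}+M^r_jC^i_{kr}-M^r_hg^{ih}C_{jkr},\qquad M^\gamma_{\alpha\beta}=M^\mu_\beta C^\gamma_{\alpha\mu}+M^\mu_\alpha C^\gamma_{\beta\mu}-M^\mu_\nu g^{\gamma\nu}C_{\alpha\beta\mu},$$ $$N^\gamma_{\alpha\beta}=f^{-1}(f_\beta\delta^\gamma_\alpha+f_\alpha\delta^\gamma_\beta-f_\lambda g^{\gamma\lambda}g_{\alpha\beta}).$$ $\{\cdots\}-\mathfrak C^k_l$ means: subtract from $\{\cdots\}$ the same expression with the indices $k$ and $l$ interchanged (similarly $\mathfrak C^\beta_\lambda$). *)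

(* Defs.v *)
From HB Require Import structures.
From mathcomp Require Export all_boot all_order all_algebra.
From mathcomp Require Export all_classical all_reals all_analysis.
Export numFieldNormedType.Exports.

Set Implicit Arguments.
Unset Strict Implicit.
Unset Printing Implicit Defensive.

Import Order.TTheory GRing.Theory Num.Theory.
Local Open Scope classical_set_scope.
Local Open Scope ring_scope.

Section Smooth.
Variables (R : realType) (V W : normedModType R).

Definition iter_derive (s : seq V) (phi : V -> W) : V -> W :=
  foldr (fun v (psi : V -> W) => 'D_v psi) phi s.

(* C^oo on an open set A of a finite-dimensional V: all iterated directional
   derivatives (hence all iterated partial derivatives) exist and are
   continuous on A. *)
Definition smooth_on (A : set V) (phi : V -> W) : Prop :=
  forall (s : seq V) (p : V), A p ->
    {for p, continuous (iter_derive s phi)} /\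
    forall v : V, derivable (iter_derive s phi) p v.

End Smooth.

Record chart (R : realType) (m : nat) (M : topologicalType) := Chart {
  cdom : set M;
  ccod : set 'rV[R]_m;
  cmap : M -> 'rV[R]_m;
  cinv : 'rV[R]_m -> M;
  cdom_open : open cdom;
  ccod_open : open ccod;
  cmap_cod : forall q, cdom q -> ccod (cmap q);
  cinv_dom : forall x, ccod x -> cdom (cinv x);
  cmapK : forall q, cdom q -> cinv (cmap q) = q;
  cinvK : forall x, ccod x -> cmap (cinv x) = x;
  cmap_cont : {within cdom, continuous cmap};
  cinv_cont : {within ccod, continuous cinv}
}.

Section Transition.
Variables (R : realType) (m : nat) (M : topologicalType).
Implicit Types c : chart R m M.

Definition transition c c' : 'rV[R]_m -> 'rV[R]_m :=
  fun x => cmap c' (cinv c x).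

Definition transition_dom c c' : set 'rV[R]_m :=
  [set x | ccod c x /\ cdom c' (cinv c x)].

End Transition.

Record manifold (R : realType) (m : nat) := Manifold {
  mcarrier :> topologicalType;
  mhausdorff : hausdorff_space mcarrier;
  msecond_countable : @second_countable mcarrier;
  atlas : set (chart R m mcarrier);
  atlas_cover : forall q : mcarrier, exists2 c, atlas c & cdom c q;
  atlas_smooth : forall c c', atlas c -> atlas c' ->
    smooth_on (transition_dom c c') (transition c c')
}.

(* The Finsler calculus in induced coordinates. A point p = (p.1, p.2) of
   'rV_d * 'rV_d is the tangent vector of components p.2 at the point of
   coordinates p.1, and L is the coordinate expression of the metric. *)
Section LocalFinsler.
Variables (R : realType) (d : nat).
Local Notation TM := ('rV[R]_d * 'rV[R]_d)%type.
Implicit Types (phi : TM -> R) (p : TM) (a b c e : 'I_d).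

Definition dbase a phi p : R := 'D_((delta_mx 0 a, 0) : TM) phi p.
Definition dfib a phi p : R := 'D_((0, delta_mx 0 a) : TM) phi p.

Variable L : TM -> R.

Definition energy p : R := L p ^+ 2.

(* g_ab *)
Definition fund a b p : R := 2^-1 * dfib a (dfib b energy) p.
(* g^ab *)
Definition fundinv a b p : R := invmx (\matrix_(i, j) fund i j p) a b.
(* G^a *)
Definition spray a p : R :=
  4^-1 * \sum_b fundinv a b p *
    (\sum_c dfib b (dbase c energy) p * p.2 0 c - dbase b energy p).
(* G^a_b *)
Definition nlconn a b p : R := dfib b (spray a) p.
(* delta phi / delta x^a *)
Definition hder a phi p : R :=
  dbase a phi p - \sum_b nlconn b a p * dfib b phi p.
(* F^c_ab *)
Definition hconn c a b p : R :=
  2^-1 * \sum_e fundinv c e p *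
    (hder b (fund e a) p + hder a (fund e b) p - hder e (fund a b) p).
(* hcurv b a c e is R_b^a_ce *)
Definition hcurv b a c e p : R :=
  hder e (hconn a b c) p - hder c (hconn a b e) p
  + \sum_h hconn a e h p * hconn h b c p
  - \sum_h hconn a c h p * hconn h b e p.
(* C_abc *)
Definition cartan a b c p : R := 2^-1 * dfib c (fund a b) p.
(* C^a_bc *)
Definition cartan1 a b c p : R := \sum_e fundinv a e p * cartan e b c p.
(* C^ab_c *)
Definition cartan2 a b c p : R :=
  \sum_e \sum_h fundinv a e p * fundinv b h p * cartan e h c p.
(* y_a *)
Definition ylow a p : R := \sum_b fund a b p * p.2 0 b.

End LocalFinsler.

(* A function on the tangent bundle is given by its expressions in the induced
   charts, which agree under (x, y) |-> (tau x, d tau_x y). *)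
Record finsler (R : realType) (m : nat) (M : manifold R m) := Finsler {
  fexpr : chart R m M -> 'rV[R]_m * 'rV[R]_m -> R;
  fexpr_compat : forall c c', atlas c -> atlas c' ->
    forall x y, transition_dom c c' x ->
    fexpr c' (transition c c' x, 'd (transition c c') x y) = fexpr c (x, y);
  fexpr_ge0 : forall c x y, atlas c -> ccod c x -> 0 <= fexpr c (x, y);
  fexpr_smooth : forall c, atlas c ->
    smooth_on [set p : 'rV[R]_m * 'rV[R]_m | ccod c p.1 /\ p.2 != 0] (fexpr c);
  fexpr_homog : forall c x y (t : R), atlas c -> ccod c x -> 0 < t ->
    fexpr c (x, t *: y) = t * fexpr c (x, y);
  fexpr_posdef : forall c x y (xi : 'rV[R]_m),
    atlas c -> ccod c x -> y != 0 -> xi != 0 ->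
    0 < \sum_a \sum_b fund (fexpr c) a b (x, y) * xi 0 a * xi 0 b
}.

Section ProductFunction.
Variables (R : realType) (m n : nat) (M1 : manifold R m) (M2 : manifold R n).
Variable f : M1 * M2 -> R.

Definition prod_expr (c1 : chart R m M1) (c2 : chart R n M2)
    (q : 'rV[R]_m * 'rV[R]_n) : R :=
  f (cinv c1 q.1, cinv c2 q.2).

Definition prod_smooth : Prop := forall c1 c2, atlas c1 -> atlas c2 ->
  smooth_on (ccod c1 `*` ccod c2) (prod_expr c1 c2).

End ProductFunction.

(* Local coordinates on the product: x_^a = (x^i, u^alpha) is row_mx x u, with
   i = lshift n i and alpha = rshift m alpha as indices a : 'I_(m + n). *)
Section Twisted.
Variables (R : realType) (m n : nat).
Local Notation TM := ('rV[R]_(m + n) * 'rV[R]_(m + n))%type.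

Definition tproj1 (p : TM) : 'rV[R]_m * 'rV[R]_m := (lsubmx p.1, lsubmx p.2).
Definition tproj2 (p : TM) : 'rV[R]_n * 'rV[R]_n := (rsubmx p.1, rsubmx p.2).
Definition tbase (p : TM) : 'rV[R]_m * 'rV[R]_n := (lsubmx p.1, rsubmx p.1).

Variables (F1 : 'rV[R]_m * 'rV[R]_m -> R) (F2 : 'rV[R]_n * 'rV[R]_n -> R).
Variable (f : 'rV[R]_m * 'rV[R]_n -> R).
Implicit Types (p : TM) (i j k r h : 'I_m) (α β γ μ ν : 'I_n).

Definition twisted p : R :=
  Num.sqrt (F1 (tproj1 p) ^+ 2 + f (tbase p) ^+ 2 * F2 (tproj2 p) ^+ 2).

(* f_i, f_alpha, f^i *)
Definition df1 i p : R :=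
  'D_((delta_mx 0 i, 0) : 'rV[R]_m * 'rV[R]_n) f (tbase p).
Definition df2 α p : R :=
  'D_((0, delta_mx 0 α) : 'rV[R]_m * 'rV[R]_n) f (tbase p).
Definition df1up i p : R := \sum_h fundinv F1 i h (tproj1 p) * df1 h p.

(* M^r_i *)
Definition Mt1 r i p : R :=
  \sum_h cartan2 F1 r h i (tproj1 p) * f (tbase p) * df1 h p * F2 (tproj2 p) ^+ 2.

(* M^mu_alpha *)
Definition Mt2 μ α p : R :=
  (f (tbase p))^-1 *
  (\sum_γ cartan2 F2 μ γ α (tproj2 p) * df2 γ p * F2 (tproj2 p) ^+ 2
   + \sum_r df1 r p * (tproj1 p).2 0 r * (μ == α)%:R
   + \sum_γ df2 γ p * (tproj2 p).2 0 γ * (μ == α)%:R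
   - \sum_γ fundinv F2 μ γ (tproj2 p) * df2 γ p * ylow F2 α (tproj2 p)
   + df2 α p * (tproj2 p).2 0 μ).

(* M^i_jk *)
Definition Mc1 i j k p : R :=
  \sum_r Mt1 r k p * cartan1 F1 i j r (tproj1 p)
  + \sum_r Mt1 r j p * cartan1 F1 i k r (tproj1 p)
  - \sum_r \sum_h Mt1 r h p * fundinv F1 i h (tproj1 p)
                  * cartan F1 j k r (tproj1 p).

(* M^gamma_alpha,beta *)
Definition Mc2 γ α β p : R :=
  \sum_μ Mt2 μ β p * cartan1 F2 γ α μ (tproj2 p)
  + \sum_μ Mt2 μ α p * cartan1 F2 γ β μ (tproj2 p)
  - \sum_μ \sum_ν Mt2 μ ν p * fundinv F2 γ ν (tproj2 p)
                  * cartan F2 α β μ (tproj2 p).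

(* N^gamma_alpha,beta *)
Definition Nc2 γ α β p : R :=
  (f (tbase p))^-1 *
  (df2 β p * (γ == α)%:R + df2 α p * (γ == β)%:R
   - \sum_μ df2 μ p * fundinv F2 γ μ (tproj2 p) * fund F2 α β (tproj2 p)).

End Twisted.

Arguments tproj1 {R m n} p.
Arguments tproj2 {R m n} p.
Arguments tbase {R m n} p.

(* { T } - C^k_l *)
Definition skew (R : realType) (I : Type) (T : I -> I -> R) (k l : I) : R :=
  T k l - T l k.

(* Main.v *)
Require Import Defs.
From mathcomp Require Import ring lra.

(* The square of the metric is E = E1(x,y) + f^2 E2(u,v), so the fundamental
   tensor is block diagonal with blocks g1 and f^2 g2. Differentiating the
   sprays of the blocks gives G^i_j = G1^i_j + M^i_j and
   G^alpha_beta = G2^alpha_beta + M^alpha_beta, by d g^ij = -2 C^ij_k dy^k and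
   by Euler's relation d E2 / d v^alpha = 2 v_alpha; the mixed coefficients
   G^i_alpha and G^alpha_i are never needed explicitly. A horizontal derivative
   of a function pulled back from a factor is then the horizontal derivative in
   that factor corrected by M, or only sees the mixed coefficients. This yields
   the six types of coefficients of the horizontal connection, and each
   curvature formula follows by substituting them in the definition, using the
   symmetry of g and of the Cartan tensor (Schwarz) to move indices. *)

Set Implicit Arguments.
Unset Strict Implicit.
Unset Printing Implicit Defensive.

Import Order.TTheory GRing.Theory Num.Theory.
Local Open Scope classical_set_scope.
Local Open Scope ring_scope.

(** * Smooth functions *)

(** [smooth_on] speaks of iterated directional derivatives only, and Frechet differentiability is
    not among its data. Additivity of the derivative in its direction, on which Euler's relation
    rests, and the symmetry of second derivatives are therefore extracted from the one-variable mean
    value theorem. The second shaping constraint is that every coordinate identity gets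
    differentiated again, up to the derivatives of the connection in the curvature: such identities
    are established at all points of an open domain, and are carried through derivatives by
    locality. A metric acts on the tensors and connections only through its square, so the square
    root in the twisted product is removed once, algebraically, and is never differentiated. *)

Section SmoothFunctions.
Variables (R : realType) (V : normedModType R).
Implicit Types (A : set V) (phi psi : V -> R).

Lemma eq_derive_on A phi psi v : open A -> (forall q, A q -> phi q = psi q) ->
  forall p, A p -> 'D_v phi p = 'D_v psi p.
Proof.
move=> oA e p Ap; apply: near_eq_derive.
by apply: filterS (open_nbhs_nbhs (conj oA Ap)) => q Aq; exact: e.
Qed.

Lemma eq_derivable_on A phi psi v p : open A -> (forall q, A q -> phi q = psi q) -> A p ->
  derivable phi p v -> derivable psi p v.
Proof.
move=> oA e Ap; apply: near_eq_derivable.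
by apply: filterS (open_nbhs_nbhs (conj oA Ap)) => q Aq; exact: e.
Qed.

Lemma eq_continuous_on A phi psi p : open A -> (forall q, A q -> phi q = psi q) -> A p ->
  {for p, continuous phi} -> {for p, continuous psi}.
Proof.
move=> oA e Ap cp; rewrite /prop_for /continuous_at -e //.
apply: cvg_trans cp; apply: near_eq_cvg.
by apply: filterS (open_nbhs_nbhs (conj oA Ap)) => q Aq; exact: e.
Qed.

Lemma eq_iter_derive_on A phi psi s : open A -> (forall q, A q -> phi q = psi q) ->
  forall p, A p -> iter_derive s phi p = iter_derive s psi p.
Proof. by move=> oA e; elim: s => //= v s; exact: eq_derive_on. Qed.

Lemma eq_smooth_on A phi psi : open A -> (forall q, A q -> phi q = psi q) ->
  smooth_on A phi -> smooth_on A psi.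
Proof.
move=> oA e sm s p Ap; have [c d] := sm s p Ap.
have es := eq_iter_derive_on s oA e.
split; first exact: (eq_continuous_on oA es Ap c).
by move=> v; exact: (eq_derivable_on oA es Ap (d v)).
Qed.

Lemma smooth_continuous A phi p : smooth_on A phi -> A p ->
  {for p, continuous phi}.
Proof. by move=> sm Ap; have [] := sm [::] p Ap. Qed.

Lemma smooth_derivable A phi p v : smooth_on A phi -> A p -> derivable phi p v.
Proof. by move=> sm Ap; have [_] := sm [::] p Ap; apply. Qed.

(** [foldr] applies the last direction of the list first, so one more innermost derivative is an
    [rcons]. *)
Lemma smooth_derive A phi v : smooth_on A phi -> smooth_on A ('D_v phi).
Proof.
by move=> sm s p Ap; have := sm (rcons s v) p Ap; rewrite /iter_derive foldr_rcons.
Qed.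

(* A coinduction principle: the functions satisfying [P] are smooth as soon as
   [P] is stable under differentiation. *)
Lemma smooth_coind A (P : (V -> R) -> Prop) : open A ->
  (forall phi, P phi -> forall p, A p ->
     {for p, continuous phi} /\ forall v, derivable phi p v) ->
  (forall phi, P phi -> forall v, exists2 psi, P psi & forall q, A q -> 'D_v phi q = psi q) ->
  forall phi, P phi -> smooth_on A phi.
Proof.
move=> oA Pc Pd phi Pphi s; elim/last_ind: s phi Pphi => [|s v IHs] phi Pphi p Ap.
  exact: Pc.
have [psi Ppsi e] := Pd _ Pphi v.
rewrite /iter_derive foldr_rcons -/(iter_derive _ _).
have es := eq_iter_derive_on s oA e.
have es' q : A q -> iter_derive s psi q = iter_derive s ('D_v phi) q.
  by move=> /es.
have [c d] := IHs _ Ppsi p Ap; split; first exact: (eq_continuous_on oA es' Ap c).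
by move=> w; exact: (eq_derivable_on oA es' Ap (d w)).
Qed.

(** Products or inverses alone are not stable under differentiation: the derivative of a product is
    a sum of products, that of an inverse contains a squared inverse. This closure is stable up to
    equality on [A], as [smooth_coind] requires. *)
Inductive smooth_alg A : (V -> R) -> Prop :=
| SmoothBase phi of smooth_on A phi : smooth_alg A phi
| SmoothCst (c : R) : smooth_alg A (cst c)
| SmoothAdd phi psi of smooth_alg A phi & smooth_alg A psi :
    smooth_alg A (phi + psi)
| SmoothMul phi psi of smooth_alg A phi & smooth_alg A psi :
    smooth_alg A (phi * psi)
| SmoothInv phi of smooth_alg A phi & (forall p, A p -> phi p != 0) :
    smooth_alg A (fun p => (phi p)^-1).

Lemma smooth_algP A phi : open A -> smooth_alg A phi -> smooth_on A phi.
Proof.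
move=> oA; move: phi.
have cd phi : smooth_alg A phi -> forall p, A p ->
    {for p, continuous phi} /\ forall v, derivable phi p v.
  move=> P; elim: P => {phi} [phi sm|c|phi psi _ IH1 _ IH2|phi psi _ IH1 _ IH2
    |phi _ IH n0] p Ap.
  - exact: (sm [::]).
  - by split => [|v]; [exact: cst_continuous|exact: derivable_cst].
  - have [c1 d1] := IH1 p Ap; have [c2 d2] := IH2 p Ap.
    by split => [|v]; [exact: continuousD|exact: derivableD].
  - have [c1 d1] := IH1 p Ap; have [c2 d2] := IH2 p Ap.
    by split => [|v]; [exact: continuousM|exact: derivableM].
  - have [c1 d1] := IH p Ap.
    by split => [|v]; [apply: continuousV => //; exact: n0|apply: derivableV => //; exact: n0].
apply: smooth_coind => // phi P v.
elim: P => {phi} [phi sm|c|phi psi P1 [d1 Pd1 e1] P2 [d2 Pd2 e2]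
    |phi psi P1 [d1 Pd1 e1] P2 [d2 Pd2 e2]|phi P [d Pd e] n0].
- by exists ('D_v phi) => //; apply: SmoothBase; exact: smooth_derive.
- exists (cst 0); first exact: SmoothCst.
  by move=> p _; rewrite /= derive_cst.
- exists (d1 + d2); first exact: SmoothAdd.
  move=> p Ap /=.
  by rewrite deriveD ?e1 ?e2 //; [apply (cd _ P1)|apply (cd _ P2)].
- exists (phi * d2 + psi * d1); first by apply: SmoothAdd; exact: SmoothMul.
  move=> p Ap /=.
  by rewrite deriveM ?e1 ?e2 //; [apply (cd _ P1)|apply (cd _ P2)].
(* The derivative - phi^-2 d is spelled as a product with the constant -1, since opposites and
   powers are not constructors of [smooth_alg]. *)
- exists (cst (-1) * (fun p => (phi p)^-1) * (fun p => (phi p)^-1) * d).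
    by do !apply: SmoothMul => //; [exact: SmoothCst|exact: SmoothInv|exact: SmoothInv].
  move=> p Ap /=.
  rewrite deriveV ?e //; [|exact: n0|by apply (cd _ P)].
  rewrite !mulrfctE /cst /= -exprVn.
  change (- (phi p)^-1 ^+ 2 * d p = -1 * (phi p)^-1 * (phi p)^-1 * d p).
  by rewrite mulN1r expr2 mulNr.
Qed.

Variable A : set V.
Hypothesis oA : open A.

Lemma smooth_cst (c : R) : smooth_on A (fun=> c).
Proof. exact: (smooth_algP oA (SmoothCst _ c)). Qed.

Lemma smoothD phi psi : smooth_on A phi -> smooth_on A psi ->
  smooth_on A (fun p => phi p + psi p).
Proof.
move=> s1 s2; rewrite (_ : (fun p => _) = phi + psi); last by rewrite addrfctE.
exact: (smooth_algP oA (SmoothAdd (SmoothBase s1) (SmoothBase s2))).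
Qed.

Lemma smoothM phi psi : smooth_on A phi -> smooth_on A psi ->
  smooth_on A (fun p => phi p * psi p).
Proof.
move=> s1 s2; rewrite (_ : (fun p => _) = phi * psi); last by rewrite mulrfctE.
exact: (smooth_algP oA (SmoothMul (SmoothBase s1) (SmoothBase s2))).
Qed.

Lemma smoothV phi : smooth_on A phi -> (forall p, A p -> phi p != 0) ->
  smooth_on A (fun p => (phi p)^-1).
Proof. by move=> s1 n0; exact: (smooth_algP oA (SmoothInv (SmoothBase s1) n0)). Qed.

Lemma smoothN phi : smooth_on A phi -> smooth_on A (fun p => - phi p).
Proof.
move=> s1; apply: eq_smooth_on (smoothM (smooth_cst (-1)) s1) => // p _.
by rewrite mulN1r.
Qed.

Lemma smoothB phi psi : smooth_on A phi -> smooth_on A psi ->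
  smooth_on A (fun p => phi p - psi p).
Proof. by move=> s1 s2; exact: (smoothD s1 (smoothN s2)). Qed.

Lemma smoothX phi k : smooth_on A phi -> smooth_on A (fun p => phi p ^+ k).
Proof.
move=> s1; elim: k => [|k IHk].
  by apply: eq_smooth_on (smooth_cst 1) => // p _; rewrite expr0.
by apply: eq_smooth_on (smoothM s1 IHk) => // p _; rewrite exprS.
Qed.

Lemma smooth_sum (I : Type) (r : seq I) (P : pred I) (F : I -> V -> R) :
  (forall i, P i -> smooth_on A (F i)) ->
  smooth_on A (fun p => \sum_(i <- r | P i) F i p).
Proof.
move=> sF; elim: r => [|i r IHr].
  by apply: eq_smooth_on (smooth_cst 0) => // p _; rewrite big_nil.
have [Pi|nPi] := boolP (P i).
  by apply: eq_smooth_on (smoothD (sF i Pi) IHr) => // p _; rewrite big_cons Pi.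
by apply: eq_smooth_on IHr => // p _; rewrite big_cons (negPf nPi).
Qed.

Lemma smooth_prod (I : Type) (r : seq I) (P : pred I) (F : I -> V -> R) :
  (forall i, P i -> smooth_on A (F i)) ->
  smooth_on A (fun p => \prod_(i <- r | P i) F i p).
Proof.
move=> sF; elim: r => [|i r IHr].
  by apply: eq_smooth_on (smooth_cst 1) => // p _; rewrite big_nil.
have [Pi|nPi] := boolP (P i).
  by apply: eq_smooth_on (smoothM (sF i Pi) IHr) => // p _; rewrite big_cons Pi.
by apply: eq_smooth_on IHr => // p _; rewrite big_cons (negPf nPi).
Qed.

Lemma smooth_det k (M : V -> 'M[R]_k) :
  (forall i j, smooth_on A (fun p => M p i j)) -> smooth_on A (fun p => \det (M p)).
Proof.
move=> sM; rewrite /determinant; apply: smooth_sum => s _; apply: smoothM.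
  exact: smooth_cst.
by apply: smooth_prod => i _; exact: sM.
Qed.

(** By Cramer's rule an entry of the inverse is a cofactor, polynomial in the entries of [M],
    divided by a determinant that does not vanish on [A]. *)
Lemma smooth_invmx k (M : V -> 'M[R]_k) :
  (forall i j, smooth_on A (fun p => M p i j)) ->
  (forall p, A p -> M p \in unitmx) ->
  forall i j, smooth_on A (fun p => invmx (M p) i j).
Proof.
move=> sM uM i j.
have sd := smooth_det sM.
have sc : smooth_on A (fun p => \adj (M p) i j).
  rewrite (_ : (fun p => _) = fun p => (-1) ^+ (j + i) * \det (row' j (col' i (M p)))).
    apply: smoothM; first exact: smooth_cst.
    apply: smooth_det => a b; have := sM (lift j a) (lift i b).
    by rewrite (_ : (fun p => row' _ _ _ _) = fun p => M p (lift j a) (lift i b)) //;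
      apply/funext => p; rewrite !mxE.
  by apply/funext => p; rewrite mxE.
apply: eq_smooth_on (smoothM (smoothV sd _) sc) => //.
  by move=> p Ap; rewrite /invmx uM // [RHS]mxE.
by move=> p /uM; rewrite unitmxE unitfE.
Qed.

Section Rules.
Variables (phi psi : V -> R) (p v : V).
Hypotheses (sphi : smooth_on A phi) (spsi : smooth_on A psi) (Ap : A p).

Lemma smooth_deriveD : 'D_v (fun q => phi q + psi q) p = 'D_v phi p + 'D_v psi p.
Proof. exact: (deriveD (smooth_derivable sphi Ap) (smooth_derivable spsi Ap)). Qed.

Lemma smooth_deriveN : 'D_v (fun q => - phi q) p = - 'D_v phi p.
Proof. exact: (deriveN (smooth_derivable sphi Ap)). Qed.

Lemma smooth_deriveB : 'D_v (fun q => phi q - psi q) p = 'D_v phi p - 'D_v psi p.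
Proof. exact: (deriveB (smooth_derivable sphi Ap) (smooth_derivable spsi Ap)). Qed.

Lemma smooth_deriveM :
  'D_v (fun q => phi q * psi q) p = 'D_v phi p * psi p + phi p * 'D_v psi p.
Proof.
rewrite addrC [X in _ + X]mulrC.
exact: (deriveM (smooth_derivable sphi Ap) (smooth_derivable spsi Ap)).
Qed.

Lemma smooth_deriveMl (c : R) : 'D_v (fun q => c * phi q) p = c * 'D_v phi p.
Proof.
have := @deriveM _ _ (cst c) phi p v (derivable_cst _ _ _) (smooth_derivable sphi Ap).
by rewrite derive_cst scaler0 addr0.
Qed.

Lemma smooth_deriveX2 : 'D_v (fun q => phi q ^+ 2) p = 2 * phi p * 'D_v phi p.
Proof.
have := @deriveX _ _ phi 2 p v (smooth_derivable sphi Ap).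
by rewrite expr1.
Qed.

End Rules.

Lemma smooth_derive_sum (I : Type) (r : seq I) (F : I -> V -> R) p v :
  (forall i, smooth_on A (F i)) -> A p ->
  'D_v (fun q => \sum_(i <- r) F i q) p = \sum_(i <- r) 'D_v (F i) p.
Proof.
move=> sF Ap; elim: r => [|i r IHr].
  rewrite big_nil (_ : (fun q => _) = cst 0) ?derive_cst //.
  by apply/funext => q; rewrite big_nil.
rewrite big_cons -IHr -smooth_deriveD //; last exact: smooth_sum.
by congr ('D_v _ p); apply/funext => q; rewrite big_cons.
Qed.

End SmoothFunctions.

(** * Composition with linear maps *)

Section LinearPullback.
Variables (R : realType) (V W : normedModType R) (T : V -> W).
Hypotheses (Tadd : forall a b, T (a + b) = T a + T b)
  (Tscale : forall (c : R) a, T (c *: a) = c *: T a).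

(** Both sides are limits of the same difference quotient, so no chain rule enters and [phi] is
    arbitrary. *)
Lemma derive_comp_linear (phi : W -> R) v p :
  'D_v (phi \o T) p = 'D_(T v) phi (T p).
Proof.
by rewrite /derive; do 2 f_equal; apply/funext => h; rewrite /= Tadd Tscale.
Qed.

Lemma derivable_comp_linear (phi : W -> R) p v :
  derivable phi (T p) (T v) -> derivable (phi \o T) p v.
Proof.
rewrite /derivable; set g := fun h => _; set g' := fun h => _.
by rewrite (_ : g = g') //; apply/funext => h; rewrite /g /g' /= Tadd Tscale.
Qed.

Lemma smooth_comp_linear (A : set W) (phi : W -> R) : continuous T ->
  smooth_on A phi -> smooth_on (T @^-1` A) (phi \o T).
Proof.
move=> cT sm s p Ap.
have -> : iter_derive s (phi \o T) = iter_derive (map T s) phi \o T.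
  by elim: s => //= v s ->; apply/funext => q; rewrite derive_comp_linear.
have [c d] := sm (map T s) _ Ap; split.
  by apply: continuous_comp => //; exact: cT.
by move=> v; exact: derivable_comp_linear.
Qed.

(** The difference quotient along v is constantly phi v, so the first derivative does not depend on
    the point and the further ones are those of a constant. *)
Lemma linear_smooth (A : set V) (phi : V -> R) : continuous phi ->
  (forall a b, phi (a + b) = phi a + phi b) ->
  (forall (c : R) a, phi (c *: a) = c * phi a) -> open A ->
  smooth_on A phi /\ forall v p, 'D_v phi p = phi v.
Proof.
move=> cphi phiD phiZ oA.
have d p v : is_derive p v phi (phi v).
  have lim : h^-1 *: ((phi \o shift p) (h *: v) - phi p) @[h --> 0^'] --> phi v.
    apply: cvg_near_cst; near=> h.
    rewrite /= phiD phiZ addrK; apply: mulKf.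
    by near: h; exact: nbhs_dnbhs_neq.
  split; first by apply/cvg_ex; exists (phi v).
  exact: cvg_lim lim.
split => [|v p]; last exact: derive_val.
move=> s p Ap.
case: (lastP s) => [|s' v].
  by split => [|v]; [exact: cphi|have [] := d p v].
rewrite /iter_derive foldr_rcons -/(iter_derive _ _).
have -> : 'D_v phi = fun=> phi v by apply/funext => q; exact: derive_val.
exact: (smooth_cst oA (phi v) s' Ap).
Unshelve. all: by end_near. Qed.

End LinearPullback.

(** * Directional derivatives *)

Section DirectionalDerivatives.
Variables (R : realType) (V : normedModType R).
Implicit Types (phi psi : V -> R) (p u v : V).

(** Restriction to a line turns directional derivatives into ordinary ones, to which the
    one-variable mean value theorem and chain rule apply. *)
Lemma is_derive_line phi p v (t : R) : derivable phi (p + t *: v) v ->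
  is_derive t 1 (fun s : R => phi (p + s *: v)) ('D_v phi (p + t *: v)).
Proof.
have e : (fun h : R => h^-1 *: (((fun s : R => phi (p + s *: v)) \o shift t) (h *: 1)
            - phi (p + t *: v))) =
         (fun h => h^-1 *: ((phi \o shift (p + t *: v)) (h *: v) - phi (p + t *: v))).
  apply/funext => h /=; congr (_ *: (phi _ - _)).
  by rewrite scalerDl [h *: 1]mulr1 addrCA.
move=> d; split; first by rewrite /derivable e.
by rewrite /derive e.
Qed.

(** Infinitesimal form of Euler's relation in degree one: for small nonzero h the difference
    quotient is exactly phi p. *)
Lemma derive_homogeneous phi p v :
  (\forall h \near (0 : R), phi (p + h *: v) = (1 + h) * phi p) ->
  'D_v phi p = phi p.
Proof.
move=> H; apply: cvg_lim => //; apply: cvg_near_cst; near=> h.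
have h0 : h != 0 by near: h; exact: nbhs_dnbhs_neq.
rewrite /= [h *: v + p]addrC (_ : phi (p + h *: v) = (1 + h) * phi p).
  by rewrite mulrDl mul1r [phi p + _]addrC addrK; exact: mulKf.
by near: h; exact: nbhs_dnbhs.
Unshelve. all: by end_near. Qed.

Lemma MVT_line phi p v (h : R) : 0 < h ->
  (forall t, 0 <= t <= h -> derivable phi (p + t *: v) v) ->
  exists2 t, 0 <= t <= h & phi (p + h *: v) - phi p = h * 'D_v phi (p + t *: v).
Proof.
move=> h0 d.
have [t||t] := @MVT R (fun s => phi (p + s *: v)) (fun s => 'D_v phi (p + s *: v)) 0 h h0.
- by rewrite in_itv /= => /andP[t0 th]; apply: is_derive_line; apply: d; rewrite !ltW.
- apply: derivable_within_continuous => t; rewrite in_itv /= => th.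
  by have [] := is_derive_line (d t th).
rewrite in_itv /= => /andP[t0 th]; rewrite scale0r addr0 subr0 mulrC => ->.
by exists t => //; rewrite !ltW.
Qed.

Lemma near_parallelogram (P : set V) p u v : nbhs p P ->
  exists2 h : R, 0 < h &
    forall s t, 0 <= s <= h -> 0 <= t <= h -> P (p + s *: u + t *: v).
Proof.
move=> /nbhs_ballP [r /= r0 rP].
have N0 : 0 < `|u| + `|v| + 1 by rewrite ltr_wpDl // addr_ge0.
(* With this h the displacement s u + t v has norm at most h (|u| + |v| + 1) = r / 2 < r; the 1
   keeps the denominator positive when u = v = 0. *)
exists (r / (`|u| + `|v| + 1) / 2).
  by rewrite !divr_gt0.
set h := r / _ / 2; move=> s t /andP[s0 sh] /andP[t0 th].
apply: rP; rewrite -ball_normE /= -addrA opprD addNKr normrN.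
apply: le_lt_trans (ler_normD _ _) _; rewrite !normrZ !ger0_norm //.
apply: (@le_lt_trans _ _ (h * (`|u| + `|v| + 1))).
  rewrite mulrDr mulr1 mulrDr.
  have h0 : 0 <= h by exact: le_trans sh.
  by rewrite -[leLHS]addr0; do 2?apply: lerD => //; exact: ler_wpM2r.
rewrite /h mulrAC divfK ?gt_eqF //; lra.
Qed.

Lemma near_continuous phi p (e : R) : {for p, continuous phi} -> 0 < e ->
  nbhs p [set q | `|phi p - phi q| < e].
Proof. by move=> c e0; move/cvgrPdist_lt : c; apply. Qed.

Variable A : set V.
Hypothesis oA : open A.
Variable phi : V -> R.
Hypothesis sphi : smooth_on A phi.

(** The mean value theorem is used twice: along u for the increment q -> phi (q + h v) - phi q, then
    along v for ['D_u phi]. The intermediate point stays in the parallelogram. *)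
Lemma second_difference p u v (h : R) : 0 < h ->
  (forall s t, 0 <= s <= h -> 0 <= t <= h -> A (p + s *: u + t *: v)) ->
  exists s t, [/\ 0 <= s <= h, 0 <= t <= h &
    phi (p + h *: u + h *: v) - phi (p + h *: u) - (phi (p + h *: v) - phi p) =
      h * (h * 'D_v ('D_u phi) (p + s *: u + t *: v))].
Proof.
move=> h0 Ah.
have hh : 0 <= h <= h by rewrite lexx ltW.
have h00 : 0 <= (0 : R) <= h by rewrite lexx ltW.
pose psi q := phi (q + h *: v) - phi q.
have dpsi q : A (q + h *: v) -> A q -> is_derive q u psi ('D_u phi (q + h *: v) - 'D_u phi q).
  move=> A1 A2.
  have e : (fun k : R => k^-1 *: (((fun q => phi (q + h *: v)) \o shift q) (k *: u)
            - phi (q + h *: v))) =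
         (fun k => k^-1 *: ((phi \o shift (q + h *: v)) (k *: u) - phi (q + h *: v))).
    by apply/funext => k /=; rewrite addrA.
  have d1 : derivable (fun q => phi (q + h *: v)) q u.
    by rewrite /derivable e; exact: (smooth_derivable sphi A1).
  have d2 := smooth_derivable sphi A2 : derivable phi q u.
  split; first exact: (derivableB d1 d2).
  by have := deriveB d1 d2; rewrite {2}/derive e.
have Aq s : 0 <= s <= h -> A (p + s *: u + h *: v) /\ A (p + s *: u).
  move=> sh; split; first exact: Ah.
  by have := Ah s 0 sh h00; rewrite scale0r addr0.
have [|s sh] := @MVT_line psi p u h h0.
  by move=> t /Aq [A1 A2]; have [] := dpsi _ A1 A2.
rewrite {1 2}/psi => ->.
have [A1 A2] := Aq s sh; rewrite (@derive_val _ _ _ _ _ _ _ (dpsi _ A1 A2)).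
have [|t th ->] := @MVT_line ('D_u phi) (p + s *: u) v h h0.
  by move=> t th; exact: (smooth_derivable (smooth_derive u sphi) (Ah _ _ sh th)).
by exists s, t.
Qed.

(** The second difference over a parallelogram is symmetric in u and v, so it is h^2 times either
    mixed derivative, each taken at some point of the parallelogram. Continuity of both mixed
    derivatives then makes their values at p agree up to any e > 0, with e / 2 for each. *)
Lemma derive_comm p u v : A p -> 'D_v ('D_u phi) p = 'D_u ('D_v phi) p.
Proof.
move=> Ap; apply/eqP; rewrite -subr_eq0 -normr_eq0; apply/eqP/le_anti.
rewrite normr_ge0 andbT; apply/ler_addgt0Pr => e e0; rewrite add0r.
have e20 : 0 < e / 2 by rewrite divr_gt0.
have N w w' := near_continuous
  (smooth_continuous (smooth_derive w (smooth_derive w' sphi)) Ap) e20.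
have [h1 h10 H1] := near_parallelogram u v
  (filterI (open_nbhs_nbhs (conj oA Ap)) (N v u)).
have [h2 h20 H2] := near_parallelogram v u
  (filterI (open_nbhs_nbhs (conj oA Ap)) (N u v)).
pose h := Num.min h1 h2.
have h0 : 0 < h by rewrite lt_min h10.
have le1 s : 0 <= s <= h -> 0 <= s <= h1.
  by rewrite le_min => /and3P[-> ->].
have le2 s : 0 <= s <= h -> 0 <= s <= h2.
  by rewrite le_min => /and3P[-> _ ->].
have [|s [t [sh th E1]]] := @second_difference p u v h h0.
  by move=> s t sh th; have [] := H1 s t (le1 _ sh) (le1 _ th).
have [|s' [t' [sh' th' E2]]] := @second_difference p v u h h0.
  by move=> s' t' sh' th'; have [] := H2 s' t' (le2 _ sh') (le2 _ th').
have [_ /= B1] := H1 s t (le1 _ sh) (le1 _ th).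
have [_ /= B2] := H2 s' t' (le2 _ sh') (le2 _ th').
move: B1 B2 E1 E2; rewrite [p + h *: v + h *: u]addrAC.
move: ('D_v ('D_u phi) (p + s *: u + t *: v)) => X.
move: ('D_u ('D_v phi) (p + s' *: v + t' *: u)) => Y.
move: (phi (p + h *: u + h *: v)) (phi (p + h *: u)) (phi (p + h *: v)) (phi p).
move=> a b c d B1 B2 E1 E2.
have XY : X = Y.
  apply: (mulfI (lt0r_neq0 h0)); apply: (mulfI (lt0r_neq0 h0)).
  by rewrite -E1 -E2; ring.
rewrite {}XY in B1; move: ('D_v ('D_u phi) p) ('D_u ('D_v phi) p) B1 B2 => x y.
rewrite !ltr_norml !ler_norml => /andP[? ?] /andP[? ?].
by apply/andP; split; lra.
Qed.

(** The increment along u + v is the increment along u followed by the one along v from p + h u.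
    Each is h times a derivative at a nearby point; continuity of the three derivatives, with e / 3
    for each, concludes. *)
Lemma deriveDdir p u v : A p -> 'D_(u + v) phi p = 'D_u phi p + 'D_v phi p.
Proof.
move=> Ap; apply/eqP; rewrite -subr_eq0 -normr_eq0; apply/eqP/le_anti.
rewrite normr_ge0 andbT; apply/ler_addgt0Pr => e e0; rewrite add0r.
have e30 : 0 < e / 3 by rewrite divr_gt0.
have N w := near_continuous (smooth_continuous (smooth_derive w sphi) Ap) e30.
have [h h0 H] := near_parallelogram u v
  (filterI (open_nbhs_nbhs (conj oA Ap)) (filterI (N (u + v)) (filterI (N u) (N v)))).
have hh : 0 <= h <= h by rewrite lexx ltW.
have h00 : 0 <= (0 : R) <= h by rewrite lexx ltW.
have Huv s : 0 <= s <= h -> p + s *: (u + v) = p + s *: u + s *: v.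
  by move=> _; rewrite scalerDr addrA.
have Hu s : p + s *: u = p + s *: u + 0 *: v by rewrite scale0r addr0.
have [|s sh E1] := @MVT_line phi p (u + v) h h0.
  by move=> t th; rewrite Huv //; apply: (smooth_derivable sphi); have [] := H t t th th.
have [|t th E2] := @MVT_line phi p u h h0.
  by move=> t th; rewrite Hu //; apply: (smooth_derivable sphi); have [] := H t 0 th h00.
have [|r rh E3] := @MVT_line phi (p + h *: u) v h h0.
  by move=> t' th'; apply: (smooth_derivable sphi); have [] := H h t' hh th'.
have [_ [/= B1 _]] := H s s sh sh.
have [_ [_ [/= B2 _]]] := H t 0 th h00.
have [_ [_ [_ /= B3]]] := H h r hh rh.
move: B1 B2 B3 E1 E2 E3; rewrite (Huv h) // (Huv s) // -(Hu t).
move: ('D_(u + v) phi (p + s *: u + s *: v)) => X.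
move: ('D_u phi (p + t *: u)) ('D_v phi (p + h *: u + r *: v)) => Y Z.
move: (phi (p + h *: u + h *: v)) (phi (p + h *: u)) (phi p).
move=> x y z B1 B2 B3 E1 E2 E3.
have E : X = Y + Z.
  by apply: (mulfI (lt0r_neq0 h0)); rewrite mulrDr -E1 -E2 -E3; ring.
move: B1 B2 B3; rewrite E; move: ('D_(u + v) phi p) ('D_u phi p) ('D_v phi p) => a b c.
rewrite !ltr_norml !ler_norml => /andP[? ?] /andP[? ?] /andP[? ?].
by apply/andP; split; lra.
Qed.

(** The parameter of the line is rescaled and the one-variable chain rule applied at 0; c may be
    zero or negative. *)
Lemma deriveZdir p (c : R) v : A p -> 'D_(c *: v) phi p = c * 'D_v phi p.
Proof.
move=> Ap; pose g s := phi (p + s *: v).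
have Ap0 : A (p + 0 *: v) by rewrite scale0r addr0.
have [d0 E0] : is_derive (0 : R) 1 g ('D_v phi p).
  have := @is_derive_line phi p v 0 (smooth_derivable sphi Ap0).
  by rewrite scale0r addr0.
have Ap1 : A (p + 0 *: (c *: v)) by rewrite scale0r addr0.
have [_ <-] : is_derive (0 : R) 1 (fun s => phi (p + s *: (c *: v))) ('D_(c *: v) phi p).
  have := @is_derive_line phi p (c *: v) 0 (smooth_derivable sphi Ap1).
  by rewrite scale0r addr0.
rewrite (_ : (fun s => _) = g \o (fun s => c * s)); last first.
  by apply/funext => s; rewrite /g /= scalerA mulrC.
have [dc Ec] : is_derive (0 : R) 1 (fun s : R => c * s) c.
  by have := @is_deriveZ R R R id c 0 1 1 (is_derive_id (0 : R) (1 : R)); rewrite [c *: 1]mulr1.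
have d0' : derivable g (c * 0) 1 by rewrite mulr0.
by have := derive1_comp dc d0'; rewrite !derive1E mulr0 E0 Ec mulrC.
Qed.

Lemma derive_sum_dir (I : Type) (r : seq I) (w : I -> V) p : A p ->
  'D_(\sum_(i <- r) w i) phi p = \sum_(i <- r) 'D_(w i) phi p.
Proof.
move=> Ap; elim: r => [|i r IHr]; first by rewrite !big_nil derive0.
by rewrite !big_cons deriveDdir // IHr.
Qed.

End DirectionalDerivatives.

(** * Local Finsler calculus *)

(* Deciding that two distinct derivatives differ by unfolding them does not
   terminate in practice. *)
#[local] Opaque derive.

Section Coordinates.
Variables (R : realType) (d : nat).
Local Notation TM := ('rV[R]_d * 'rV[R]_d)%type.
Variable A : set TM.
Hypothesis oA : open A.
Implicit Types (phi psi : TM -> R) (p : TM) (a b c e : 'I_d).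

Lemma eq_dbase_on phi psi a : (forall q, A q -> phi q = psi q) ->
  forall p, A p -> dbase a phi p = dbase a psi p.
Proof. by move=> e p; exact: (eq_derive_on _ oA e). Qed.

Lemma eq_dfib_on phi psi a : (forall q, A q -> phi q = psi q) ->
  forall p, A p -> dfib a phi p = dfib a psi p.
Proof. by move=> e p; exact: (eq_derive_on _ oA e). Qed.

Lemma smooth_dbase phi a : smooth_on A phi -> smooth_on A (dbase a phi).
Proof. exact: smooth_derive. Qed.

Lemma smooth_dfib phi a : smooth_on A phi -> smooth_on A (dfib a phi).
Proof. exact: smooth_derive. Qed.

Lemma smooth_fib_coord c :
  smooth_on A (fun p => p.2 0 c) /\
  forall v q : TM, 'D_v (fun p : TM => p.2 0 c) q = v.2 0 c.
Proof.
apply: linear_smooth => //.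
- move=> p; apply: (@continuous_comp _ _ _ snd (fun v : 'rV[R]_d => v 0 c)).
    exact: cvg_snd.
  exact: coord_continuous.
- by move=> p q; rewrite mxE.
- by move=> k p; rewrite mxE.
Qed.

Lemma dfib_fib_coord a c p : dfib a (fun q => q.2 0 c) p = (c == a)%:R.
Proof. by rewrite /dfib (smooth_fib_coord c).2 /= mxE eqxx. Qed.

Variable L : TM -> R.
Hypothesis sE : smooth_on A (energy L).

Lemma smooth_fund a b : smooth_on A (fund L a b).
Proof.
apply: (smoothM oA); first exact: smooth_cst.
by do 2!apply: smooth_dfib.
Qed.

Lemma fundC a b p : A p -> fund L a b p = fund L b a p.
Proof.
move=> Ap; exact: (congr1 (fun z => 2^-1 * z)
  (derive_comm oA sE (0, delta_mx 0 b) (0, delta_mx 0 a) Ap)).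
Qed.

Lemma cartanC12 a b c p : A p -> cartan L a b c p = cartan L b a c p.
Proof.
move=> Ap; exact: (congr1 (fun z => 2^-1 * z) (eq_dfib_on c (fun q => @fundC a b q) Ap)).
Qed.

Lemma cartanE a b c p : A p ->
  cartan L a b c p = 2^-1 * (2^-1 * dfib c (dfib a (dfib b (energy L))) p).
Proof.
move=> Ap; rewrite /cartan /dfib; congr (_ * _).
by rewrite (smooth_deriveMl _ (smooth_dfib a (smooth_dfib b sE)) Ap).
Qed.

(** The two outer fibre derivatives of [dfib b (energy L)] commute. Together with [cartanC12] this
    generates all permutations of the indices. *)
Lemma cartanC13 a b c p : A p -> cartan L a b c p = cartan L c b a p.
Proof.
move=> Ap; apply: etrans (cartanE a b c Ap) (etrans _ (esym (cartanE c b a Ap))).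
exact: (congr1 (fun z => 2^-1 * (2^-1 * z)) (derive_comm oA (smooth_dfib b sE)
  (0, delta_mx 0 a) (0, delta_mx 0 c) Ap)).
Qed.

Lemma cartanC23 a b c p : A p -> cartan L a b c p = cartan L a c b p.
Proof.
move=> Ap.
apply: (etrans (cartanC12 a b c Ap)); apply: (etrans (cartanC13 b a c Ap)).
exact: (cartanC12 c a b Ap).
Qed.

Lemma cartan1C a b c p : A p -> cartan1 L a b c p = cartan1 L a c b p.
Proof. by move=> Ap; apply: eq_bigr => e _; rewrite cartanC23. Qed.

Hypothesis uG : forall p, A p -> \matrix_(i, j) fund L i j p \in unitmx.

Lemma smooth_fundinv a b : smooth_on A (fundinv L a b).
Proof.
apply: (smooth_invmx oA) => [i j|//].
by under eq_fun do rewrite mxE; exact: smooth_fund.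
Qed.

Lemma fund_fundinv a c p : A p ->
  \sum_b fund L a b p * fundinv L b c p = (a == c)%:R.
Proof.
move=> Ap; have /matrixP/(_ a c) := mulmxV (uG Ap); rewrite !mxE => <-.
by apply: eq_bigr => b _; rewrite mxE.
Qed.

Lemma fundinv_fund a c p : A p ->
  \sum_b fundinv L a b p * fund L b c p = (a == c)%:R.
Proof.
move=> Ap; have /matrixP/(_ a c) := mulVmx (uG Ap); rewrite !mxE => <-.
by apply: eq_bigr => b _; rewrite mxE.
Qed.

Lemma fundinv_ylow a p : A p -> \sum_b fundinv L a b p * ylow L b p = p.2 0 a.
Proof.
move=> Ap; under eq_bigr do rewrite /ylow mulr_sumr.
rewrite exchange_big /= (bigD1 a) //= [X in _ + X]big1 => [|c ca].
  under eq_bigr do rewrite mulrA.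
  by rewrite -mulr_suml fundinv_fund // eqxx mul1r addr0.
under eq_bigr do rewrite mulrA.
by rewrite -mulr_suml fundinv_fund // eq_sym (negPf ca) mul0r.
Qed.

Lemma fundinvC a b p : A p -> fundinv L a b p = fundinv L b a p.
Proof.
move=> Ap; rewrite /fundinv.
have e : (\matrix_(i, j) fund L i j p)^T = \matrix_(i, j) fund L i j p.
  by apply/matrixP => i j; rewrite !mxE fundC.
by rewrite -[in RHS]e -trmx_inv mxE.
Qed.

Lemma cartan2E a b c p : A p ->
  cartan2 L a b c p = \sum_h cartan1 L a h c p * fundinv L h b p.
Proof.
move=> Ap; rewrite /cartan2 exchange_big /=; apply: eq_bigr => h _.
rewrite mulr_suml; apply: eq_bigr => e _.
by rewrite (fundinvC h b Ap) mulrAC.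
Qed.

Lemma smooth_spray a : smooth_on A (spray L a).
Proof.
apply: (smoothM oA); first exact: smooth_cst.
apply: (smooth_sum oA) => b _; apply: (smoothM oA); first exact: smooth_fundinv.
apply: (smoothB oA); last exact: smooth_dbase.
apply: (smooth_sum oA) => c _; apply: (smoothM oA).
  by apply: smooth_dfib; exact: smooth_dbase.
exact: (smooth_fib_coord c).1.
Qed.

Lemma smooth_nlconn a b : smooth_on A (nlconn L a b).
Proof. exact/smooth_dfib/smooth_spray. Qed.

Lemma smooth_hder a phi : smooth_on A phi -> smooth_on A (hder L a phi).
Proof.
move=> s; apply: (smoothB oA); first exact: smooth_dbase.
apply: (smooth_sum oA) => b _; apply: (smoothM oA); first exact: smooth_nlconn.
exact: smooth_dfib.
Qed.

Lemma smooth_hconn c a b : smooth_on A (hconn L c a b).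
Proof.
apply: (smoothM oA); first exact: smooth_cst.
apply: (smooth_sum oA) => e _; apply: (smoothM oA); first exact: smooth_fundinv.
by apply: (smoothB oA); [apply: (smoothD oA)|]; apply/smooth_hder/smooth_fund.
Qed.

Lemma eq_hder_on phi psi a : (forall q, A q -> phi q = psi q) ->
  forall p, A p -> hder L a phi p = hder L a psi p.
Proof.
move=> e p Ap; rewrite /hder (eq_dbase_on a e Ap); congr (_ - _).
by apply: eq_bigr => b _; rewrite (eq_dfib_on b e Ap).
Qed.

(** Meant for the off-diagonal blocks of the fundamental tensor of the product, which vanish on an
    open set and not just at one point. *)
Lemma hder_eq0_on phi a p : (forall q, A q -> phi q = 0) -> A p -> hder L a phi p = 0.
Proof.
move=> e Ap; rewrite (eq_hder_on a e Ap) /hder /dbase derive_cst big1 ?subr0 // => b _.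
by rewrite /dfib derive_cst mulr0.
Qed.

Lemma dfib_fund a b c p : dfib c (fund L a b) p = 2 * cartan L a b c p.
Proof. by rewrite /cartan mulrA mulfV ?mul1r // pnatr_eq0. Qed.

Section HderRules.
Variables (phi psi : TM -> R) (a : 'I_d) (p : TM).
Hypotheses (sphi : smooth_on A phi) (spsi : smooth_on A psi) (Ap : A p).

Lemma hderD : hder L a (fun q => phi q + psi q) p = hder L a phi p + hder L a psi p.
Proof.
rewrite /hder /dbase (smooth_deriveD _ sphi spsi Ap).
rewrite (_ : \sum_b _ = \sum_b nlconn L b a p * dfib b phi p
  + \sum_b nlconn L b a p * dfib b psi p); first by rewrite opprD addrACA.
rewrite -big_split; apply: eq_bigr => b _.
by rewrite /dfib (smooth_deriveD _ sphi spsi Ap) mulrDr.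
Qed.

Lemma hderN : hder L a (fun q => - phi q) p = - hder L a phi p.
Proof.
rewrite /hder /dbase (smooth_deriveN _ sphi Ap) opprD; congr (_ - _).
rewrite -sumrN; apply: eq_bigr => b _.
by rewrite /dfib (smooth_deriveN _ sphi Ap) mulrN.
Qed.

Lemma hderM :
  hder L a (fun q => phi q * psi q) p = hder L a phi p * psi p + phi p * hder L a psi p.
Proof.
rewrite /hder /dbase (smooth_deriveM _ sphi spsi Ap) mulrBl mulrBr addrACA; congr (_ + _).
rewrite -opprD mulr_suml mulr_sumr -big_split; congr (- _); apply: eq_bigr => b _ /=.
rewrite /dfib (smooth_deriveM _ sphi spsi Ap).
move: (nlconn L b a p) ('D_ _ phi p) ('D_ _ psi p) (phi p) (psi p) => x y z t w.
by ring.
Qed.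

End HderRules.

Lemma hderB phi psi a p : smooth_on A phi -> smooth_on A psi -> A p ->
  hder L a (fun q => phi q - psi q) p = hder L a phi p - hder L a psi p.
Proof.
by move=> s1 s2 Ap; rewrite (hderD _ s1 (smoothN oA s2) Ap) (hderN _ s2 Ap).
Qed.

Lemma hconnC c a b p : A p -> hconn L c a b p = hconn L c b a p.
Proof.
move=> Ap; apply: (congr1 (fun z => 2^-1 * z)); apply: eq_bigr => e _.
apply: (congr1 (fun z => fundinv L c e p * z)).
exact: (congr2 (fun x y => x - y) (addrC _ _) (eq_hder_on e (fun q => @fundC a b q) Ap)).
Qed.

Lemma derive_fundinv a b v p : A p -> 'D_v (fundinv L a b) p =
  - \sum_c \sum_e fundinv L a c p * 'D_v (fund L c e) p * fundinv L e b p.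
Proof.
move=> Ap.
(* Differentiate g^ac g_ce = delta^a_e. *)
have H e : \sum_c ('D_v (fundinv L a c) p * fund L c e p) =
    - \sum_c fundinv L a c p * 'D_v (fund L c e) p.
  apply/eqP; rewrite -subr_eq0 opprK -big_split /=; apply/eqP.
  transitivity ('D_v (fun q => \sum_c fundinv L a c q * fund L c e q) p).
    rewrite (smooth_derive_sum oA _ _ _ Ap).
      apply: eq_bigr => c _.
      by rewrite (smooth_deriveM _ (smooth_fundinv a c) (smooth_fund c e) Ap).
    by move=> c; exact: (smoothM oA (smooth_fundinv a c) (smooth_fund c e)).
  have E q : A q -> \sum_c fundinv L a c q * fund L c e q = cst (a == e)%:R q.
    exact: fundinv_fund.
  by rewrite (eq_derive_on v oA E Ap) derive_cst.
transitivity (\sum_e \sum_c ('D_v (fundinv L a c) p * fund L c e p) * fundinv L e b p).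
  rewrite exchange_big /= (bigD1 b) //= [X in _ + X]big1 ?addr0.
    under eq_bigr do rewrite -mulrA.
    by rewrite -mulr_sumr fund_fundinv // eqxx mulr1.
  move=> c cb; under eq_bigr do rewrite -mulrA.
  by rewrite -mulr_sumr fund_fundinv // (negPf cb) mulr0.
rewrite [in RHS]exchange_big /= -sumrN; apply: eq_bigr => e _.
by rewrite -mulr_suml H mulNr mulr_suml.
Qed.

Lemma dfib_fundinv a b c p : A p ->
  dfib c (fundinv L a b) p = - (2 * cartan2 L a b c p).
Proof.
move=> Ap; rewrite /dfib derive_fundinv //; congr (- _).
rewrite /cartan2 mulr_sumr; apply: eq_bigr => e _.
rewrite mulr_sumr; apply: eq_bigr => h _.
rewrite (fundinvC b h Ap) /cartan /dfib.
move: (fundinv L a e p) (fundinv L h b p) ('D_ _ _ _) => x y z.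
by field.
Qed.

Hypothesis cone : forall p (t : R), A p -> 0 < t -> A (p.1, t *: p.2).
Hypothesis homog : forall p (t : R), A p -> 0 < t ->
  energy L (p.1, t *: p.2) = t ^+ 2 * energy L p.

(** Differentiating E(x, t y) = t^2 E(x, y) along the fibre produces a factor t on the left, which
    is then cancelled. *)
Lemma dfib_energy_homog a p (t : R) : A p -> 0 < t ->
  dfib a (energy L) (p.1, t *: p.2) = t * dfib a (energy L) p.
Proof.
move=> Ap t0; pose S (q : TM) : TM := (q.1, t *: q.2).
have SD q q' : S (q + q') = S q + S q' by rewrite /S scalerDr.
have SZ k q : S (k *: q) = k *: S q.
  by apply/eqP; rewrite xpair_eqE /= !scalerA mulrC !eqxx.
pose w : TM := (0, delta_mx 0 a).
have Sw : S w = t *: w by rewrite /S /w; congr pair; rewrite /= ?scaler0.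
have H : 'D_w (energy L \o S) p = t * dfib a (energy L) (S p).
  rewrite (derive_comp_linear SD SZ) /= Sw.
  by rewrite (deriveZdir sE _ _ (cone Ap t0)).
have E q : A q -> (energy L \o S) q = t ^+ 2 * energy L q.
  by move=> Aq; exact: homog.
apply: (mulfI (lt0r_neq0 t0)); rewrite -[LHS]H (eq_derive_on w oA E Ap).
by rewrite (smooth_deriveMl _ sE Ap) mulrA.
Qed.

(** The fibre derivative of the energy has degree one, so it equals its own derivative along the
    radial direction. Expanding that direction in the coordinate basis gives the contraction of 2
    g_ab with y^b. *)
Lemma dfib_energy a p : A p -> dfib a (energy L) p = 2 * ylow L a p.
Proof.
move=> Ap; pose psi := dfib a (energy L); have spsi : smooth_on A psi by exact: smooth_dfib.
pose w : TM := (0, p.2).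
have H : 'D_w psi p = psi p.
  apply: derive_homogeneous; near=> h.
  (* Homogeneity is available for positive factors only, hence the restriction to |h| < 1. *)
  have h1 : 0 < 1 + h.
    have : `|h| < 1 by near: h; exact: (@nbhs0_lt R R 1 ltr01).
    by rewrite ltr_norml => /andP[? _]; rewrite -ltrBlDl sub0r.
  rewrite -dfib_energy_homog // /psi; congr (dfib _ _ _).
  rewrite /w; apply/eqP; rewrite xpair_eqE /= scaler0 addr0 scalerDl scale1r !eqxx.
  by [].
have ew : w = \sum_b p.2 0 b *: ((0, delta_mx 0 b) : TM).
  rewrite [RHS]surjective_pairing /w; congr pair.
    rewrite (big_morph fst (id1 := 0) (op1 := +%R)) //.
    by rewrite big1 // => b _; rewrite /= scaler0.
  rewrite (big_morph snd (id1 := 0) (op1 := +%R)) //=.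
  exact: row_sum_delta.
rewrite -[LHS]H ew (derive_sum_dir oA spsi) // /ylow mulr_sumr; apply: eq_bigr => b _.
rewrite (deriveZdir spsi) // fundC // /fund /psi -/(dfib b _ p) mulrA mulrA mulfV.
  by rewrite mul1r mulrC.
by rewrite pnatr_eq0.
Unshelve. all: by end_near. Qed.

End Coordinates.

(** * Coordinates on the product *)

Section Projections.
Variables (R : realType) (m n : nat).
Local Notation TM := ('rV[R]_(m + n) * 'rV[R]_(m + n))%type.
Local Notation T1 := ('rV[R]_m * 'rV[R]_m)%type.
Local Notation T2 := ('rV[R]_n * 'rV[R]_n)%type.
Local Notation TB := ('rV[R]_m * 'rV[R]_n)%type.
Local Notation X := (lshift n).
Local Notation U := (@rshift m n).

Lemma lsubmx_deltaX (i : 'I_m) : lsubmx (delta_mx 0 (X i) : 'rV[R]_(m + n)) = delta_mx 0 i.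
Proof. by apply/rowP => k; rewrite !mxE eqxx /= eq_lshift. Qed.

Lemma rsubmx_deltaX (i : 'I_m) : rsubmx (delta_mx 0 (X i) : 'rV[R]_(m + n)) = 0.
Proof. by apply/rowP => k; rewrite !mxE eqxx /= eq_rlshift. Qed.

Lemma lsubmx_deltaU (a : 'I_n) : lsubmx (delta_mx 0 (U a) : 'rV[R]_(m + n)) = 0.
Proof. by apply/rowP => k; rewrite !mxE eqxx /= eq_lrshift. Qed.

Lemma rsubmx_deltaU (a : 'I_n) : rsubmx (delta_mx 0 (U a) : 'rV[R]_(m + n)) = delta_mx 0 a.
Proof. by apply/rowP => k; rewrite !mxE eqxx /= eq_rshift. Qed.

Lemma lsubmxD (a b : 'rV[R]_(m + n)) : lsubmx (a + b) = lsubmx a + lsubmx b.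
Proof. by apply/rowP => k; rewrite !mxE. Qed.

Lemma rsubmxD (a b : 'rV[R]_(m + n)) : rsubmx (a + b) = rsubmx a + rsubmx b.
Proof. by apply/rowP => k; rewrite !mxE. Qed.

Lemma lsubmxZ (c : R) (a : 'rV[R]_(m + n)) : lsubmx (c *: a) = c *: lsubmx a.
Proof. by apply/rowP => k; rewrite !mxE. Qed.

Lemma rsubmxZ (c : R) (a : 'rV[R]_(m + n)) : rsubmx (c *: a) = c *: rsubmx a.
Proof. by apply/rowP => k; rewrite !mxE. Qed.

Lemma lsubmx0 : lsubmx (0 : 'rV[R]_(m + n)) = 0.
Proof. by apply/rowP => k; rewrite !mxE. Qed.

Lemma rsubmx0 : rsubmx (0 : 'rV[R]_(m + n)) = 0.
Proof. by apply/rowP => k; rewrite !mxE. Qed.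

Lemma tproj1D (p q : TM) : tproj1 (p + q) = tproj1 p + tproj1 q.
Proof. by rewrite /tproj1 !lsubmxD. Qed.
Lemma tproj2D (p q : TM) : tproj2 (p + q) = tproj2 p + tproj2 q.
Proof. by rewrite /tproj2 !rsubmxD. Qed.
Lemma tbaseD (p q : TM) : tbase (p + q) = tbase p + tbase q.
Proof. by rewrite /tbase lsubmxD rsubmxD. Qed.
Lemma tproj1Z (c : R) (p : TM) : tproj1 (c *: p) = c *: tproj1 p.
Proof. by rewrite /tproj1 !lsubmxZ. Qed.
Lemma tproj2Z (c : R) (p : TM) : tproj2 (c *: p) = c *: tproj2 p.
Proof. by rewrite /tproj2 !rsubmxZ. Qed.
Lemma tbaseZ (c : R) (p : TM) : tbase (c *: p) = c *: tbase p.
Proof. by rewrite /tbase lsubmxZ rsubmxZ. Qed.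

Lemma continuous_fst_lsubmx : continuous (fun p : TM => lsubmx p.1).
Proof.
move=> p; apply: (@continuous_comp _ _ _ fst (@lsubmx R 1 m n)); first exact: cvg_fst.
exact: continuous_lsubmx.
Qed.

Lemma continuous_fst_rsubmx : continuous (fun p : TM => rsubmx p.1).
Proof.
move=> p; apply: (@continuous_comp _ _ _ fst (@rsubmx R 1 m n)); first exact: cvg_fst.
exact: continuous_rsubmx.
Qed.

Lemma continuous_snd_lsubmx : continuous (fun p : TM => lsubmx p.2).
Proof.
move=> p; apply: (@continuous_comp _ _ _ snd (@lsubmx R 1 m n)); first exact: cvg_snd.
exact: continuous_lsubmx.
Qed.

Lemma continuous_snd_rsubmx : continuous (fun p : TM => rsubmx p.2).
Proof.
move=> p; apply: (@continuous_comp _ _ _ snd (@rsubmx R 1 m n)); first exact: cvg_snd.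
exact: continuous_rsubmx.
Qed.

Lemma continuous_tproj1 : continuous (@tproj1 R m n).
Proof.
by move=> p; exact: (cvg_pair (@continuous_fst_lsubmx p) (@continuous_snd_lsubmx p)).
Qed.

Lemma continuous_tproj2 : continuous (@tproj2 R m n).
Proof.
by move=> p; exact: (cvg_pair (@continuous_fst_rsubmx p) (@continuous_snd_rsubmx p)).
Qed.

Lemma continuous_tbase : continuous (@tbase R m n).
Proof.
by move=> p; exact: (cvg_pair (@continuous_fst_lsubmx p) (@continuous_fst_rsubmx p)).
Qed.

Lemma tproj1_baseX i : tproj1 ((delta_mx 0 (X i), 0) : TM) = (delta_mx 0 i, 0).
Proof. by rewrite /tproj1 lsubmx_deltaX lsubmx0. Qed.
Lemma tproj1_fibX i : tproj1 ((0, delta_mx 0 (X i)) : TM) = (0, delta_mx 0 i).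
Proof. by rewrite /tproj1 lsubmx_deltaX lsubmx0. Qed.
Lemma tproj1_baseU a : tproj1 ((delta_mx 0 (U a), 0) : TM) = 0.
Proof. by rewrite /tproj1 lsubmx_deltaU lsubmx0. Qed.
Lemma tproj1_fibU a : tproj1 ((0, delta_mx 0 (U a)) : TM) = 0.
Proof. by rewrite /tproj1 lsubmx_deltaU lsubmx0. Qed.
Lemma tproj2_baseX i : tproj2 ((delta_mx 0 (X i), 0) : TM) = 0.
Proof. by rewrite /tproj2 rsubmx_deltaX rsubmx0. Qed.
Lemma tproj2_fibX i : tproj2 ((0, delta_mx 0 (X i)) : TM) = 0.
Proof. by rewrite /tproj2 rsubmx_deltaX rsubmx0. Qed.
Lemma tproj2_baseU a : tproj2 ((delta_mx 0 (U a), 0) : TM) = (delta_mx 0 a, 0).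
Proof. by rewrite /tproj2 rsubmx_deltaU rsubmx0. Qed.
Lemma tproj2_fibU a : tproj2 ((0, delta_mx 0 (U a)) : TM) = (0, delta_mx 0 a).
Proof. by rewrite /tproj2 rsubmx_deltaU rsubmx0. Qed.
Lemma tbase_baseX i : tbase ((delta_mx 0 (X i), 0) : TM) = (delta_mx 0 i, 0).
Proof. by rewrite /tbase lsubmx_deltaX rsubmx_deltaX. Qed.
Lemma tbase_baseU a : tbase ((delta_mx 0 (U a), 0) : TM) = (0, delta_mx 0 a).
Proof. by rewrite /tbase lsubmx_deltaU rsubmx_deltaU. Qed.
Lemma tbase_fib (v : 'rV[R]_(m + n)) : tbase ((0, v) : TM) = 0.
Proof. by rewrite /tbase lsubmx0 rsubmx0. Qed.

(** A function pulled back along a projection sees a coordinate direction only through its image,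
    which is a coordinate direction of the factor or zero. As the projections are linear, this and
    its analogues hold for arbitrary functions. *)
Lemma dbaseX_tproj1 i (phi : T1 -> R) (q : TM) :
  dbase (X i) (fun p : TM => phi (tproj1 p)) q = dbase i phi (tproj1 q).
Proof.
rewrite /dbase [LHS](derive_comp_linear tproj1D tproj1Z phi).
by rewrite tproj1_baseX.
Qed.

Lemma dfibX_tproj1 i (phi : T1 -> R) (q : TM) :
  dfib (X i) (fun p : TM => phi (tproj1 p)) q = dfib i phi (tproj1 q).
Proof.
rewrite /dfib [LHS](derive_comp_linear tproj1D tproj1Z phi).
by rewrite tproj1_fibX.
Qed.

Lemma dbaseU_tproj1 a (phi : T1 -> R) (q : TM) :
  dbase (U a) (fun p : TM => phi (tproj1 p)) q = 0.
Proof.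
rewrite /dbase [LHS](derive_comp_linear tproj1D tproj1Z phi).
by rewrite tproj1_baseU derive0.
Qed.

Lemma dfibU_tproj1 a (phi : T1 -> R) (q : TM) :
  dfib (U a) (fun p : TM => phi (tproj1 p)) q = 0.
Proof.
rewrite /dfib [LHS](derive_comp_linear tproj1D tproj1Z phi).
by rewrite tproj1_fibU derive0.
Qed.

Lemma dbaseX_tproj2 i (phi : T2 -> R) (q : TM) :
  dbase (X i) (fun p : TM => phi (tproj2 p)) q = 0.
Proof.
rewrite /dbase [LHS](derive_comp_linear tproj2D tproj2Z phi).
by rewrite tproj2_baseX derive0.
Qed.

Lemma dfibX_tproj2 i (phi : T2 -> R) (q : TM) :
  dfib (X i) (fun p : TM => phi (tproj2 p)) q = 0.
Proof.
rewrite /dfib [LHS](derive_comp_linear tproj2D tproj2Z phi).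
by rewrite tproj2_fibX derive0.
Qed.

Lemma dbaseU_tproj2 a (phi : T2 -> R) (q : TM) :
  dbase (U a) (fun p : TM => phi (tproj2 p)) q = dbase a phi (tproj2 q).
Proof.
rewrite /dbase [LHS](derive_comp_linear tproj2D tproj2Z phi).
by rewrite tproj2_baseU.
Qed.

Lemma dfibU_tproj2 a (phi : T2 -> R) (q : TM) :
  dfib (U a) (fun p : TM => phi (tproj2 p)) q = dfib a phi (tproj2 q).
Proof.
rewrite /dfib [LHS](derive_comp_linear tproj2D tproj2Z phi).
by rewrite tproj2_fibU.
Qed.

Lemma dbaseX_tbase i (f : TB -> R) (q : TM) :
  dbase (X i) (fun p : TM => f (tbase p)) q = df1 f i q.
Proof.
rewrite /dbase [LHS](derive_comp_linear tbaseD tbaseZ f).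
by rewrite tbase_baseX.
Qed.

Lemma dbaseU_tbase a (f : TB -> R) (q : TM) :
  dbase (U a) (fun p : TM => f (tbase p)) q = df2 f a q.
Proof.
rewrite /dbase [LHS](derive_comp_linear tbaseD tbaseZ f).
by rewrite tbase_baseU.
Qed.

Lemma dfib_tbase a (f : TB -> R) (q : TM) :
  dfib a (fun p : TM => f (tbase p)) q = 0.
Proof.
rewrite /dfib [LHS](derive_comp_linear tbaseD tbaseZ f).
by rewrite tbase_fib derive0.
Qed.

Lemma fib_coordX (q : TM) k : q.2 0 (X k) = (tproj1 q).2 0 k.
Proof. by rewrite /= mxE. Qed.

Lemma fib_coordU (q : TM) k : q.2 0 (U k) = (tproj2 q).2 0 k.
Proof. by rewrite /= mxE. Qed.

End Projections.

(** * Algebra of the curvature formulas *)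

(* The curvature formulas only depend on the shape of the connection
   coefficients and on the linearity and locality of the horizontal derivative,
   so both are abstract here: [K] stands for F^c_ab, [D] for delta^t, [S] for
   smoothness; an index [X i] is Latin, an index [U a] is Greek. *)
Section CurvatureAlgebra.
Variables (R : realType) (m n : nat) (T : Type) (A : T -> Prop) (p : T).
Hypothesis Ap : A p.
Local Notation X := (lshift n).
Local Notation U := (@rshift m n).
Implicit Types (phi psi : T -> R) (i j k l r s h : 'I_m) (a b c d : 'I_n).
Variables (S : (T -> R) -> Prop) (D : 'I_(m + n) -> (T -> R) -> T -> R).
Hypothesis D_eq : forall z phi psi,
  (forall q, A q -> phi q = psi q) -> D z phi p = D z psi p.
Hypothesis D_opp : forall z phi, S phi -> D z (fun q => - phi q) p = - D z phi p.
Variable K : 'I_(m + n) -> 'I_(m + n) -> 'I_(m + n) -> T -> R.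
Hypothesis SK : forall x y z, S (K x y z).
Hypothesis K_sym : forall x y z q, A q -> K x y z q = K x z y q.
Variable G : 'I_(m + n) -> 'I_(m + n) -> T -> R.
Variables (gi1 : 'I_m -> 'I_m -> T -> R) (C1 Cu1 H1 M1c : 'I_m -> 'I_m -> 'I_m -> T -> R).
Variables (g2 gi2 : 'I_n -> 'I_n -> T -> R).
Variables (C2 Cu2 Cuu2 H2 M2c N : 'I_n -> 'I_n -> 'I_n -> T -> R).
Variables (f0 : T -> R) (f1 fu : 'I_m -> T -> R).
Hypothesis f0_neq0 : f0 p != 0.
Hypothesis fuE : forall i q, fu i q = \sum_h gi1 i h q * f1 h q.
Hypothesis Cu1E : forall i j k q, Cu1 i j k q = \sum_h gi1 i h q * C1 h j k q.
Hypothesis Cu2E : forall c a b q, Cu2 c a b q = \sum_d gi2 c d q * C2 d a b q.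
Hypothesis Cuu2E : forall c a b, Cuu2 c a b p = \sum_d Cu2 c d b p * gi2 d a p.
Hypothesis gi1C : forall i j, gi1 i j p = gi1 j i p.
Hypothesis gi2C : forall a b, gi2 a b p = gi2 b a p.
Hypothesis g2C : forall a b, g2 a b p = g2 b a p.
Hypothesis g2K : forall a b, \sum_c g2 a c p * gi2 c b p = (a == b)%:R.
Hypothesis C1C : forall i j k, C1 i j k p = C1 j i k p.
Hypothesis C2C : forall a b c, C2 a b c p = C2 b a c p.
Hypothesis Cu2C : forall a b c q, A q -> Cu2 a b c q = Cu2 a c b q.
Local Notation kd a b := ((a == b)%:R).

Hypothesis K_XXX : forall i j k q, A q ->
  K (X i) (X j) (X k) q = H1 i j k q - M1c i j k q.
Hypothesis K_XXU : forall i j b q, A q ->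
  K (X i) (X j) (U b) q = - \sum_r G (X r) (U b) q * Cu1 i j r q.
Hypothesis K_XUU : forall i a b q, A q -> K (X i) (U a) (U b) q =
  - (f0 q * (fu i q * g2 a b q
     - \sum_d \sum_h f0 q * G (U d) (X h) q * gi1 i h q * C2 a b d q)).
Hypothesis K_UXX : forall c i j q, A q -> K (U c) (X i) (X j) q =
  \sum_d \sum_r f0 q ^- 2 * gi2 c d q * G (X r) (U d) q * C1 i j r q.
Hypothesis K_UXU : forall c i b q, A q -> K (U c) (X i) (U b) q =
  (f0 q)^-1 * f1 i q * kd c b - \sum_d G (U d) (X i) q * Cu2 c b d q.
Hypothesis K_UUU : forall c a b q, A q ->
  K (U c) (U a) (U b) q = H2 c a b q + N c a b q - M2c c a b q.

(** * Blocks of the connection and their contractions *)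

Local Notation curv y x z w := (D w (K x y z) p - D z (K x y w) p
  + \sum_e K x w e p * K e y z p - \sum_e K x z e p * K e y w p).

Local Notation KX i j k := (H1 i j k p - M1c i j k p).
Local Notation KU c a b := (H2 c a b p + N c a b p - M2c c a b p).
(** At [p] the mixed blocks are K_XXU = - P, K_XUU = - f W, K_UXU = f^-1 V and K_UXX = Z; [Y] is [W]
    with its Latin index lowered. *)
Local Notation P i j b := (\sum_r G (X r) (U b) p * Cu1 i j r p).
Local Notation W i a b := (fu i p * g2 a b p
     - \sum_d \sum_h f0 p * G (U d) (X h) p * gi1 i h p * C2 a b d p).
Local Notation Y h a b := (f1 h p * g2 a b p - \sum_d f0 p * G (U d) (X h) p * C2 a b d p).
Local Notation V c i b := (f1 i p * kd c b - \sum_d f0 p * G (U d) (X i) p * Cu2 c b d p).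
Local Notation Z c i j :=
  (\sum_d \sum_r f0 p ^- 2 * gi2 c d p * G (X r) (U d) p * C1 i j r p).

(** The curvature is the antisymmetrisation in its last two indices of one derivative plus one
    contraction. When these indices are of the same type, [u] being [X] or [U], only this half has
    to be computed. *)
Lemma skew_curvature (I : Type) (y x : 'I_(m + n)) (u : I -> 'I_(m + n))
    (E : I -> I -> R) (v w : I) :
  (forall v w, D (u w) (K x y (u v)) p + \sum_e K x (u w) e p * K e y (u v) p = E v w) ->
  curv y x (u v) (u w) = skew E v w.
Proof. by move=> e; rewrite /skew -!e; ring. Qed.

Lemma K_UXU_V c i b : K (U c) (X i) (U b) p = (f0 p)^-1 * V c i b.
Proof.
rewrite K_UXU // mulrBr mulrA; congr (_ - _); rewrite mulr_sumr.
by apply: eq_bigr => d _; rewrite mulrA mulrA mulVf // mul1r.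
Qed.

Lemma K_UUX_V c b i : K (U c) (U b) (X i) p = (f0 p)^-1 * V c i b.
Proof. by rewrite K_sym // K_UXU_V. Qed.

Lemma K_XUX i b j q : A q -> K (X i) (U b) (X j) q = - \sum_r G (X r) (U b) q * Cu1 i j r q.
Proof. by move=> Aq; rewrite K_sym // K_XXU. Qed.

(** The sign is extracted on the side of [K], whose smoothness is known; the explicit expression
    [psi] then needs no smoothness proof of its own. *)
Lemma D_K_opp z x y w psi : (forall q, A q -> K x y w q = - psi q) ->
  D z (K x y w) p = - D z psi p.
Proof.
move=> e; apply: (canRL (@opprK R)); rewrite -(D_opp z (SK x y w)); apply: D_eq => q Aq.
by rewrite e // opprK.
Qed.

Lemma W_sym i a b : W i a b = W i b a.
Proof.
rewrite g2C; congr (_ - _); apply: eq_bigr => d _; apply: eq_bigr => h _.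
by rewrite C2C.
Qed.

Lemma W_raise1 i a b : W i a b = \sum_h gi1 i h p * Y h a b.
Proof.
rewrite fuE mulr_suml exchange_big /= -sumrB; apply: eq_bigr => h _.
rewrite mulrBr mulrA; congr (_ - _); rewrite mulr_sumr; apply: eq_bigr => d _.
by ring.
Qed.

(** Raising a Greek index contracts g2 to a Kronecker symbol and, by symmetry of the Cartan tensor,
    turns [C2] into [Cu2]. *)
Lemma W_raise2 i a c : \sum_b W i a b * gi2 b c p =
  fu i p * kd c a - \sum_d \sum_h f0 p * G (U d) (X h) p * gi1 i h p * Cu2 c a d p.
Proof.
under eq_bigr do rewrite mulrBl; rewrite sumrB; congr (_ - _).
  by under eq_bigr do rewrite -mulrA; rewrite -mulr_sumr g2K eq_sym.
under eq_bigr do rewrite mulr_suml; rewrite exchange_big; apply: eq_bigr => d _ /=.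
under eq_bigr do rewrite mulr_suml; rewrite exchange_big; apply: eq_bigr => h _ /=.
rewrite Cu2E mulr_sumr; apply: eq_bigr => b _.
by rewrite (C2C b a) (gi2C c b); ring.
Qed.

Lemma V_raise c i a : \sum_b V c i b * gi2 b a p =
  f1 i p * gi2 c a p - \sum_d f0 p * G (U d) (X i) p * Cuu2 c a d p.
Proof.
under eq_bigr do rewrite mulrBl; rewrite sumrB; congr (_ - _).
  rewrite (bigD1 c) //= eqxx mulr1 big1 ?addr0 // => b /negPf.
  by rewrite eq_sym => ->; rewrite mulr0 mul0r.
under eq_bigr do rewrite mulr_suml; rewrite exchange_big; apply: eq_bigr => d _ /=.
by rewrite Cuu2E mulr_sumr; apply: eq_bigr => b _; rewrite mulrA.
Qed.

(** The contraction is moved innermost, where [C1_raise] can act on it; [mul_Z] does the same for a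
    Greek contraction, in view of [W_raise2] and [V_raise]. *)
Lemma Z_mul c i (u : 'I_m -> R) : \sum_j Z c i j * u j =
  \sum_d \sum_r f0 p ^- 2 * gi2 c d p * G (X r) (U d) p * \sum_j C1 i j r p * u j.
Proof.
under eq_bigr do rewrite mulr_suml; rewrite exchange_big; apply: eq_bigr => d _ /=.
under eq_bigr do rewrite mulr_suml; rewrite exchange_big; apply: eq_bigr => r _ /=.
by rewrite mulr_sumr; apply: eq_bigr => j _; rewrite mulrA.
Qed.

Lemma mul_Z i j (u : 'I_n -> R) : \sum_c u c * Z c i j =
  \sum_r \sum_d f0 p ^- 2 * G (X r) (U d) p * C1 i j r p * \sum_c u c * gi2 c d p.
Proof.
under eq_bigr do rewrite mulr_sumr; rewrite exchange_big [RHS]exchange_big /=.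
apply: eq_bigr => d _ /=.
under eq_bigr do rewrite mulr_sumr; rewrite exchange_big; apply: eq_bigr => r _ /=.
by rewrite mulr_sumr; apply: eq_bigr => b _; ring.
Qed.

(** The inverse metric moves from [u] to the Cartan tensor: C_lhs g^hk u_k = C^h_ls u_h. *)
Lemma C1_raise l s (u : 'I_m -> R) :
  \sum_h C1 l h s p * (\sum_k gi1 h k p * u k) = \sum_h Cu1 h l s p * u h.
Proof.
under eq_bigr do rewrite mulr_sumr; rewrite exchange_big; apply: eq_bigr => k _ /=.
rewrite Cu1E mulr_suml; apply: eq_bigr => h _.
by rewrite (C1C l h) (gi1C h k); ring.
Qed.

Lemma P_mul i b (u : 'I_m -> R) :
  \sum_r P i r b * u r = \sum_s \sum_r G (X s) (U b) p * Cu1 i r s p * u r.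
Proof. by under eq_bigr do rewrite mulr_suml; rewrite exchange_big. Qed.

Lemma PP i j a b : \sum_r P i r a * P r j b =
  \sum_s \sum_l \sum_r G (X s) (U a) p * G (X l) (U b) p * Cu1 i r s p * Cu1 r j l p.
Proof.
rewrite P_mul; apply: eq_bigr => s _; under eq_bigr do rewrite mulr_sumr.
rewrite exchange_big; apply: eq_bigr => l _; apply: eq_bigr => r _ /=.
by ring.
Qed.

Lemma mul_P j b (u : 'I_m -> R) :
  \sum_r u r * P r j b = \sum_r \sum_s u r * G (X s) (U b) p * Cu1 r j s p.
Proof.
by apply: eq_bigr => r _; rewrite mulr_sumr; apply: eq_bigr => s _; rewrite mulrA.
Qed.

(** The contraction C^h_ls C_hjr common to two of the curvature components: the inverse metric
    inside the [Cu1] of [P] is transferred to the [C1] of [Z]. *)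
Lemma ZP c l j b : \sum_h Z c l h * P h j b =
  \sum_d \sum_s \sum_r \sum_h f0 p ^- 2 * gi2 c d p * G (X s) (U d) p
    * G (X r) (U b) p * Cu1 h l s p * C1 h j r p.
Proof.
rewrite Z_mul; apply: eq_bigr => d _; apply: eq_bigr => s _.
rewrite (_ : \sum_h _ = \sum_r G (X r) (U b) p * \sum_h Cu1 h l s p * C1 h j r p).
  rewrite mulr_sumr; apply: eq_bigr => r _; rewrite !mulr_sumr; apply: eq_bigr => h _.
  by rewrite !mulrA.
under eq_bigr do rewrite mulr_sumr; rewrite exchange_big; apply: eq_bigr => r _ /=.
rewrite -C1_raise mulr_sumr; apply: eq_bigr => h _.
by rewrite Cu1E mulrCA.
Qed.

Lemma curvature_XUXX i k l a :
  curv (U a) (X i) (X k) (X l) = skew (fun k l =>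
    - D (X l) (fun q => \sum_r G (X r) (U a) q * Cu1 i k r q) p
    - \sum_r \sum_s (H1 i r l p - M1c i r l p) * G (X s) (U a) p * Cu1 r k s p
    - \sum_b \sum_r (f0 p)^-1 * G (X r) (U b) p * Cu1 i l r p * f1 k p * kd b a
    + \sum_b \sum_r \sum_d G (X r) (U b) p * G (U d) (X k) p
        * Cu1 i l r p * Cu2 b a d p) k l.
Proof.
apply: (@skew_curvature _ _ _ X) => {}k {}l; rewrite big_split_ord /=.
rewrite (D_K_opp _ (@K_XUX i a k)) -!addrA; congr (_ + _); congr (_ + _).
  rewrite -mul_P -sumrN; apply: eq_bigr => r _.
  by rewrite K_sym // K_XXX // K_XUX // mulrN.
rewrite -sumrN -big_split; apply: eq_bigr => b _ /=.
rewrite K_XXU // K_UUX_V mulNr mulr_suml -sumrN -[X in _ = X + _]sumrN -big_split.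
apply: eq_bigr => r _ /=.
(* The Cartan part of [V] carries a factor f that cancels the f^-1 of K_UUX. It is restored here so
   that both parts of [V] have the same coefficient. *)
rewrite (_ : \sum_(d < n) G (X r) (U b) p * _ * _ * _ = G (X r) (U b) p * Cu1 i l r p
  * (f0 p)^-1 * \sum_d f0 p * G (U d) (X k) p * Cu2 b a d p); first by ring.
by rewrite mulr_sumr; apply: eq_bigr => d _; field.
Qed.

Lemma curvature_XXUU i j b c :
  curv (X j) (X i) (U b) (U c) = skew (fun b c =>
    - D (U c) (fun q => \sum_r G (X r) (U b) q * Cu1 i j r q) p
    + \sum_s \sum_l \sum_r G (X s) (U c) p * G (X l) (U b) p
        * Cu1 i r s p * Cu1 r j l p
    - \sum_a (fu i p * g2 a c p
         - \sum_d \sum_h f0 p * G (U d) (X h) p * gi1 i h p * C2 a c d p)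
        * (f1 j p * kd a b - \sum_d f0 p * G (U d) (X j) p * Cu2 a b d p)) b c.
Proof.
apply: (@skew_curvature _ _ _ U) => {}b {}c; rewrite big_split_ord /=.
rewrite (D_K_opp _ (@K_XXU i j b)) -!addrA; congr (_ + _); congr (_ + _).
  by rewrite -PP; apply: eq_bigr => r _; rewrite K_XUX // K_XXU // mulrNN.
rewrite -sumrN; apply: eq_bigr => a _; rewrite K_XUU // K_UXU_V W_sym.
by move: (\sum_d _) (\sum_d _) => u v; field.
Qed.

(** The last two indices are of different types, so the two halves of the curvature are unrelated.
    Each quadratic term splits into a Latin and a Greek contraction; the four are evaluated
    separately, and afterwards only signs remain. *)
Lemma curvature_XUUX i l a b :
  curv (U a) (X i) (U b) (X l) =
    D (U b) (fun q => \sum_r G (X r) (U a) q * Cu1 i l r q) p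
    - D (X l) (fun q => f0 q * (fu i q * g2 a b q
        - \sum_d \sum_h f0 q * G (U d) (X h) q * gi1 i h q * C2 a b d q)) p
    - \sum_t \sum_s \sum_r G (X t) (U b) p * G (X s) (U a) p
        * Cu1 i r t p * Cu1 r l s p
    + \sum_c (fu i p * g2 c b p
         - \sum_d \sum_h f0 p * G (U d) (X h) p * gi1 i h p * C2 c b d p)
        * (f1 l p * kd c a - \sum_d f0 p * G (U d) (X l) p * Cu2 c a d p)
    - \sum_r \sum_h f0 p * gi1 r h p * (H1 i r l p - M1c i r l p)
        * (f1 h p * g2 a b p - \sum_d f0 p * G (U d) (X h) p * C2 a b d p)
    - \sum_r \sum_c G (X r) (U c) p * Cu1 i l r p
        * (H2 c a b p + N c a b p - M2c c a b p).
Proof.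
rewrite (D_K_opp _ (@K_XUU i a b)) (D_K_opp _ (@K_XUX i a l)) !big_split_ord /= -PP.
have -> : \sum_(e < m) K (X i) (X l) (X e) p * K (X e) (U a) (U b) p =
   - \sum_r \sum_h f0 p * gi1 r h p * KX i r l * Y h a b.
  rewrite -sumrN; apply: eq_bigr => r _.
  rewrite K_sym // K_XXX // K_XUU // W_raise1 mulrN; congr (- _).
  by rewrite !mulr_sumr; apply: eq_bigr => h _; ring.
have -> : \sum_(e < n) K (X i) (X l) (U e) p * K (U e) (U a) (U b) p =
   - \sum_r \sum_c G (X r) (U c) p * Cu1 i l r p * KU c a b.
  rewrite exchange_big -sumrN; apply: eq_bigr => c _ /=.
  by rewrite K_XXU // K_UUU // mulNr mulr_suml.
have -> : \sum_(e < m) K (X i) (U b) (X e) p * K (X e) (U a) (X l) p =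
   \sum_r P i r b * P r l a.
  by apply: eq_bigr => r _; rewrite !K_XUX // mulrNN.
have -> : \sum_(e < n) K (X i) (U b) (U e) p * K (U e) (U a) (X l) p =
   - \sum_c W i c b * V c l a.
  rewrite -sumrN; apply: eq_bigr => c _; rewrite K_XUU // K_UUX_V W_sym.
  by move: (\sum_d _) (\sum_d _) => u v; field.
move: (\sum_r _) (\sum_r _) (\sum_r _) (\sum_c _) (D _ _ _) (D _ _ _) => ? ? ? ? ? ?.
by ring.
Qed.

Lemma curvature_XXUX i j l b :
  curv (X j) (X i) (U b) (X l) =
    - D (X l) (fun q => \sum_r G (X r) (U b) q * Cu1 i j r q) p
    - D (U b) (fun q => H1 i j l q - M1c i j l q) p
    - \sum_r \sum_s (H1 i l r p - M1c i l r p) * G (X s) (U b) p * Cu1 r j s p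
    - \sum_r \sum_a (f0 p)^-1 * G (X r) (U a) p * Cu1 i l r p
        * (f1 j p * kd a b - \sum_d f0 p * G (U d) (X j) p * Cu2 a b d p)
    + \sum_s \sum_r G (X s) (U b) p * Cu1 i r s p * (H1 r j l p - M1c r j l p)
    + \sum_r \sum_c (f0 p)^-1 * G (X r) (U c) p * C1 j l r p
        * (fu i p * kd c b - \sum_d \sum_h f0 p * G (U d) (X h) p * gi1 i h p
             * Cu2 c b d p).
Proof.
rewrite (D_K_opp _ (@K_XXU i j b)) (D_eq _ (@K_XXX i j l)) !big_split_ord /= -mul_P.
have -> : \sum_(e < m) K (X i) (X l) (X e) p * K (X e) (X j) (U b) p =
   - \sum_r KX i l r * P r j b.
  by rewrite -sumrN; apply: eq_bigr => r _; rewrite K_XXX // K_XXU // mulrN.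
have -> : \sum_(e < n) K (X i) (X l) (U e) p * K (U e) (X j) (U b) p =
   - \sum_r \sum_a (f0 p)^-1 * G (X r) (U a) p * Cu1 i l r p * V a j b.
  rewrite exchange_big -sumrN; apply: eq_bigr => a _ /=.
  rewrite K_XXU // K_UXU_V mulNr mulr_suml; congr (- _); apply: eq_bigr => r _.
  by ring.
have -> : \sum_(e < m) K (X i) (U b) (X e) p * K (X e) (X j) (X l) p =
   - \sum_s \sum_r G (X s) (U b) p * Cu1 i r s p * KX r j l.
  by rewrite -P_mul -sumrN; apply: eq_bigr => r _; rewrite K_XUX // K_XXX // mulNr.
have -> : \sum_(e < n) K (X i) (U b) (U e) p * K (U e) (X j) (X l) p =
   - \sum_r \sum_c (f0 p)^-1 * G (X r) (U c) p * C1 j l r p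
        * (fu i p * kd c b - \sum_d \sum_h f0 p * G (U d) (X h) p * gi1 i h p
             * Cu2 c b d p).
  (* The factor gi2 inside [Z] raises the Greek index of [W], and f times f^-2 leaves f^-1. *)
  transitivity (- (f0 p * \sum_c W i b c * Z c j l)).
    rewrite mulr_sumr -sumrN; apply: eq_bigr => c _.
    by rewrite K_XUU // K_UXX // mulNr mulrA.
  rewrite mul_Z mulr_sumr; congr (- _); apply: eq_bigr => r _.
  rewrite mulr_sumr; apply: eq_bigr => c _; rewrite W_raise2.
  by move: (\sum_d _) => u; field.
move: (\sum_r _) (\sum_r _) (\sum_r _) (\sum_s _) (D _ _ _) (D _ _ _) => ? ? ? ? ? ?.
by ring.
Qed.

Lemma W_exchange i a b q :
  \sum_h \sum_d f0 q * gi1 i h q * G (U d) (X h) q * C2 a b d q =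
  \sum_d \sum_h f0 q * G (U d) (X h) q * gi1 i h q * C2 a b d q.
Proof.
by rewrite exchange_big; apply: eq_bigr => d _; apply: eq_bigr => h _ /=; ring.
Qed.

Lemma curvature_XUUU i a b c :
  curv (U a) (X i) (U b) (U c) = skew (fun b c =>
    - D (U c) (fun q => f0 q * fu i q * g2 a b q
        - \sum_h \sum_d f0 q ^+ 2 * gi1 i h q * G (U d) (X h) q * C2 a b d q) p
    + \sum_s \sum_r f0 p * G (X s) (U c) p * Cu1 i r s p
        * (fu r p * g2 a b p
           - \sum_d \sum_l f0 p * G (U d) (X l) p * C2 a b d p * gi1 r l p)
    - \sum_d f0 p * (fu i p * g2 c d p
           - \sum_h \sum_e f0 p * gi1 i h p * G (U e) (X h) p * C2 c d e p)
        * (H2 d a b p + N d a b p - M2c d a b p)) b c.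
Proof.
apply: (@skew_curvature _ _ _ U) => {}b {}c; rewrite big_split_ord /= -!addrA; congr (_ + _).
  apply: D_K_opp => q Aq; rewrite K_XUU // -W_exchange mulrBr mulrA; congr (- (_ - _)).
  by rewrite mulr_sumr; apply: eq_bigr => h _; rewrite mulr_sumr; apply: eq_bigr => d _; ring.
congr (_ + _).
  transitivity (\sum_r P i r c * (f0 p * W r a b)).
    by apply: eq_bigr => r _; rewrite K_XUX // K_XUU // mulrNN.
  rewrite P_mul; apply: eq_bigr => s _; apply: eq_bigr => r _.
  rewrite (_ : \sum_d \sum_l f0 p * G (U d) (X l) p * C2 a b d p * gi1 r l p =
    \sum_d \sum_h f0 p * G (U d) (X h) p * gi1 r h p * C2 a b d p).
    by move: (\sum_d _) => u; ring.
  by apply: eq_bigr => d _; apply: eq_bigr => h _; rewrite mulrAC.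
rewrite -sumrN; apply: eq_bigr => d _; rewrite K_XUU // K_UUU // W_exchange.
by move: (\sum_d _) => u; ring.
Qed.

Lemma curvature_UXXX j k l c :
  curv (X j) (U c) (X k) (X l) = skew (fun k l =>
    D (X l) (fun q => \sum_d \sum_r f0 q ^- 2 * gi2 c d q
        * G (X r) (U d) q * C1 j k r q) p
    + \sum_d \sum_s \sum_r f0 p ^- 2 * gi2 c d p * G (X s) (U d) p
        * C1 l r s p * (H1 r j k p - M1c r j k p)
    + \sum_r \sum_a f0 p ^- 3 * G (X r) (U a) p * C1 j k r p
        * (f1 l p * gi2 c a p - \sum_d f0 p * G (U d) (X l) p * Cuu2 c a d p)) k l.
Proof.
apply: (@skew_curvature _ _ _ X) => {}k {}l.
rewrite big_split_ord /= (D_eq _ (@K_UXX c j k)) -!addrA; congr (_ + _); congr (_ + _).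
  transitivity (\sum_r Z c l r * KX r j k).
    by apply: eq_bigr => r _; rewrite K_UXX // K_XXX.
  rewrite Z_mul; apply: eq_bigr => d _; apply: eq_bigr => s _; rewrite mulr_sumr.
  by apply: eq_bigr => r _; rewrite mulrA.
(* The coefficient f^-3 arises from the f^-1 of K_UXU and the f^-2 of [Z]; raising the index of [V]
   by the gi2 in [Z] yields [Cuu2]. *)
transitivity ((f0 p)^-1 * \sum_a V c l a * Z a j k).
  by rewrite mulr_sumr; apply: eq_bigr => a _; rewrite K_UXU_V K_UXX // mulrA.
rewrite mul_Z mulr_sumr; apply: eq_bigr => r _; rewrite mulr_sumr; apply: eq_bigr => a _.
rewrite V_raise; move: (\sum_d _) => u; by field.
Qed.

Lemma curvature_UXUX j l c b :
  curv (X j) (U c) (U b) (X l) =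
    D (X l) (fun q => (f0 q)^-1 * f1 j q * kd c b
        - \sum_d G (U d) (X j) q * Cu2 c d b q) p
    - D (U b) (fun q => \sum_d \sum_r f0 q ^- 2 * gi2 c d q
        * G (X r) (U d) q * C1 j l r q) p
    - \sum_d \sum_s \sum_t \sum_h f0 p ^- 2 * gi2 c d p
        * G (X s) (U d) p * G (X t) (U b) p * Cu1 h l s p * C1 h j t p
    + \sum_a f0 p ^- 2
        * (f1 l p * kd c a - \sum_d f0 p * G (U d) (X l) p * Cu2 c a d p)
        * (f1 j p * kd a b - \sum_d f0 p * G (U d) (X j) p * Cu2 a b d p)
    - \sum_r (f0 p)^-1
        * (f1 r p * kd c b - \sum_d f0 p * G (U d) (X r) p * Cu2 c b d p)
        * (H1 r j l p - M1c r j l p)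
    - \sum_a \sum_d \sum_r f0 p ^- 2 * gi2 a d p * G (X r) (U d) p
        * C1 j l r p * (H2 c b a p + N c b a p - M2c c b a p).
Proof.
rewrite (D_eq _ (@K_UXX c j l)) !big_split_ord /= -ZP.
(* The lower indices of [Cu2] are swapped under the derivative, hence at all points of [A] and not
   only at [p]. *)
have -> : D (X l) (K (U c) (X j) (U b)) p = D (X l) (fun q => (f0 q)^-1 * f1 j q * kd c b
        - \sum_d G (U d) (X j) q * Cu2 c d b q) p.
  apply: D_eq => q Aq; rewrite K_UXU //; congr (_ - _); apply: eq_bigr => d _.
  by rewrite Cu2C.
have -> : \sum_(e < m) K (U c) (X l) (X e) p * K (X e) (X j) (U b) p =
   - \sum_h Z c l h * P h j b.
  by rewrite -sumrN; apply: eq_bigr => h _; rewrite K_UXX // K_XXU // mulrN.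
have -> : \sum_(e < n) K (U c) (X l) (U e) p * K (U e) (X j) (U b) p =
   \sum_a f0 p ^- 2 * V c l a * V a j b.
  apply: eq_bigr => a _; rewrite !K_UXU_V.
  by move: (\sum_d _) (\sum_d _) => u v; field.
have -> : \sum_(e < m) K (U c) (U b) (X e) p * K (X e) (X j) (X l) p =
   \sum_r (f0 p)^-1 * V c r b * KX r j l.
  by apply: eq_bigr => r _; rewrite K_UUX_V K_XXX.
have -> : \sum_(e < n) K (U c) (U b) (U e) p * K (U e) (X j) (X l) p =
   \sum_a \sum_d \sum_r f0 p ^- 2 * gi2 a d p * G (X r) (U d) p * C1 j l r p * KU c b a.
  apply: eq_bigr => a _; rewrite K_UUU // K_UXX // mulrC mulr_suml; apply: eq_bigr => d _.
  by rewrite mulr_suml.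
move: (\sum_h _) (\sum_r _) (\sum_a _) (\sum_a _) (D _ _ _) (D _ _ _) => ? ? ? ? ? ?.
by ring.
Qed.

Lemma curvature_UUUX l c a b :
  curv (U a) (U c) (U b) (X l) =
    D (X l) (fun q => H2 c a b q + N c a b q - M2c c a b q) p
    - D (U b) (fun q => (f0 q)^-1 * f1 l q * kd c a
        - \sum_d G (U d) (X l) q * Cu2 c a d q) p
    - \sum_d \sum_s \sum_h (f0 p)^-1 * gi2 c d p * G (X s) (U d) p * Cu1 h l s p
        * (f1 h p * g2 a b p - \sum_e f0 p * G (U e) (X h) p * C2 a b e p)
    + \sum_d (f0 p)^-1
        * (f1 l p * kd c d - \sum_e f0 p * G (U e) (X l) p * Cu2 c d e p)
        * (H2 d a b p + N d a b p - M2c d a b p)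
    + \sum_s \sum_r (f0 p)^-1 * G (X s) (U a) p * Cu1 r l s p
        * (f1 r p * kd c b - \sum_e f0 p * G (U e) (X r) p * Cu2 c b e p)
    - \sum_d (f0 p)^-1
        * (f1 l p * kd d a - \sum_e f0 p * G (U e) (X l) p * Cu2 d a e p)
        * (H2 c b d p + N c b d p - M2c c b d p).
Proof.
rewrite (D_eq _ (@K_UUU c a b)) !big_split_ord /=.
have -> : D (U b) (K (U c) (U a) (X l)) p = D (U b) (fun q => (f0 q)^-1 * f1 l q * kd c a
        - \sum_d G (U d) (X l) q * Cu2 c a d q) p.
  by apply: D_eq => q Aq; rewrite K_sym // K_UXU.
have -> : \sum_(e < m) K (U c) (X l) (X e) p * K (X e) (U a) (U b) p =
   - \sum_d \sum_s \sum_h (f0 p)^-1 * gi2 c d p * G (X s) (U d) p * Cu1 h l s p * Y h a b.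
  (* The gi1 inside [W] is moved onto the Cartan tensor of [Z], which leaves [Y] contracted with
     [Cu1], and f^-2 times f is f^-1. *)
  transitivity (- \sum_h Z c l h * (f0 p * W h a b)).
    by rewrite -sumrN; apply: eq_bigr => h _; rewrite K_UXX // K_XUU // mulrN.
  rewrite Z_mul; congr (- _); apply: eq_bigr => d _; apply: eq_bigr => s _.
  transitivity ((f0 p)^-1 * gi2 c d p * G (X s) (U d) p * \sum_h Cu1 h l s p * Y h a b).
    rewrite -C1_raise.
    have -> : \sum_h C1 l h s p * (f0 p * W h a b) =
        f0 p * \sum_h C1 l h s p * \sum_k gi1 h k p * Y k a b.
      by rewrite mulr_sumr; apply: eq_bigr => h _; rewrite W_raise1 mulrCA.
    by move: (\sum_h _) => u; field.
  by rewrite mulr_sumr; apply: eq_bigr => h _; rewrite mulrA.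
have -> : \sum_(e < n) K (U c) (X l) (U e) p * K (U e) (U a) (U b) p =
   \sum_d (f0 p)^-1 * V c l d * KU d a b.
  by apply: eq_bigr => d _; rewrite K_UXU_V K_UUU.
have -> : \sum_(e < m) K (U c) (U b) (X e) p * K (X e) (U a) (X l) p =
   - \sum_s \sum_r (f0 p)^-1 * G (X s) (U a) p * Cu1 r l s p * V c r b.
  rewrite exchange_big -sumrN; apply: eq_bigr => r _ /=.
  rewrite K_UUX_V K_XUX // mulrN; congr (- _); rewrite mulr_sumr; apply: eq_bigr => s _.
  by move: (\sum_e _) => u; ring.
have -> : \sum_(e < n) K (U c) (U b) (U e) p * K (U e) (U a) (X l) p =
   \sum_d (f0 p)^-1 * V d l a * KU c b d.
  by apply: eq_bigr => d _; rewrite K_UUX_V K_UUU // mulrC.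
move: (\sum_d _) (\sum_d _) (\sum_d _) (\sum_s _) (D _ _ _) (D _ _ _) => ? ? ? ? ? ?.
by ring.
Qed.

Lemma curvature_UXUU j c a b :
  curv (X j) (U c) (U a) (U b) = skew (fun a b =>
    D (U b) (fun q => (f0 q)^-1 * f1 j q * kd c a
        - \sum_d G (U d) (X j) q * Cu2 c d a q) p
    + \sum_d (f0 p)^-1 * (H2 c d b p + N c d b p - M2c c d b p)
        * (f1 j p * kd d a - \sum_e f0 p * G (U e) (X j) p * Cu2 d a e p)
    - \sum_s \sum_r (f0 p)^-1 * G (X s) (U a) p * Cu1 r j s p
        * (f1 r p * kd c b - \sum_d f0 p * G (U d) (X r) p * Cu2 c b d p)) a b.
Proof.
apply: (@skew_curvature _ _ _ U) => {}a {}b; rewrite big_split_ord /= -!addrA; congr (_ + _).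
  apply: D_eq => q Aq; rewrite K_UXU //; congr (_ - _); apply: eq_bigr => d _.
  by rewrite Cu2C.
rewrite addrC; congr (_ + _).
  by apply: eq_bigr => d _; rewrite K_sym // K_UUU // K_UXU_V mulrCA mulrA.
rewrite exchange_big -sumrN; apply: eq_bigr => r _ /=.
rewrite K_UUX_V K_XXU // mulrN; congr (- _); rewrite mulr_sumr; apply: eq_bigr => s _.
by move: (\sum_d _) => u; ring.
Qed.

Lemma curvature_UUXX k l c a :
  curv (U a) (U c) (X k) (X l) = skew (fun k l =>
    D (X l) (fun q => (f0 q)^-1 * f1 k q * kd c a
        - \sum_d G (U d) (X k) q * Cu2 c a d q) p
    + \sum_b f0 p ^- 2
        * (f1 l p * kd c b - \sum_d f0 p * G (U d) (X l) p * Cu2 c b d p)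
        * (f1 k p * kd b a - \sum_d f0 p * G (U d) (X k) p * Cu2 b a d p)
    - \sum_s \sum_d \sum_t \sum_h f0 p ^- 2 * G (X s) (U d) p
        * G (X t) (U a) p * gi2 c d p * Cu1 h l s p * C1 h k t p) k l.
Proof.
apply: (@skew_curvature _ _ _ X) => {}k {}l; rewrite big_split_ord /= -!addrA; congr (_ + _).
  by apply: D_eq => q Aq; rewrite K_sym // K_UXU.
rewrite addrC; congr (_ + _).
  apply: eq_bigr => b _; rewrite K_UXU_V K_UUX_V.
  by move: (\sum_d _) (\sum_d _) => u v; field.
(* This is the contraction of [ZP], up to the order of the outer sums and of the factors. *)
transitivity (- \sum_h Z c l h * P h k a).
  by rewrite -sumrN; apply: eq_bigr => h _; rewrite K_UXX // K_XUX // mulrN.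
rewrite ZP exchange_big; congr (- _); do 4!(apply: eq_bigr => ? _) => /=.
by ring.
Qed.

Lemma skewB (I : Type) (E E' : I -> I -> R) v w :
  skew (fun v w => E v w - E' v w) v w = skew E v w - skew E' v w.
Proof. by rewrite /skew; ring. Qed.

(** [D1], [dF1] and [M1t] stand for the horizontal derivative of [H1] in the first factor, its fibre
    derivative and M^r_i. The products H H complete [D1] to the curvature of the factor; the rest of
    (H - M)(H - M) and the Greek contraction - P Z go into the correction. *)
Lemma curvature_XXXX (D1 dF1 : 'I_m -> 'I_m -> 'I_m -> 'I_m -> R)
    (M1t : 'I_m -> 'I_m -> R) i j k l :
  (forall i j k l, D (X l) (fun q => H1 i j k q - M1c i j k q) p =
    D (X l) (H1 i j k) p - D (X l) (M1c i j k) p) ->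
  (forall i j k l,
    D (X l) (H1 i j k) p = D1 l i j k - \sum_r M1t r l * dF1 r i j k) ->
  curv (X j) (X i) (X k) (X l) =
    (D1 l i j k - D1 k i j l + \sum_h H1 i l h p * H1 h j k p
       - \sum_h H1 i k h p * H1 h j l p)
    - skew (fun k l =>
        \sum_r M1t r l * dF1 r i j k + D (X l) (M1c i j k) p
        + \sum_h H1 i l h p * M1c h j k p + \sum_h M1c i l h p * H1 h j k p
        - \sum_h M1c i l h p * M1c h j k p
        + \sum_a \sum_c \sum_r \sum_s f0 p ^- 2 * gi2 a c p * G (X r) (U a) p
            * G (X s) (U c) p * Cu1 i l r p * C1 j k s p) k l.
Proof.
move=> D_sub D_H1; set E := (fun k l => _).
transitivity (skew (fun k l => D1 l i j k + \sum_h H1 i l h p * H1 h j k p - E k l) k l);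
  last first.
  by rewrite skewB; congr (_ - _); rewrite /skew; ring.
apply: (@skew_curvature _ _ _ X) => {}k {}l; rewrite /E {E}.
rewrite (D_eq _ (@K_XXX i j k)) D_sub D_H1 big_split_ord /=.
have -> : \sum_(e < m) K (X i) (X l) (X e) p * K (X e) (X j) (X k) p =
    \sum_h H1 i l h p * H1 h j k p - \sum_h H1 i l h p * M1c h j k p
    - \sum_h M1c i l h p * H1 h j k p + \sum_h M1c i l h p * M1c h j k p.
  by rewrite -!sumrB -big_split; apply: eq_bigr => h _ /=; rewrite !K_XXX //; ring.
have -> : \sum_(e < n) K (X i) (X l) (U e) p * K (U e) (X j) (X k) p =
   - \sum_a \sum_c \sum_r \sum_s f0 p ^- 2 * gi2 a c p * G (X r) (U a) p
          * G (X s) (U c) p * Cu1 i l r p * C1 j k s p.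
  rewrite -sumrN; apply: eq_bigr => a _; rewrite K_XXU // K_UXX // mulNr; congr (- _).
  rewrite mulr_sumr; apply: eq_bigr => c _.
  rewrite mulr_suml; apply: eq_bigr => r _; rewrite mulr_sumr; apply: eq_bigr => s _.
  by ring.
move: (D1 _ _ _ _) (D _ _ _) (\sum_a _) (\sum_r _) => d1 d2 s1 s2.
move: (\sum_h _) (\sum_h _) (\sum_h _) (\sum_h _) => s3 s4 s5 s6.
by ring.
Qed.

Lemma curvature_UUUU (D2 dF2 : 'I_n -> 'I_n -> 'I_n -> 'I_n -> R)
    (M2t : 'I_n -> 'I_n -> R) c a b d :
  (forall c a b d, D (U d) (fun q => H2 c a b q + N c a b q - M2c c a b q) p =
    D (U d) (H2 c a b) p + D (U d) (N c a b) p - D (U d) (M2c c a b) p) ->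
  (forall c a b d,
    D (U d) (H2 c a b) p = D2 d c a b - \sum_e M2t e d * dF2 e c a b) ->
  curv (U a) (U c) (U b) (U d) =
    (D2 d c a b - D2 b c a d + \sum_e H2 c d e p * H2 e a b p
       - \sum_e H2 c b e p * H2 e a d p)
    - skew (fun b d =>
        \sum_e M2t e d * dF2 e c a b + D (U d) (M2c c a b) p
        + \sum_e H2 c d e p * M2c e a b p + \sum_e M2c c d e p * H2 e a b p
        - \sum_e M2c c d e p * M2c e a b p
        + D (U b) (N c a d) p
        + \sum_e H2 c b e p * N e a d p + \sum_e N c b e p * H2 e a d p
        + \sum_e N c b e p * N e a d p
        + \sum_e N c d e p * M2c e a b p + \sum_e N e a b p * M2c c d e p
        + \sum_r (\sum_s gi1 r s p * kd c d * f1 s p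
             - \sum_s \sum_e f0 p * gi1 r s p * G (U e) (X s) p * Cu2 c d e p)
            * (g2 a b p * f1 r p - \sum_e f0 p * G (U e) (X r) p * C2 a b e p)) b d.
Proof.
move=> D_sum D_H2.
(* The half curvature is sorted by origin: [E0] gives the curvature of the factor, [E1] the terms
   with M and without N, [E2] those with N and without M, [E3] the products of N with M and the
   Latin contraction. *)
pose E0 b d := D2 d c a b + \sum_e H2 c d e p * H2 e a b p.
pose E1 b d := \sum_e M2t e d * dF2 e c a b + D (U d) (M2c c a b) p
        + \sum_e H2 c d e p * M2c e a b p + \sum_e M2c c d e p * H2 e a b p
        - \sum_e M2c c d e p * M2c e a b p.
pose E2 b d := D (U d) (N c a b) p
        + \sum_e H2 c d e p * N e a b p + \sum_e N c d e p * H2 e a b p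
        + \sum_e N c d e p * N e a b p.
pose E3 b d := \sum_e N c d e p * M2c e a b p + \sum_e N e a b p * M2c c d e p
        + \sum_r (\sum_s gi1 r s p * kd c d * f1 s p
             - \sum_s \sum_e f0 p * gi1 r s p * G (U e) (X s) p * Cu2 c d e p)
            * (g2 a b p * f1 r p - \sum_e f0 p * G (U e) (X r) p * C2 a b e p).
transitivity (skew (fun b d => E0 b d - E1 b d + E2 b d - E3 b d) b d); last first.
  (* The stated formula lists the terms of [E2] with b and d exchanged. Under [skew] this reverses
     their sign, so they count positively, like N in K_UUU. *)
  rewrite (_ : skew _ b d = skew E0 b d - skew (fun b d => E1 b d + E2 d b + E3 b d) b d).
    congr (_ - _); first by rewrite /skew /E0; ring.
    by rewrite /skew /E1 /E2 /E3 !addrA.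
  by rewrite /skew; ring.
apply: (@skew_curvature _ _ _ U) => {}b {}d; rewrite /E0 /E1 /E2 /E3 {E0 E1 E2 E3}.
rewrite (D_eq _ (@K_UUU c a b)) D_sum D_H2 big_split_ord /=.
have -> : \sum_(e < n) K (U c) (U d) (U e) p * K (U e) (U a) (U b) p =
    \sum_e H2 c d e p * H2 e a b p - \sum_e H2 c d e p * M2c e a b p
    - \sum_e M2c c d e p * H2 e a b p + \sum_e M2c c d e p * M2c e a b p
    + \sum_e H2 c d e p * N e a b p + \sum_e N c d e p * H2 e a b p
    + \sum_e N c d e p * N e a b p
    - \sum_e N c d e p * M2c e a b p - \sum_e N e a b p * M2c c d e p.
  rewrite -!(sumrB, big_split) /=; apply: eq_bigr => e _ /=; rewrite !K_UUU //; ring.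
have -> : \sum_(e < m) K (U c) (U d) (X e) p * K (X e) (U a) (U b) p =
    - \sum_r (\sum_s gi1 r s p * kd c d * f1 s p
             - \sum_s \sum_e f0 p * gi1 r s p * G (U e) (X s) p * Cu2 c d e p)
            * (g2 a b p * f1 r p - \sum_e f0 p * G (U e) (X r) p * C2 a b e p).
  (* The f^-1 of K_UUX cancels the f of K_XUU. By symmetry of gi1 the inverse metric then passes
     from [Y] to [V], where the formula has it. *)
  transitivity (- \sum_r V c r d * \sum_s gi1 r s p * Y s a b).
    rewrite -sumrN; apply: eq_bigr => r _; rewrite K_UUX_V K_XUU // W_raise1.
    by move: (\sum_e _) (\sum_s _) => u v; field.
  congr (- _); under eq_bigr do rewrite mulr_sumr; rewrite exchange_big /=.
  apply: eq_bigr => r _.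
  rewrite (_ : \sum_s gi1 r s p * kd c d * f1 s p - _ = \sum_s gi1 r s p * V c s d).
    rewrite (mulrC (g2 a b p)) mulr_suml; apply: eq_bigr => s _.
    by rewrite (gi1C s r); move: (\sum_e _) (\sum_e _) => u v; ring.
  rewrite -sumrB; apply: eq_bigr => s _; rewrite mulrBr mulr_sumr.
  congr (_ - _); first by ring.
  by apply: eq_bigr => e _; ring.
move: (D2 _ _ _ _) (D _ _ _) (D _ _ _) (\sum_e M2t _ _ * _) => d1 d2 d3 s2.
move: (\sum_e H2 _ _ _ _ * H2 _ _ _ _) (\sum_e H2 _ _ _ _ * M2c _ _ _ _)
  (\sum_e H2 _ _ _ _ * N _ _ _ _) => s3 s4 s5.
move: (\sum_e M2c _ _ _ _ * H2 _ _ _ _) (\sum_e M2c _ _ _ _ * M2c _ _ _ _) => s6 s7.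
move: (\sum_e N _ _ _ _ * H2 _ _ _ _) (\sum_e N _ _ _ _ * N _ _ _ _) => s8 s9.
move: (\sum_e _) (\sum_e _) (\sum_e _) => s10 s11 s12.
by ring.
Qed.

End CurvatureAlgebra.

(** * The twisted product *)

Lemma sum_mulr_exchange (R : comPzRingType) (I J : finType) (g : I -> R) (M : J -> R)
    (C : I -> J -> R) :
  \sum_h g h * (\sum_r M r * C h r) = \sum_r M r * \sum_h g h * C h r.
Proof.
under eq_bigr do rewrite mulr_sumr; rewrite exchange_big /=; apply: eq_bigr => r _.
by rewrite mulr_sumr; apply: eq_bigr => h _; rewrite mulrCA.
Qed.

(** Applied to M^i_jk: once the inverse metric is factored out, the bracket has the shape of a
    Christoffel symbol, with the M C terms in place of metric derivatives. *)
Lemma sum_connection (R : comPzRingType) (I : finType) (g : I -> R) (M : I -> I -> R)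
    (C : I -> I -> I -> R) j k :
  \sum_r M r k * (\sum_h g h * C h j r) + \sum_r M r j * (\sum_h g h * C h k r)
    - \sum_r \sum_h M r h * g h * C j k r =
  \sum_h g h * (\sum_r M r k * C h j r + \sum_r M r j * C h k r - \sum_r M r h * C j k r).
Proof.
rewrite -(sum_mulr_exchange g (M^~ k) (fun h r => C h j r)).
rewrite -(sum_mulr_exchange g (M^~ j) (fun h r => C h k r)) [X in _ - X]exchange_big /=.
rewrite -big_split -sumrB /=.
apply: eq_bigr => h _; rewrite mulrBr mulrDr; congr (_ - _); rewrite mulr_sumr.
by apply: eq_bigr => r _; rewrite mulrCA mulrA.
Qed.

(** The Christoffel expression is linear in the three metric derivatives, so corrections - 2 s, - 2
    t, - 2 u to them split off, with 1/2 absorbing the 2. *)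
Lemma sum_koszul (R : numFieldType) (I : finType) (g a b c s t u : I -> R) :
  2^-1 * (\sum_h g h * (a h - 2 * s h + (b h - 2 * t h) - (c h - 2 * u h))) =
  2^-1 * (\sum_h g h * (a h + b h - c h)) - \sum_h g h * (s h + t h - u h).
Proof. by rewrite !mulr_sumr -sumrB; apply: eq_bigr => h _; field. Qed.

(** Christoffel symbols of the rescaled metric x^2 g: the derivatives of x^2 contribute 2 x dx g,
    and division by x^2 turns them into the terms of N^gamma_alpha,beta, while the remaining terms
    lose the factor x^2. *)
Lemma sum_koszul_twisted (R : numFieldType) (I : finType) (x A B gab : R)
    (g gA gB d h1 h2 h3 s t u : I -> R) : x != 0 ->
  2^-1 * (\sum_l x ^- 2 * g l * (2 * x * B * gA l + x ^+ 2 * (h1 l - 2 * s l)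
     + (2 * x * A * gB l + x ^+ 2 * (h2 l - 2 * t l))
     - (2 * x * d l * gab + x ^+ 2 * (h3 l - 2 * u l)))) =
  2^-1 * (\sum_l g l * (h1 l + h2 l - h3 l))
  + x^-1 * (B * (\sum_l g l * gA l) + A * (\sum_l g l * gB l) - \sum_l d l * g l * gab)
  - \sum_l g l * (s l + t l - u l).
Proof.
move=> x0; rewrite !mulr_sumr -big_split -sumrB mulr_sumr -big_split -sumrB.
by apply: eq_bigr => l _ /=; field.
Qed.

Section TwistedMetric.
Variables (R : realType) (m n : nat).
Local Notation TM := ('rV[R]_(m + n) * 'rV[R]_(m + n))%type.
Local Notation T1 := ('rV[R]_m * 'rV[R]_m)%type.
Local Notation T2 := ('rV[R]_n * 'rV[R]_n)%type.
Local Notation TB := ('rV[R]_m * 'rV[R]_n)%type.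
Local Notation X := (lshift n).
Local Notation U := (@rshift m n).
Local Notation pr1 := (@tproj1 R m n).
Local Notation pr2 := (@tproj2 R m n).
Local Notation bs := (@tbase R m n).
Variables (F1 : T1 -> R) (F2 : T2 -> R) (f : TB -> R) (F : TM -> R).
Variables (A1 : set T1) (A2 : set T2) (B : set TB).
Hypotheses (oA1 : open A1) (oA2 : open A2) (oB : open B).
Hypotheses (sE1 : smooth_on A1 (energy F1)) (sE2 : smooth_on A2 (energy F2)).
Hypotheses (sf : smooth_on B f) (f_neq0 : forall q, B q -> f q != 0).
Hypothesis uG1 : forall p, A1 p -> \matrix_(i, j) fund F1 i j p \in unitmx.
Hypothesis uG2 : forall p, A2 p -> \matrix_(i, j) fund F2 i j p \in unitmx.
Hypothesis cone2 : forall p (t : R), A2 p -> 0 < t -> A2 (p.1, t *: p.2).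
Hypothesis homog2 : forall p (t : R), A2 p -> 0 < t ->
  energy F2 (p.1, t *: p.2) = t ^+ 2 * energy F2 p.
Hypothesis energyF : forall q,
  energy F q = energy F1 (pr1 q) + f (bs q) ^+ 2 * energy F2 (pr2 q).

Definition tdom : set TM := pr1 @^-1` A1 `&` (pr2 @^-1` A2 `&` bs @^-1` B).
Local Notation A := tdom.

Lemma tdom1 q : A q -> A1 (pr1 q). Proof. by case. Qed.
Lemma tdom2 q : A q -> A2 (pr2 q). Proof. by case=> _ []. Qed.
Lemma tdomB q : A q -> B (bs q). Proof. by case=> _ []. Qed.

Lemma open_tdom : open A.
Proof.
by apply: openI; [|apply: openI]; apply: open_comp => // q _;
  [exact: continuous_tproj1|exact: continuous_tproj2|exact: continuous_tbase].
Qed.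
Local Notation oA := open_tdom.

Lemma smooth_pr1 (phi : T1 -> R) : smooth_on A1 phi ->
  smooth_on A (fun q => phi (pr1 q)).
Proof.
move=> s1 s q /tdom1; move: s q.
exact: (smooth_comp_linear (@tproj1D R m n) (@tproj1Z R m n) (@continuous_tproj1 R m n) s1).
Qed.

Lemma smooth_pr2 (phi : T2 -> R) : smooth_on A2 phi ->
  smooth_on A (fun q => phi (pr2 q)).
Proof.
move=> s1 s q /tdom2; move: s q.
exact: (smooth_comp_linear (@tproj2D R m n) (@tproj2Z R m n) (@continuous_tproj2 R m n) s1).
Qed.

Lemma smooth_bs (phi : TB -> R) : smooth_on B phi ->
  smooth_on A (fun q => phi (bs q)).
Proof.
move=> s1 s q /tdomB; move: s q.
exact: (smooth_comp_linear (@tbaseD R m n) (@tbaseZ R m n) (@continuous_tbase R m n) s1).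
Qed.

Let f0 (q : TM) := f (bs q).
Let e1 (q : TM) := energy F1 (pr1 q).
Let e2 (q : TM) := energy F2 (pr2 q).

Lemma f0_neq0 q : A q -> f (bs q) != 0. Proof. by move=> /tdomB; exact: f_neq0. Qed.

Let sf0 : smooth_on A f0 := smooth_bs sf.
Let se1 : smooth_on A e1 := smooth_pr1 sE1.
Let se2 : smooth_on A e2 := smooth_pr2 sE2.

Lemma smooth_df1 i : smooth_on A (df1 f i).
Proof. exact: (smooth_bs (smooth_derive (delta_mx 0 i, 0) sf)). Qed.

Lemma smooth_df2 a : smooth_on A (df2 f a).
Proof. exact: (smooth_bs (smooth_derive (0, delta_mx 0 a) sf)). Qed.

Lemma smooth_energyF : smooth_on A (energy F).
Proof.
apply: (eq_smooth_on oA _ (smoothD oA se1 (smoothM oA (smoothX oA 2 sf0) se2))).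
by move=> q _; rewrite energyF.
Qed.

(** * First derivatives of the energy of the product *)

Lemma derive_energyF v q : A q -> 'D_v (energy F) q =
  'D_v e1 q + (2 * f0 q * 'D_v f0 q * e2 q + f0 q ^+ 2 * 'D_v e2 q).
Proof.
move=> Aq; have s2 := smoothX oA 2 sf0.
rewrite (_ : energy F = fun q => e1 q + f0 q ^+ 2 * e2 q); last exact/funext/energyF.
rewrite (smooth_deriveD _ se1 (smoothM oA s2 se2) Aq) (smooth_deriveM _ s2 se2 Aq).
by rewrite (smooth_deriveX2 _ sf0 Aq).
Qed.

Lemma dfibX_energyF j q : A q -> dfib (X j) (energy F) q = dfib j (energy F1) (pr1 q).
Proof.
move=> Aq; rewrite {1}/dfib derive_energyF //.
rewrite -/(dfib (X j) e1 q) -/(dfib (X j) e2 q) -/(dfib (X j) f0 q).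
by rewrite dfibX_tproj1 dfibX_tproj2 dfib_tbase !(mulr0, mul0r, addr0).
Qed.

Lemma dfibU_energyF b q : A q ->
  dfib (U b) (energy F) q = f (bs q) ^+ 2 * dfib b (energy F2) (pr2 q).
Proof.
move=> Aq; rewrite {1}/dfib derive_energyF //.
rewrite -/(dfib (U b) e1 q) -/(dfib (U b) e2 q) -/(dfib (U b) f0 q).
by rewrite dfibU_tproj1 dfibU_tproj2 dfib_tbase !(mulr0, mul0r, add0r).
Qed.

Lemma dbaseX_energyF j q : A q -> dbase (X j) (energy F) q =
  dbase j (energy F1) (pr1 q) + 2 * f (bs q) * df1 f j q * energy F2 (pr2 q).
Proof.
move=> Aq; rewrite {1}/dbase derive_energyF //.
rewrite -/(dbase (X j) e1 q) -/(dbase (X j) e2 q) -/(dbase (X j) f0 q).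
by rewrite dbaseX_tproj1 dbaseX_tproj2 dbaseX_tbase mulr0 addr0.
Qed.

Lemma dbaseU_energyF b q : A q -> dbase (U b) (energy F) q =
  2 * f (bs q) * df2 f b q * energy F2 (pr2 q)
  + f (bs q) ^+ 2 * dbase b (energy F2) (pr2 q).
Proof.
move=> Aq; rewrite {1}/dbase derive_energyF //.
rewrite -/(dbase (U b) e1 q) -/(dbase (U b) e2 q) -/(dbase (U b) f0 q).
by rewrite dbaseU_tproj1 dbaseU_tproj2 dbaseU_tbase add0r.
Qed.

(** Intended for factors that depend on the base point only, such as f^2 or 2 f f_i, which are
    constants along the fibres. *)
Lemma dfib_mul_base a (h phi : TM -> R) q : smooth_on A h -> smooth_on A phi ->
  dfib a h q = 0 -> A q ->
  dfib a (fun p => h p * phi p) q = h q * dfib a phi q.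
Proof.
move=> sh sphi h0 Aq; rewrite {1}/dfib (smooth_deriveM _ sh sphi Aq).
by rewrite -/(dfib a h q) h0 mul0r add0r.
Qed.

Let sf2 : smooth_on A (fun q => f (bs q) ^+ 2) := smoothX oA 2 sf0.

Lemma dfib_f2 a q : dfib a (fun q : TM => f (bs q) ^+ 2) q = 0.
Proof. exact: (dfib_tbase a (fun x => f x ^+ 2)). Qed.

Let sff1 j : smooth_on A (fun q => 2 * f (bs q) * df1 f j q).
Proof. exact: (smoothM oA (smoothM oA (smooth_cst oA 2) sf0) (smooth_df1 j)). Qed.

Let sff2 j : smooth_on A (fun q => 2 * f (bs q) * df2 f j q).
Proof. exact: (smoothM oA (smoothM oA (smooth_cst oA 2) sf0) (smooth_df2 j)). Qed.

Lemma dfib_ff1 a j q : dfib a (fun q : TM => 2 * f (bs q) * df1 f j q) q = 0.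
Proof. exact: (dfib_tbase a (fun x => 2 * f x * 'D_(delta_mx 0 j, 0) f x)). Qed.

Lemma dfib_ff2 a j q : dfib a (fun q : TM => 2 * f (bs q) * df2 f j q) q = 0.
Proof. exact: (dfib_tbase a (fun x => 2 * f x * 'D_(0, delta_mx 0 j) f x)). Qed.

(** * Block form of the fundamental tensor *)

Lemma fund_XX i j q : A q -> fund F (X i) (X j) q = fund F1 i j (pr1 q).
Proof.
move=> Aq; rewrite {1}/fund (eq_dfib_on oA (X i) (@dfibX_energyF j) Aq).
by rewrite dfibX_tproj1.
Qed.

Lemma fund_XU i b q : A q -> fund F (X i) (U b) q = 0.
Proof.
move=> Aq; rewrite {1}/fund (eq_dfib_on oA (X i) (@dfibU_energyF b) Aq).
rewrite (dfib_mul_base sf2 (smooth_pr2 (smooth_dfib b sE2)) (dfib_f2 _ _) Aq).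
by rewrite dfibX_tproj2 !mulr0.
Qed.

Lemma fund_UX b i q : A q -> fund F (U b) (X i) q = 0.
Proof.
move=> Aq; rewrite {1}/fund (eq_dfib_on oA (U b) (@dfibX_energyF i) Aq).
by rewrite dfibU_tproj1 mulr0.
Qed.

Lemma fund_UU a b q : A q ->
  fund F (U a) (U b) q = f (bs q) ^+ 2 * fund F2 a b (pr2 q).
Proof.
move=> Aq; rewrite {1}/fund (eq_dfib_on oA (U a) (@dfibU_energyF b) Aq).
rewrite (dfib_mul_base sf2 (smooth_pr2 (smooth_dfib b sE2)) (dfib_f2 _ _) Aq).
by rewrite dfibU_tproj2 mulrCA.
Qed.

Lemma fund_block q : A q -> \matrix_(a, b) fund F a b q =
  block_mx (\matrix_(i, j) fund F1 i j (pr1 q)) 0 0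
           (f (bs q) ^+ 2 *: \matrix_(a, b) fund F2 a b (pr2 q)).
Proof.
move=> Aq; apply/matrixP => a b; rewrite -[a]splitK -[b]splitK.
case: (fintype.split a) => i; case: (fintype.split b) => j /=; rewrite mxE.
- by rewrite block_mxEul mxE fund_XX.
- by rewrite block_mxEur mxE fund_XU.
- by rewrite block_mxEdl mxE fund_UX.
- by rewrite block_mxEdr !mxE fund_UU.
Qed.

Lemma unit_fundF q : A q -> \matrix_(a, b) fund F a b q \in unitmx.
Proof.
move=> Aq; rewrite fund_block // block_diag_mx_unit (uG1 (tdom1 Aq)) /=.
by rewrite unitmxZ ?(uG2 (tdom2 Aq)) // unitfE expf_neq0 // f0_neq0.
Qed.

Lemma invmx_fund_block q : A q -> invmx (\matrix_(a, b) fund F a b q) =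
  block_mx (invmx (\matrix_(i, j) fund F1 i j (pr1 q))) 0 0
           (f (bs q) ^- 2 *: invmx (\matrix_(a, b) fund F2 a b (pr2 q))).
Proof.
move=> Aq; have := unit_fundF Aq; rewrite fund_block // => u.
rewrite invmx_block_diag //; congr (block_mx _ _ _ _).
by rewrite invmxZ //; move: u; rewrite block_diag_mx_unit => /andP[].
Qed.

Lemma fundinv_XX i j q : A q -> fundinv F (X i) (X j) q = fundinv F1 i j (pr1 q).
Proof. by move=> Aq; rewrite /fundinv invmx_fund_block // block_mxEul. Qed.

Lemma fundinv_XU i b q : A q -> fundinv F (X i) (U b) q = 0.
Proof. by move=> Aq; rewrite /fundinv invmx_fund_block // block_mxEur mxE. Qed.

Lemma fundinv_UX b i q : A q -> fundinv F (U b) (X i) q = 0.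
Proof. by move=> Aq; rewrite /fundinv invmx_fund_block // block_mxEdl mxE. Qed.

Lemma fundinv_UU a b q : A q ->
  fundinv F (U a) (U b) q = f (bs q) ^- 2 * fundinv F2 a b (pr2 q).
Proof. by move=> Aq; rewrite /fundinv invmx_fund_block // block_mxEdr mxE. Qed.

(** * Spray and nonlinear connection *)

Lemma dfibX_dbaseX j k q : A q ->
  dfib (X j) (dbase (X k) (energy F)) q = dfib j (dbase k (energy F1)) (pr1 q).
Proof.
move=> Aq; rewrite (eq_dfib_on oA (X j) (@dbaseX_energyF k) Aq).
rewrite {1}/dfib (smooth_deriveD _ (smooth_pr1 (smooth_dbase k sE1))
  (smoothM oA (sff1 k) se2) Aq) -!/(dfib (X j) _ q).
rewrite (dfib_mul_base (sff1 k) se2 (dfib_ff1 _ _ _) Aq).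
by rewrite dfibX_tproj2 mulr0 addr0 dfibX_tproj1.
Qed.

Lemma dfibX_dbaseU j c q : A q -> dfib (X j) (dbase (U c) (energy F)) q = 0.
Proof.
move=> Aq; rewrite (eq_dfib_on oA (X j) (@dbaseU_energyF c) Aq).
have s2 := smooth_pr2 (smooth_dbase c sE2).
rewrite {1}/dfib (smooth_deriveD _ (smoothM oA (sff2 c) se2) (smoothM oA sf2 s2) Aq).
rewrite -!/(dfib (X j) _ q) (dfib_mul_base (sff2 c) se2 (dfib_ff2 _ _ _) Aq).
rewrite (dfib_mul_base sf2 s2 (dfib_f2 _ _) Aq).
by rewrite !dfibX_tproj2 !mulr0 addr0.
Qed.

Lemma dfibU_dbaseX b k q : A q -> dfib (U b) (dbase (X k) (energy F)) q =
  2 * f (bs q) * df1 f k q * dfib b (energy F2) (pr2 q).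
Proof.
move=> Aq; rewrite (eq_dfib_on oA (U b) (@dbaseX_energyF k) Aq).
rewrite {1}/dfib (smooth_deriveD _ (smooth_pr1 (smooth_dbase k sE1))
  (smoothM oA (sff1 k) se2) Aq) -!/(dfib (U b) _ q).
rewrite (dfib_mul_base (sff1 k) se2 (dfib_ff1 _ _ _) Aq).
by rewrite dfibU_tproj2 dfibU_tproj1 add0r.
Qed.

Lemma dfibU_dbaseU b c q : A q -> dfib (U b) (dbase (U c) (energy F)) q =
  2 * f (bs q) * df2 f c q * dfib b (energy F2) (pr2 q)
  + f (bs q) ^+ 2 * dfib b (dbase c (energy F2)) (pr2 q).
Proof.
move=> Aq; rewrite (eq_dfib_on oA (U b) (@dbaseU_energyF c) Aq).
have s2 := smooth_pr2 (smooth_dbase c sE2).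
rewrite {1}/dfib (smooth_deriveD _ (smoothM oA (sff2 c) se2) (smoothM oA sf2 s2) Aq).
rewrite -!/(dfib (U b) _ q) (dfib_mul_base (sff2 c) se2 (dfib_ff2 _ _ _) Aq).
rewrite (dfib_mul_base sf2 s2 (dfib_f2 _ _) Aq).
by rewrite !dfibU_tproj2.
Qed.

Lemma dfib_sum_base a (I : finType) (c phi : I -> TM -> R) q :
  (forall k, smooth_on A (c k)) -> (forall k, smooth_on A (phi k)) ->
  (forall k, dfib a (c k) q = 0) -> A q ->
  dfib a (fun p => \sum_k c k p * phi k p) q = \sum_k c k q * dfib a (phi k) q.
Proof.
move=> sc sphi c0 Aq; rewrite {1}/dfib (smooth_derive_sum oA _ _ _ Aq).
  by apply: eq_bigr => k _; exact: (dfib_mul_base (sc k) (sphi k) (c0 k) Aq).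
by move=> k; exact: (smoothM oA (sc k) (sphi k)).
Qed.

(** The correction to dF^2/dx^h is 2 f f_h F_2^2, which does not depend on y. It therefore enters
    only through the last term of the spray, with coefficient - 1/4. The base factors are written
    first, ready for [dfib_sum_base]. *)
Lemma spray_X i q : A q -> spray F (X i) q = spray F1 i (pr1 q)
  - \sum_h 2^-1 * f (bs q) * df1 f h q
      * (fundinv F1 i h (pr1 q) * energy F2 (pr2 q)).
Proof.
move=> Aq; rewrite {1}/spray big_split_ord /= [X in _ + X]big1 => [|b _]; last first.
  by rewrite (fundinv_XU _ _ Aq) mul0r.
rewrite addr0 /spray !mulr_sumr -sumrB; apply: eq_bigr => k _.
rewrite (fundinv_XX _ _ Aq) (dbaseX_energyF _ Aq) big_split_ord /=.
rewrite [X in _ + X - _]big1 => [|b _]; last by rewrite (dfibX_dbaseU _ _ Aq) mul0r.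
under eq_bigr => j _ do rewrite (dfibX_dbaseX _ _ Aq) fib_coordX.
move: (\sum_j _) (fundinv F1 i k (pr1 q)) (dbase k _ _) (f (bs q)) (df1 f k q) (energy _ _).
by move=> a b c d e g; field.
Qed.

(** The mixed second derivatives contain the fibre derivative of F_2^2, that is 2 v_beta; raising
    its index afterwards gives v^alpha in the two middle sums. *)
Lemma spray_U a q : A q -> spray F (U a) q = spray F2 a (pr2 q)
  + \sum_k (f (bs q))^-1 * df1 f k q * (q.2 0 (X k) * q.2 0 (U a))
  + \sum_c (f (bs q))^-1 * df2 f c q * (q.2 0 (U c) * q.2 0 (U a))
  - \sum_c 2^-1 * (f (bs q))^-1 * df2 f c q
      * (fundinv F2 a c (pr2 q) * energy F2 (pr2 q)).
Proof.
move=> Aq; have fn0 := f0_neq0 Aq.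
rewrite {1}/spray big_split_ord /= [X in X + _]big1 => [|b _]; last first.
  by rewrite (fundinv_UX _ _ Aq) mul0r.
rewrite add0r.
(* [S] is the derivative of f along the tangent vector (y, v). *)
pose S := \sum_k df1 f k q * q.2 0 (X k) + \sum_c df2 f c q * q.2 0 (U c).
transitivity (\sum_b (4^-1 * (fundinv F2 a b (pr2 q) *
    (\sum_c dfib b (dbase c (energy F2)) (pr2 q) * (pr2 q).2 0 c - dbase b (energy F2) (pr2 q)))
  + (f (bs q))^-1 * S * (fundinv F2 a b (pr2 q) * ylow F2 b (pr2 q))
  - 2^-1 * (f (bs q))^-1 * df2 f b q * (fundinv F2 a b (pr2 q) * energy F2 (pr2 q)))).
  rewrite mulr_sumr; apply: eq_bigr => b _.
  rewrite (fundinv_UU _ _ Aq) (dbaseU_energyF _ Aq) big_split_ord /=.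
  under eq_bigr => k _ do rewrite (dfibU_dbaseX _ _ Aq).
  under [X in _ + X - _]eq_bigr => c _ do rewrite (dfibU_dbaseU _ _ Aq).
  rewrite (dfib_energy oA2 sE2 cone2 homog2 _ (tdom2 Aq)).
  move: (ylow F2 b (pr2 q)) => yl.
  have -> : \sum_(k < m) 2 * f (bs q) * df1 f k q * (2 * yl) * q.2 0 (X k)
      = 4 * f (bs q) * yl * \sum_k df1 f k q * q.2 0 (X k).
    rewrite mulr_sumr; apply: eq_bigr => k _.
    by move: (f _) (df1 _ _ _) (q.2 _ _) => x y t; ring.
  have -> : \sum_(c < n) (2 * f (bs q) * df2 f c q * (2 * yl) +
      f (bs q) ^+ 2 * dfib b (dbase c (energy F2)) (pr2 q)) * q.2 0 (U c)
      = 4 * f (bs q) * yl * (\sum_c df2 f c q * q.2 0 (U c))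
      + f (bs q) ^+ 2 * \sum_c dfib b (dbase c (energy F2)) (pr2 q) * (pr2 q).2 0 c.
    rewrite !mulr_sumr -big_split; apply: eq_bigr => c _ /=; rewrite -fib_coordU.
    by move: (f _) (df2 _ _ _) (q.2 _ _) (dfib _ _ _) => x y t w; ring.
  rewrite /S; move: fn0.
  move: (\sum_k _) (\sum_c _) (\sum_c _) => s1 s2 s3.
  move: (f (bs q)) (fundinv _ _ _ _) (dbase _ _ _) (df2 _ _ _) (energy _ _).
  by move=> x g d d2 e x0; field.
rewrite sumrB big_split /= -mulr_sumr -/(spray F2 a (pr2 q)).
rewrite -[X in _ + X - _]mulr_sumr (fundinv_ylow uG2 _ (tdom2 Aq)) -fib_coordU.
apply: (congr1 (fun z => z - _)); rewrite -addrA; apply: (congr1 (fun z => _ + z)).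
rewrite /S mulrDr mulrDl !mulr_sumr !mulr_suml.
apply: (congr2 (fun x y => x + y)); apply: eq_bigr => k _.
  by move: (_^-1) (df1 _ _ _) (q.2 _ _) (q.2 _ _) => x y z t; ring.
by move: (_^-1) (df2 _ _ _) (q.2 _ _) (q.2 _ _) => x y z t; ring.
Qed.

Let sfV : smooth_on A (fun q => (f (bs q))^-1).
Proof. by apply: (smoothV oA sf0) => q Aq; exact: f0_neq0. Qed.

(** Only the inverse metric in the correction to the spray depends on y; its derivative brings a
    factor -2 which turns - 1/2 into the coefficient 1 of M^i_j. *)
Lemma nlconn_XX i j q : A q ->
  nlconn F (X i) (X j) q = nlconn F1 i j (pr1 q) + Mt1 F1 F2 f i j q.
Proof.
move=> Aq; rewrite {1}/nlconn (eq_dfib_on oA (X j) (@spray_X i) Aq).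
pose c h (q : TM) := 2^-1 * f (bs q) * df1 f h q.
pose phi h (q : TM) := fundinv F1 i h (pr1 q) * energy F2 (pr2 q).
have sc h : smooth_on A (c h).
  exact: (smoothM oA (smoothM oA (smooth_cst oA 2^-1) sf0) (smooth_df1 h)).
have sg h : smooth_on A (fun q => fundinv F1 i h (pr1 q)).
  exact: (smooth_pr1 (smooth_fundinv oA1 sE1 uG1 i h)).
have sphi h : smooth_on A (phi h) by exact: (smoothM oA (sg h) se2).
have c0 h : dfib (X j) (c h) q = 0.
  exact: (dfib_tbase (X j) (fun x => 2^-1 * f x * 'D_(delta_mx 0 h, 0) f x)).
have ss := smooth_pr1 (smooth_spray oA1 sE1 uG1 i).
have s1 := smooth_sum oA (index_enum _) (P := xpredT)
  (fun h _ => smoothM oA (sc h) (sphi h)).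
rewrite {1}/dfib (smooth_deriveB _ ss s1 Aq).
rewrite -!/(dfib (X j) _ q) dfibX_tproj1 -/(nlconn F1 i j (pr1 q)).
rewrite (dfib_sum_base sc sphi c0 Aq) /Mt1 -sumrN.
apply: (congr1 (fun z => _ + z)); apply: eq_bigr => h _.
rewrite {1}/phi {1}/dfib (smooth_deriveM _ (sg h) se2 Aq) -!/(dfib (X j) _ q).
rewrite dfibX_tproj2 dfibX_tproj1 (dfib_fundinv oA1 sE1 uG1 _ _ _ (tdom1 Aq)) /c /e2 /energy.
move: (f (bs q)) (df1 _ _ _) (cartan2 _ _ _ _ _) (F2 _) (fundinv _ _ _ _) => x y z t w.
by field.
Qed.

(** Origin of the five terms of M^alpha_beta: y^k v^alpha gives the first Kronecker term, v^gamma
    v^alpha the second one and f_beta v^alpha, and g^alpha,gamma F_2^2 the Cartan term and the one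
    in v_beta. *)
Lemma nlconn_UU a b q : A q ->
  nlconn F (U a) (U b) q = nlconn F2 a b (pr2 q) + Mt2 F2 f a b q.
Proof.
move=> Aq; rewrite {1}/nlconn (eq_dfib_on oA (U b) (@spray_U a) Aq).
pose c1 k (q : TM) := (f (bs q))^-1 * df1 f k q.
pose c2 k (q : TM) := (f (bs q))^-1 * df2 f k q.
pose c3 k (q : TM) := 2^-1 * (f (bs q))^-1 * df2 f k q.
pose phi1 k (q : TM) := q.2 0 (X k) * q.2 0 (U a).
pose phi2 k (q : TM) := q.2 0 (U k) * q.2 0 (U a).
pose phi3 k (q : TM) := fundinv F2 a k (pr2 q) * energy F2 (pr2 q).
have sc1 h : smooth_on A (c1 h) by exact: (smoothM oA sfV (smooth_df1 h)).
have sc2 h : smooth_on A (c2 h) by exact: (smoothM oA sfV (smooth_df2 h)).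
have sc3 h : smooth_on A (c3 h).
  exact: (smoothM oA (smoothM oA (smooth_cst oA 2^-1) sfV) (smooth_df2 h)).
have sy k := (smooth_fib_coord oA k).1.
have sg h : smooth_on A (fun q => fundinv F2 a h (pr2 q)).
  exact: (smooth_pr2 (smooth_fundinv oA2 sE2 uG2 a h)).
have sphi1 h : smooth_on A (phi1 h) by exact: (smoothM oA (sy _) (sy _)).
have sphi2 h : smooth_on A (phi2 h) by exact: (smoothM oA (sy _) (sy _)).
have sphi3 h : smooth_on A (phi3 h) by exact: (smoothM oA (sg h) se2).
have z1 h : dfib (U b) (c1 h) q = 0.
  exact: (dfib_tbase (U b) (fun x => (f x)^-1 * 'D_(delta_mx 0 h, 0) f x)).
have z2 h : dfib (U b) (c2 h) q = 0.
  exact: (dfib_tbase (U b) (fun x => (f x)^-1 * 'D_(0, delta_mx 0 h) f x)).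
have z3 h : dfib (U b) (c3 h) q = 0.
  exact: (dfib_tbase (U b) (fun x => 2^-1 * (f x)^-1 * 'D_(0, delta_mx 0 h) f x)).
have ss := smooth_pr2 (smooth_spray oA2 sE2 uG2 a).
have s1 := smooth_sum oA (index_enum _) (P := xpredT) (fun h _ => smoothM oA (sc1 h) (sphi1 h)).
have s2 := smooth_sum oA (index_enum _) (P := xpredT) (fun h _ => smoothM oA (sc2 h) (sphi2 h)).
have s3 := smooth_sum oA (index_enum _) (P := xpredT) (fun h _ => smoothM oA (sc3 h) (sphi3 h)).
rewrite {1}/dfib (smooth_deriveB _ (smoothD oA (smoothD oA ss s1) s2) s3 Aq).
rewrite (smooth_deriveD _ (smoothD oA ss s1) s2 Aq) (smooth_deriveD _ ss s1 Aq).
rewrite -!/(dfib (U b) _ q) dfibU_tproj2 -/(nlconn F2 a b (pr2 q)).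
rewrite (dfib_sum_base sc1 sphi1 z1 Aq) (dfib_sum_base sc2 sphi2 z2 Aq).
rewrite (dfib_sum_base sc3 sphi3 z3 Aq).
rewrite -!addrA; apply: (congr1 (fun z => _ + z)).
have -> : \sum_k c1 k q * dfib (U b) (phi1 k) q =
    (f (bs q))^-1 * \sum_r df1 f r q * (pr1 q).2 0 r * (a == b)%:R.
  rewrite mulr_sumr; apply: eq_bigr => k _.
  rewrite {1}/dfib (smooth_deriveM _ (sy _) (sy _) Aq) -!/(dfib (U b) _ q).
  rewrite !(dfib_fib_coord oA) eq_lrshift eq_rshift mul0r add0r /c1 fib_coordX.
  by rewrite !mulrA.
have -> : \sum_k c2 k q * dfib (U b) (phi2 k) q =
    (f (bs q))^-1 * (\sum_c df2 f c q * (pr2 q).2 0 c * (a == b)%:R + df2 f b q * (pr2 q).2 0 a).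
  transitivity (\sum_k (f (bs q))^-1 *
      (df2 f k q * (pr2 q).2 0 k * (a == b)%:R + (k == b)%:R * (df2 f k q * (pr2 q).2 0 a))).
    apply: eq_bigr => k _.
    rewrite {1}/dfib (smooth_deriveM _ (sy _) (sy _) Aq) -!/(dfib (U b) _ q).
    rewrite !(dfib_fib_coord oA) !eq_rshift /c2 !fib_coordU.
    move: (_^-1) (df2 _ _ _) (_%:R) (_%:R) ((pr2 q).2 _ _) ((pr2 q).2 _ _) => x y z t u v.
    by ring.
  rewrite -mulr_sumr big_split /=; congr (_ * (_ + _)).
  rewrite (bigD1 b) //= eqxx mul1r big1 ?addr0 // => k /negPf ->.
  by rewrite mul0r.
have -> : \sum_k c3 k q * dfib (U b) (phi3 k) q =
    (f (bs q))^-1 * (\sum_c fundinv F2 a c (pr2 q) * df2 f c q * ylow F2 b (pr2 q)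
     - \sum_c cartan2 F2 a c b (pr2 q) * df2 f c q * F2 (pr2 q) ^+ 2).
  rewrite -sumrB mulr_sumr; apply: eq_bigr => k _.
  rewrite {1}/dfib (smooth_deriveM _ (sg k) se2 Aq) -!/(dfib (U b) _ q).
  rewrite !dfibU_tproj2 (dfib_fundinv oA2 sE2 uG2 _ _ _ (tdom2 Aq)).
  rewrite (dfib_energy oA2 sE2 cone2 homog2 _ (tdom2 Aq)) /c3 /e2 /energy.
  move: ((f (bs q))^-1) (df2 _ _ _) (cartan2 _ _ _ _ _) (F2 _) (fundinv _ _ _ _) (ylow _ _ _).
  by move=> x y z t w u; field.
rewrite /Mt2; move: (_^-1) (\sum_c _) (\sum_c _) (\sum_c _) (\sum_c _).
by move: (df2 f b q * _) => v x y z t u; ring.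
Qed.

Let sEF := smooth_energyF.
Let uGF := unit_fundF.
Local Notation G := (nlconn F).

(** * Horizontal derivatives of pulled-back functions and of the metric *)

Lemma hder_split a phi q : hder F a phi q = dbase a phi q
  - \sum_r G (X r) a q * dfib (X r) phi q - \sum_l G (U l) a q * dfib (U l) phi q.
Proof. by rewrite /hder big_split_ord /= opprD addrA. Qed.

Lemma hderX_pr1 i phi q : A q -> hder F (X i) (fun p => phi (pr1 p)) q =
  hder F1 i phi (pr1 q) - \sum_r Mt1 F1 F2 f r i q * dfib r phi (pr1 q).
Proof.
move=> Aq; rewrite hder_split dbaseX_tproj1 [X in _ - X]big1 ?subr0 => [|l _]; last first.
  by rewrite dfibU_tproj1 mulr0.
rewrite /hder -addrA -opprD -big_split /=.
apply: (congr1 (fun z => _ - z)); apply: eq_bigr => r _.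
by rewrite dfibX_tproj1 (nlconn_XX _ _ Aq) mulrDl.
Qed.

Lemma hderU_pr1 b phi q : hder F (U b) (fun p => phi (pr1 p)) q =
  - \sum_r G (X r) (U b) q * dfib r phi (pr1 q).
Proof.
rewrite hder_split dbaseU_tproj1 [X in _ - X]big1 ?subr0 => [|l _]; last first.
  by rewrite dfibU_tproj1 mulr0.
rewrite sub0r; apply: (congr1 (fun z => - z)); apply: eq_bigr => r _.
by rewrite dfibX_tproj1.
Qed.

Lemma hderX_pr2 i phi q : hder F (X i) (fun p => phi (pr2 p)) q =
  - \sum_l G (U l) (X i) q * dfib l phi (pr2 q).
Proof.
rewrite hder_split dbaseX_tproj2 [X in _ - X - _]big1 ?subr0 => [|l _]; last first.
  by rewrite dfibX_tproj2 mulr0.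
rewrite sub0r; apply: (congr1 (fun z => - z)); apply: eq_bigr => r _.
by rewrite dfibU_tproj2.
Qed.

Lemma hderU_pr2 b phi q : A q -> hder F (U b) (fun p => phi (pr2 p)) q =
  hder F2 b phi (pr2 q) - \sum_l Mt2 F2 f l b q * dfib l phi (pr2 q).
Proof.
move=> Aq; rewrite hder_split dbaseU_tproj2 [X in _ - X - _]big1 ?subr0 => [|l _]; last first.
  by rewrite dfibX_tproj2 mulr0.
rewrite /hder -addrA -opprD -big_split /=.
apply: (congr1 (fun z => _ - z)); apply: eq_bigr => r _.
by rewrite dfibU_tproj2 (nlconn_UU _ _ Aq) mulrDl.
Qed.

Lemma hder_f2 a q : A q ->
  hder F a (fun p => f (bs p) ^+ 2) q = 2 * f (bs q) * dbase a (fun p => f (bs p)) q.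
Proof.
move=> Aq; rewrite {1}/hder {1}/dbase (smooth_deriveX2 _ sf0 Aq) big1 ?subr0 // => b _.
by rewrite dfib_f2 mulr0.
Qed.

Lemma hder_f2_pr2 a phi q : smooth_on A2 phi -> A q ->
  hder F a (fun p => f (bs p) ^+ 2 * phi (pr2 p)) q =
  2 * f (bs q) * dbase a (fun p => f (bs p)) q * phi (pr2 q)
  + f (bs q) ^+ 2 * hder F a (fun p => phi (pr2 p)) q.
Proof.
by move=> s Aq; rewrite (hderM F _ sf2 (smooth_pr2 s) Aq) (hder_f2 _ Aq).
Qed.

Lemma hder_fund_XU a i b q : A q -> hder F a (fund F (X i) (U b)) q = 0.
Proof. exact: (hder_eq0_on oA F a (@fund_XU i b)). Qed.

Lemma hder_fund_UX a b i q : A q -> hder F a (fund F (U b) (X i)) q = 0.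
Proof. exact: (hder_eq0_on oA F a (@fund_UX b i)). Qed.

Lemma hderX_fund_XX k i j q : A q -> hder F (X k) (fund F (X i) (X j)) q =
  hder F1 k (fund F1 i j) (pr1 q) - 2 * \sum_r Mt1 F1 F2 f r k q * cartan F1 i j r (pr1 q).
Proof.
move=> Aq; rewrite (eq_hder_on oA F (X k) (@fund_XX i j) Aq) (hderX_pr1 _ _ Aq) mulr_sumr.
apply: (congr1 (fun z => _ - z)); apply: eq_bigr => r _.
by rewrite dfib_fund mulrCA.
Qed.

Lemma hderU_fund_XX b i j q : A q -> hder F (U b) (fund F (X i) (X j)) q =
  - (2 * \sum_r G (X r) (U b) q * cartan F1 i j r (pr1 q)).
Proof.
move=> Aq; rewrite (eq_hder_on oA F (U b) (@fund_XX i j) Aq) hderU_pr1 mulr_sumr.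
apply: (congr1 (fun z => - z)); apply: eq_bigr => r _.
by rewrite dfib_fund mulrCA.
Qed.

Lemma hderX_fund_UU i a b q : A q -> hder F (X i) (fund F (U a) (U b)) q =
  2 * f (bs q) * (df1 f i q * fund F2 a b (pr2 q)
    - f (bs q) * \sum_l G (U l) (X i) q * cartan F2 a b l (pr2 q)).
Proof.
move=> Aq; rewrite (eq_hder_on oA F (X i) (@fund_UU a b) Aq).
rewrite (hder_f2_pr2 _ (smooth_fund oA2 sE2 a b) Aq) dbaseX_tbase hderX_pr2.
under eq_bigr do rewrite dfib_fund mulrCA.
rewrite -mulr_sumr; move: (\sum_l _) (f _) (df1 _ _ _) (fund _ _ _ _) => x y z t.
by ring.
Qed.

Lemma hderU_fund_UU c a b q : A q -> hder F (U c) (fund F (U a) (U b)) q =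
  2 * f (bs q) * df2 f c q * fund F2 a b (pr2 q)
  + f (bs q) ^+ 2 * (hder F2 c (fund F2 a b) (pr2 q)
    - 2 * \sum_l Mt2 F2 f l c q * cartan F2 a b l (pr2 q)).
Proof.
move=> Aq; rewrite (eq_hder_on oA F (U c) (@fund_UU a b) Aq).
rewrite (hder_f2_pr2 _ (smooth_fund oA2 sE2 a b) Aq) dbaseU_tbase (hderU_pr2 _ _ Aq).
under eq_bigr do rewrite dfib_fund mulrCA.
by rewrite -mulr_sumr.
Qed.

(** * Coefficients of the horizontal connection *)

Lemma hconn_upX i a b q : A q -> hconn F (X i) a b q =
  2^-1 * \sum_h fundinv F1 i h (pr1 q) * (hder F b (fund F (X h) a) q
    + hder F a (fund F (X h) b) q - hder F (X h) (fund F a b) q).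
Proof.
move=> Aq; rewrite {1}/hconn big_split_ord /= [X in _ + X]big1 ?addr0 => [|l _]; last first.
  by rewrite (fundinv_XU _ _ Aq) mul0r.
by apply: (congr1 (fun z => _ * z)); apply: eq_bigr => h _; rewrite (fundinv_XX _ _ Aq).
Qed.

Lemma hconn_upU c a b q : A q -> hconn F (U c) a b q =
  2^-1 * \sum_l f (bs q) ^- 2 * fundinv F2 c l (pr2 q) * (hder F b (fund F (U l) a) q
    + hder F a (fund F (U l) b) q - hder F (U l) (fund F a b) q).
Proof.
move=> Aq; rewrite {1}/hconn big_split_ord /= [X in X + _]big1 ?add0r => [|l _]; last first.
  by rewrite (fundinv_UX _ _ Aq) mul0r.
by apply: (congr1 (fun z => _ * z)); apply: eq_bigr => h _; rewrite (fundinv_UU _ _ Aq).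
Qed.

Lemma Mc1E i j k q : Mc1 F1 F2 f i j k q = \sum_h fundinv F1 i h (pr1 q) *
  (\sum_r Mt1 F1 F2 f r k q * cartan F1 h j r (pr1 q)
   + \sum_r Mt1 F1 F2 f r j q * cartan F1 h k r (pr1 q)
   - \sum_r Mt1 F1 F2 f r h q * cartan F1 j k r (pr1 q)).
Proof.
exact: (sum_connection (fun h => fundinv F1 i h (pr1 q))
  (fun r k => Mt1 F1 F2 f r k q) (fun a b c => cartan F1 a b c (pr1 q)) j k).
Qed.

Lemma Mc2E c a b q : Mc2 F2 f c a b q = \sum_h fundinv F2 c h (pr2 q) *
  (\sum_r Mt2 F2 f r b q * cartan F2 h a r (pr2 q)
   + \sum_r Mt2 F2 f r a q * cartan F2 h b r (pr2 q)
   - \sum_r Mt2 F2 f r h q * cartan F2 a b r (pr2 q)).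
Proof.
exact: (sum_connection (fun h => fundinv F2 c h (pr2 q))
  (fun r k => Mt2 F2 f r k q) (fun x y z => cartan F2 x y z (pr2 q)) a b).
Qed.

Lemma hconn_XXX i j k q : A q -> hconn F (X i) (X j) (X k) q =
  hconn F1 i j k (pr1 q) - Mc1 F1 F2 f i j k q.
Proof.
move=> Aq; rewrite (hconn_upX _ _ _ Aq).
under eq_bigr => h _ do
  rewrite (hderX_fund_XX k h j Aq) (hderX_fund_XX j h k Aq) (hderX_fund_XX h j k Aq).
rewrite sum_koszul Mc1E.
by [].
Qed.

Lemma hconn_XXU i j b q : A q -> hconn F (X i) (X j) (U b) q =
  - \sum_r G (X r) (U b) q * cartan1 F1 i j r (pr1 q).
Proof.
move=> Aq; rewrite (hconn_upX _ _ _ Aq).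
under eq_bigr => h _ do
  rewrite (hderU_fund_XX b h j Aq) (hder_fund_XU (X j) h b Aq) (hder_fund_XU (X h) j b Aq).
rewrite /cartan1 -sum_mulr_exchange mulr_sumr -sumrN; apply: eq_bigr => h _.
by move: (fundinv _ _ _ _) (\sum_r _) => x y; field.
Qed.

Lemma hconn_XUU i a b q : A q -> hconn F (X i) (U a) (U b) q =
  - (f (bs q) * (df1up F1 f i q * fund F2 a b (pr2 q)
     - \sum_l \sum_h f (bs q) * G (U l) (X h) q * fundinv F1 i h (pr1 q)
         * cartan F2 a b l (pr2 q))).
Proof.
move=> Aq; rewrite (hconn_upX _ _ _ Aq).
under eq_bigr => h _ do
  rewrite (hder_fund_XU (U b) h a Aq) (hder_fund_XU (U a) h b Aq) (hderX_fund_UU h a b Aq).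
rewrite exchange_big /df1up /= mulr_suml -sumrB !mulr_sumr -sumrN; apply: eq_bigr => h _.
have -> : \sum_l f (bs q) * G (U l) (X h) q * fundinv F1 i h (pr1 q) * cartan F2 a b l (pr2 q)
    = f (bs q) * fundinv F1 i h (pr1 q) * \sum_l G (U l) (X h) q * cartan F2 a b l (pr2 q).
  rewrite mulr_sumr; apply: eq_bigr => l _.
  by move: (f _) (G _ _ _) (fundinv _ _ _ _) (cartan _ _ _ _ _) => x y z t; ring.
move: (\sum_l _) (f _) (df1 _ _ _) (fund _ _ _ _) (fundinv _ _ _ _) => x y z t w.
by field.
Qed.

(** The off-diagonal metric entries vanish, so only the derivative of g_ij in a Greek direction
    survives, and it sees only the mixed coefficients G^r_lambda. Its two minus signs and the factor
    2 of dg = 2 C cancel against 1/2. *)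
Lemma hconn_UXX c i j q : A q -> hconn F (U c) (X i) (X j) q =
  \sum_l \sum_r f (bs q) ^- 2 * fundinv F2 c l (pr2 q) * G (X r) (U l) q
    * cartan F1 i j r (pr1 q).
Proof.
move=> Aq; rewrite (hconn_upU _ _ _ Aq) mulr_sumr; apply: eq_bigr => l _.
rewrite (hder_fund_UX (X j) l i Aq) (hder_fund_UX (X i) l j Aq) (hderU_fund_XX l i j Aq).
under [RHS]eq_bigr do rewrite -mulrA.
rewrite -mulr_sumr; move: (_ * _) (\sum_r _) => x y.
by field.
Qed.

Lemma hconn_UXU c i b q : A q -> hconn F (U c) (X i) (U b) q =
  (f (bs q))^-1 * df1 f i q * (c == b)%:R
  - \sum_l G (U l) (X i) q * cartan1 F2 c b l (pr2 q).
Proof.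
move=> Aq; have fn0 := f0_neq0 Aq; rewrite (hconn_upU _ _ _ Aq).
under eq_bigr => l _ do
  rewrite (hder_fund_UX (U b) l i Aq) (hder_fund_XU (U l) i b Aq) (hderX_fund_UU i l b Aq).
(* The Kronecker symbol is expanded back into a contraction of the metric with its inverse, so that
   the two sides can be compared term by term under one sum. *)
rewrite /cartan1 -sum_mulr_exchange -(fundinv_fund uG2 c b (tdom2 Aq)).
rewrite !mulr_sumr -sumrB; apply: eq_bigr => l _; move: fn0.
move: (f _) (df1 _ _ _) (fund _ _ _ _) (fundinv _ _ _ _) (\sum_r _) => y z t w x y0.
by field.
Qed.

Lemma hconn_UUU c a b q : A q -> hconn F (U c) (U a) (U b) q =
  hconn F2 c a b (pr2 q) + Nc2 F2 f c a b q - Mc2 F2 f c a b q.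
Proof.
move=> Aq; have fn0 := f0_neq0 Aq; rewrite (hconn_upU _ _ _ Aq).
under eq_bigr => l _ do
  rewrite (hderU_fund_UU b l a Aq) (hderU_fund_UU a l b Aq) (hderU_fund_UU l a b Aq).
rewrite (sum_koszul_twisted _ _ _ _ _ _ _ _ _ _ _ _ _ fn0) Mc2E /Nc2.
by rewrite -(fundinv_fund uG2 c a (tdom2 Aq)) -(fundinv_fund uG2 c b (tdom2 Aq)).
Qed.

(** * Smoothness of the correction tensors *)

Lemma smooth_Nc2 c a b : smooth_on A (Nc2 F2 f c a b).
Proof.
apply: (smoothM oA sfV); apply: (smoothB oA).
  by apply: (smoothD oA); apply: (smoothM oA (smooth_df2 _) (smooth_cst oA _)).
apply: (smooth_sum oA) => l _; apply: (smoothM oA).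
  exact: (smoothM oA (smooth_df2 l) (smooth_pr2 (smooth_fundinv oA2 sE2 uG2 c l))).
exact: (smooth_pr2 (smooth_fund oA2 sE2 a b)).
Qed.

Let sK x y z : smooth_on A (hconn F x y z) := smooth_hconn oA sEF uGF x y z.
Let sH1 i j k : smooth_on A (fun q => hconn F1 i j k (pr1 q)) :=
  smooth_pr1 (smooth_hconn oA1 sE1 uG1 i j k).
Let sH2 c a b : smooth_on A (fun q => hconn F2 c a b (pr2 q)) :=
  smooth_pr2 (smooth_hconn oA2 sE2 uG2 c a b).

(** M^i_jk is the difference of two connection coefficients already known to be smooth, which spares
    an inspection of its explicit sum. This is what allows the derivative of F - M to be split. *)
Lemma smooth_Mc1 i j k : smooth_on A (Mc1 F1 F2 f i j k).
Proof.
apply: (eq_smooth_on oA _ (smoothB oA (sH1 i j k) (sK (X i) (X j) (X k)))) => q Aq.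
by rewrite (hconn_XXX _ _ _ Aq) subKr.
Qed.

Lemma smooth_Mc2 c a b : smooth_on A (Mc2 F2 f c a b).
Proof.
apply: (eq_smooth_on oA _ (smoothB oA (smoothD oA (sH2 c a b) (smooth_Nc2 c a b))
  (sK (U c) (U a) (U b)))) => q Aq.
by rewrite (hconn_UUU _ _ _ Aq) subKr.
Qed.

(** Stated for functions on open subsets of coordinate spaces, with F given through its energy, so
    that charts and the square root are dealt with separately. The proof matches the calculus of F
    with the symbols of the algebraic section. *)
Lemma twisted_curvature p : A p ->
  let X (i : 'I_m) := lshift n i in
  let U (α : 'I_n) := rshift m α in
  let G a b q := nlconn F a b q in
  let dX i phi q := hder F (X i) phi q in
  let dU α phi q := hder F (U α) phi q in
  let bR b a c d q := hcurv F b a c d q in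
  let pr1 := @tproj1 R m n in
  let pr2 := @tproj2 R m n in
  let bs := @tbase R m n in
  let gi1 i j q := fundinv F1 i j (pr1 q) in
  let C1 i j k q := cartan F1 i j k (pr1 q) in
  let Cu1 i j k q := cartan1 F1 i j k (pr1 q) in
  let H1 i j k q := hconn F1 i j k (pr1 q) in
  let R1 j i k l q := hcurv F1 j i k l (pr1 q) in
  let g2 α β q := fund F2 α β (pr2 q) in
  let gi2 α β q := fundinv F2 α β (pr2 q) in
  let C2 α β γ q := cartan F2 α β γ (pr2 q) in
  let Cu2 γ α β q := cartan1 F2 γ α β (pr2 q) in
  let Cuu2 γ μ α q := cartan2 F2 γ μ α (pr2 q) in
  let H2 γ α β q := hconn F2 γ α β (pr2 q) in
  let R2 α γ β λ q := hcurv F2 α γ β λ (pr2 q) in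
  let f0 q := f (bs q) in
  let f1 i q := df1 f i q in
  let fu i q := df1up F1 f i q in
  let M1t r i q := Mt1 F1 F2 f r i q in
  let M2t μ α q := Mt2 F2 f μ α q in
  let M1c i j k q := Mc1 F1 F2 f i j k q in
  let M2c γ α β q := Mc2 F2 f γ α β q in
  let N γ α β q := Nc2 F2 f γ α β q in
  let kd (α β : 'I_n) : R := (α == β)%:R in
  (forall (i j k l : 'I_m),
    bR (X j) (X i) (X k) (X l) p =
      R1 j i k l p
      - skew (fun k l =>
          \sum_r M1t r l p * dfib (X r) (H1 i j k) p
          + dX l (M1c i j k) p
          + \sum_h H1 i l h p * M1c h j k p
          + \sum_h M1c i l h p * H1 h j k p
          - \sum_h M1c i l h p * M1c h j k p
          + \sum_α \sum_γ \sum_r \sum_s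
              f0 p ^- 2 * gi2 α γ p * G (X r) (U α) p * G (X s) (U γ) p
              * Cu1 i l r p * C1 j k s p) k l)
  /\
  (forall (i k l : 'I_m) (α : 'I_n),
    bR (U α) (X i) (X k) (X l) p =
      skew (fun k l =>
        - dX l (fun q => \sum_r G (X r) (U α) q * Cu1 i k r q) p
        - \sum_r \sum_s (H1 i r l p - M1c i r l p)
            * G (X s) (U α) p * Cu1 r k s p
        - \sum_β \sum_r (f0 p)^-1 * G (X r) (U β) p * Cu1 i l r p
            * f1 k p * kd β α
        + \sum_β \sum_r \sum_μ G (X r) (U β) p * G (U μ) (X k) p
            * Cu1 i l r p * Cu2 β α μ p) k l)
  /\
  (forall (i j : 'I_m) (β λ : 'I_n),
    bR (X j) (X i) (U β) (U λ) p =
      skew (fun β λ =>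
        - dU λ (fun q => \sum_r G (X r) (U β) q * Cu1 i j r q) p
        + \sum_s \sum_l \sum_r G (X s) (U λ) p * G (X l) (U β) p
            * Cu1 i r s p * Cu1 r j l p
        - \sum_α
            (fu i p * g2 α λ p
             - \sum_μ \sum_h f0 p * G (U μ) (X h) p * gi1 i h p * C2 α λ μ p)
            * (f1 j p * kd α β
               - \sum_ν f0 p * G (U ν) (X j) p * Cu2 α β ν p)) β λ)
  /\
  (forall (i l : 'I_m) (α β : 'I_n),
    bR (U α) (X i) (U β) (X l) p =
      dU β (fun q => \sum_r G (X r) (U α) q * Cu1 i l r q) p
      - dX l (fun q => f0 q *
            (fu i q * g2 α β q
             - \sum_λ \sum_h f0 q * G (U λ) (X h) q * gi1 i h q
                 * C2 α β λ q)) p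
      - \sum_t \sum_s \sum_r G (X t) (U β) p * G (X s) (U α) p
          * Cu1 i r t p * Cu1 r l s p
      + \sum_μ
          (fu i p * g2 μ β p
           - \sum_λ \sum_h f0 p * G (U λ) (X h) p * gi1 i h p * C2 μ β λ p)
          * (f1 l p * kd μ α
             - \sum_ν f0 p * G (U ν) (X l) p * Cu2 μ α ν p)
      - \sum_r \sum_h f0 p * gi1 r h p * (H1 i r l p - M1c i r l p)
          * (f1 h p * g2 α β p
             - \sum_λ f0 p * G (U λ) (X h) p * C2 α β λ p)
      - \sum_r \sum_μ G (X r) (U μ) p * Cu1 i l r p
          * (H2 μ α β p + N μ α β p - M2c μ α β p))
  /\
  (forall (i j l : 'I_m) (β : 'I_n),
    bR (X j) (X i) (U β) (X l) p =
      - dX l (fun q => \sum_r G (X r) (U β) q * Cu1 i j r q) p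
      - dU β (fun q => H1 i j l q - M1c i j l q) p
      - \sum_r \sum_s (H1 i l r p - M1c i l r p)
          * G (X s) (U β) p * Cu1 r j s p
      - \sum_r \sum_α (f0 p)^-1 * G (X r) (U α) p * Cu1 i l r p
          * (f1 j p * kd α β
             - \sum_μ f0 p * G (U μ) (X j) p * Cu2 α β μ p)
      + \sum_s \sum_r G (X s) (U β) p * Cu1 i r s p
          * (H1 r j l p - M1c r j l p)
      + \sum_r \sum_μ (f0 p)^-1 * G (X r) (U μ) p * C1 j l r p
          * (fu i p * kd μ β
             - \sum_λ \sum_h f0 p * G (U λ) (X h) p * gi1 i h p
                 * Cu2 μ β λ p))
  /\
  (forall (i : 'I_m) (α β λ : 'I_n),
    bR (U α) (X i) (U β) (U λ) p =
      skew (fun β λ =>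
        - dU λ (fun q => f0 q * fu i q * g2 α β q
            - \sum_h \sum_μ f0 q ^+ 2 * gi1 i h q * G (U μ) (X h) q
                * C2 α β μ q) p
        + \sum_s \sum_r f0 p * G (X s) (U λ) p * Cu1 i r s p
            * (fu r p * g2 α β p
               - \sum_μ \sum_l f0 p * G (U μ) (X l) p * C2 α β μ p
                   * gi1 r l p)
        - \sum_μ f0 p
            * (fu i p * g2 λ μ p
               - \sum_h \sum_κ f0 p * gi1 i h p * G (U κ) (X h) p
                   * C2 λ μ κ p)
            * (H2 μ α β p + N μ α β p - M2c μ α β p)) β λ)
  /\
  (forall (j k l : 'I_m) (γ : 'I_n),
    bR (X j) (U γ) (X k) (X l) p =
      skew (fun k l =>
        dX l (fun q => \sum_λ \sum_r f0 q ^- 2 * gi2 γ λ q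
            * G (X r) (U λ) q * C1 j k r q) p
        + \sum_λ \sum_s \sum_r f0 p ^- 2 * gi2 γ λ p * G (X s) (U λ) p
            * C1 l r s p * (H1 r j k p - M1c r j k p)
        + \sum_r \sum_μ f0 p ^- 3 * G (X r) (U μ) p * C1 j k r p
            * (f1 l p * gi2 γ μ p
               - \sum_α f0 p * G (U α) (X l) p * Cuu2 γ μ α p)) k l)
  /\
  (forall (j l : 'I_m) (γ β : 'I_n),
    bR (X j) (U γ) (U β) (X l) p =
      dX l (fun q => (f0 q)^-1 * f1 j q * kd γ β
          - \sum_α G (U α) (X j) q * Cu2 γ α β q) p
      - dU β (fun q => \sum_λ \sum_r f0 q ^- 2 * gi2 γ λ q
          * G (X r) (U λ) q * C1 j l r q) p
      - \sum_λ \sum_s \sum_t \sum_h f0 p ^- 2 * gi2 γ λ p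
          * G (X s) (U λ) p * G (X t) (U β) p * Cu1 h l s p * C1 h j t p
      + \sum_μ f0 p ^- 2
          * (f1 l p * kd γ μ
             - \sum_α f0 p * G (U α) (X l) p * Cu2 γ μ α p)
          * (f1 j p * kd μ β
             - \sum_ν f0 p * G (U ν) (X j) p * Cu2 μ β ν p)
      - \sum_r (f0 p)^-1
          * (f1 r p * kd γ β
             - \sum_α f0 p * G (U α) (X r) p * Cu2 γ β α p)
          * (H1 r j l p - M1c r j l p)
      - \sum_μ \sum_λ \sum_r f0 p ^- 2 * gi2 μ λ p * G (X r) (U λ) p
          * C1 j l r p * (H2 γ β μ p + N γ β μ p - M2c γ β μ p))
  /\
  (forall (l : 'I_m) (γ α β : 'I_n),
    bR (U α) (U γ) (U β) (X l) p =
      dX l (fun q => H2 γ α β q + N γ α β q - M2c γ α β q) p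
      - dU β (fun q => (f0 q)^-1 * f1 l q * kd γ α
          - \sum_μ G (U μ) (X l) q * Cu2 γ α μ q) p
      - \sum_λ \sum_s \sum_h (f0 p)^-1 * gi2 γ λ p * G (X s) (U λ) p
          * Cu1 h l s p
          * (f1 h p * g2 α β p
             - \sum_μ f0 p * G (U μ) (X h) p * C2 α β μ p)
      + \sum_μ (f0 p)^-1
          * (f1 l p * kd γ μ
             - \sum_κ f0 p * G (U κ) (X l) p * Cu2 γ μ κ p)
          * (H2 μ α β p + N μ α β p - M2c μ α β p)
      + \sum_s \sum_r (f0 p)^-1 * G (X s) (U α) p * Cu1 r l s p
          * (f1 r p * kd γ β
             - \sum_κ f0 p * G (U κ) (X r) p * Cu2 γ β κ p)
      - \sum_μ (f0 p)^-1
          * (f1 l p * kd μ α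
             - \sum_κ f0 p * G (U κ) (X l) p * Cu2 μ α κ p)
          * (H2 γ β μ p + N γ β μ p - M2c γ β μ p))
  /\
  (forall (j : 'I_m) (γ β λ : 'I_n),
    bR (X j) (U γ) (U β) (U λ) p =
      skew (fun β λ =>
        dU λ (fun q => (f0 q)^-1 * f1 j q * kd γ β
            - \sum_α G (U α) (X j) q * Cu2 γ α β q) p
        + \sum_α (f0 p)^-1
            * (H2 γ α λ p + N γ α λ p - M2c γ α λ p)
            * (f1 j p * kd α β
               - \sum_ν f0 p * G (U ν) (X j) p * Cu2 α β ν p)
        - \sum_s \sum_r (f0 p)^-1 * G (X s) (U β) p * Cu1 r j s p
            * (f1 r p * kd γ λ
               - \sum_α f0 p * G (U α) (X r) p * Cu2 γ λ α p)) β λ)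
  /\
  (forall (k l : 'I_m) (γ α : 'I_n),
    bR (U α) (U γ) (X k) (X l) p =
      skew (fun k l =>
        dX l (fun q => (f0 q)^-1 * f1 k q * kd γ α
            - \sum_μ G (U μ) (X k) q * Cu2 γ α μ q) p
        + \sum_β f0 p ^- 2
            * (f1 l p * kd γ β
               - \sum_κ f0 p * G (U κ) (X l) p * Cu2 γ β κ p)
            * (f1 k p * kd β α
               - \sum_ν f0 p * G (U ν) (X k) p * Cu2 β α ν p)
        - \sum_s \sum_μ \sum_t \sum_h f0 p ^- 2 * G (X s) (U μ) p
            * G (X t) (U α) p * gi2 γ μ p * Cu1 h l s p * C1 h k t p) k l)
  /\
  (forall (γ α β λ : 'I_n),
    bR (U α) (U γ) (U β) (U λ) p =
      R2 α γ β λ p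
      - skew (fun β λ =>
          \sum_κ M2t κ λ p * dfib (U κ) (H2 γ α β) p
          + dU λ (M2c γ α β) p
          + \sum_μ H2 γ λ μ p * M2c μ α β p
          + \sum_μ M2c γ λ μ p * H2 μ α β p
          - \sum_μ M2c γ λ μ p * M2c μ α β p
          + dU β (N γ α λ) p
          + \sum_μ H2 γ β μ p * N μ α λ p
          + \sum_μ N γ β μ p * H2 μ α λ p
          + \sum_μ N γ β μ p * N μ α λ p
          + \sum_μ N γ λ μ p * M2c μ α β p
          + \sum_μ N μ α β p * M2c γ λ μ p
          + \sum_r
              (\sum_s gi1 r s p * kd γ λ * f1 s p
               - \sum_s \sum_κ f0 p * gi1 r s p * G (U κ) (X s) p
                   * Cu2 γ λ κ p)
              * (g2 α β p * f1 r p
                 - \sum_μ f0 p * G (U μ) (X r) p * C2 α β μ p)) β λ).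
Proof.
move=> Ap; cbv zeta.
have D_eq z phi psi : (forall q, A q -> phi q = psi q) -> hder F z phi p = hder F z psi p.
  by move=> e; exact: (eq_hder_on oA F z e Ap).
have D_opp z phi : smooth_on A phi -> hder F z (fun q => - phi q) p = - hder F z phi p.
  by move=> s; exact: (hderN F z s Ap).
have K_sym x y z q : A q -> hconn F x y z q = hconn F x z y q.
  exact: (hconnC oA sEF).
have f0n0 := f0_neq0 Ap.
have A1p := tdom1 Ap; have A2p := tdom2 Ap.
have gi1C i j : fundinv F1 i j (pr1 p) = fundinv F1 j i (pr1 p).
  exact: (fundinvC oA1 sE1 _ _ A1p).
have gi2C a b : fundinv F2 a b (pr2 p) = fundinv F2 b a (pr2 p).
  exact: (fundinvC oA2 sE2 _ _ A2p).
have g2C a b : fund F2 a b (pr2 p) = fund F2 b a (pr2 p).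
  exact: (fundC oA2 sE2 _ _ A2p).
have g2K a b : \sum_c fund F2 a c (pr2 p) * fundinv F2 c b (pr2 p) = (a == b)%:R.
  exact: (fund_fundinv uG2 a b A2p).
have C1C i j k : cartan F1 i j k (pr1 p) = cartan F1 j i k (pr1 p).
  exact: (cartanC12 oA1 sE1 _ _ _ A1p).
have C2C a b c : cartan F2 a b c (pr2 p) = cartan F2 b a c (pr2 p).
  exact: (cartanC12 oA2 sE2 _ _ _ A2p).
(* Unlike the other symmetries, this one is used under a horizontal derivative, hence is required on
   the whole domain. *)
have Cu2C a b c q : A q -> cartan1 F2 a b c (pr2 q) = cartan1 F2 a c b (pr2 q).
  by move=> Aq; exact: (cartan1C oA2 sE2 a b c (tdom2 Aq)).
have Cuu2E c a b : cartan2 F2 c a b (pr2 p) =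
    \sum_d cartan1 F2 c d b (pr2 p) * fundinv F2 d a (pr2 p).
  exact: (cartan2E oA2 sE2 c a b A2p).
have fuE i (q : TM) : df1up F1 f i q = \sum_h fundinv F1 i h (pr1 q) * df1 f h q by [].
have Cu1E i j k (q : TM) : cartan1 F1 i j k (pr1 q) =
    \sum_h fundinv F1 i h (pr1 q) * cartan F1 h j k (pr1 q) by [].
have Cu2E c a b (q : TM) : cartan1 F2 c a b (pr2 q) =
    \sum_d fundinv F2 c d (pr2 q) * cartan F2 d a b (pr2 q) by [].
have K_XXX := @hconn_XXX; have K_XXU := @hconn_XXU; have K_XUU := @hconn_XUU.
have K_UXX := @hconn_UXX; have K_UXU := @hconn_UXU; have K_UUU := @hconn_UUU.
repeat apply: conj.
- move=> i j k l.
  have D_sub i' j' k' l' : hder F (X l')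
      (fun q => hconn F1 i' j' k' (pr1 q) - Mc1 F1 F2 f i' j' k' q) p =
      hder F (X l') (fun q => hconn F1 i' j' k' (pr1 q)) p - hder F (X l') (Mc1 F1 F2 f i' j' k') p.
    exact: (hderB oA F _ (sH1 _ _ _) (smooth_Mc1 _ _ _) Ap).
  have D_H1 i' j' k' l' : hder F (X l') (fun q => hconn F1 i' j' k' (pr1 q)) p =
      hder F1 l' (hconn F1 i' j' k') (pr1 p)
      - \sum_r Mt1 F1 F2 f r l' p * dfib (X r) (fun q => hconn F1 i' j' k' (pr1 q)) p.
    rewrite (hderX_pr1 _ _ Ap); apply: (congr1 (fun z => _ - z)); apply: eq_bigr => r _.
    by rewrite dfibX_tproj1.
  exact: (curvature_XXXX Ap D_eq K_XXX K_XXU K_UXX i j k l D_sub D_H1).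
- move=> i k l a.
  exact: (curvature_XUXX Ap D_eq D_opp sK K_sym f0n0 K_XXX K_XXU K_UXU i k l a).
- move=> i j b c.
  exact: (curvature_XXUU Ap D_eq D_opp sK K_sym f0n0 g2C C2C K_XXU K_XUU K_UXU i j b c).
- move=> i l a b.
  exact: (curvature_XUUX Ap D_eq D_opp sK K_sym f0n0 fuE g2C C2C K_XXX K_XXU K_XUU
    K_UXU K_UUU i l a b).
- move=> i j l b.
  exact: (curvature_XXUX Ap D_eq D_opp sK K_sym f0n0 Cu2E gi2C g2K C2C K_XXX K_XXU K_XUU
    K_UXX K_UXU i j l b).
- move=> i a b c.
  exact: (curvature_XUUU Ap D_eq D_opp sK K_sym K_XXU K_XUU K_UUU i a b c).
- move=> j k l c.
  (* [Cuu2E] constrains [Cuu2] at [p] only, so the function of the point is specified. *)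
  exact: (curvature_UXXX (Cuu2 := fun c a b q => cartan2 F2 c a b (pr2 q))
    Ap D_eq f0n0 Cuu2E K_XXX K_UXX K_UXU j k l c).
- move=> j l c b.
  exact: (curvature_UXUX Ap D_eq K_sym f0n0 Cu1E gi1C C1C Cu2C K_XXX K_XXU K_UXX K_UXU
    K_UUU j l c b).
- move=> l c a b.
  exact: (curvature_UUUX Ap D_eq K_sym f0n0 fuE Cu1E gi1C C1C K_XXU K_XUU K_UXX K_UXU
    K_UUU l c a b).
- move=> j c a b.
  exact: (curvature_UXUU Ap D_eq K_sym f0n0 Cu2C K_XXU K_UXU K_UUU j c a b).
- move=> k l c a.
  exact: (curvature_UUXX Ap D_eq K_sym f0n0 Cu1E gi1C C1C K_XXU K_UXX K_UXU k l c a).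
- move=> c a b d.
  have D_sum c' a' b' d' : hder F (U d')
      (fun q => hconn F2 c' a' b' (pr2 q) + Nc2 F2 f c' a' b' q - Mc2 F2 f c' a' b' q) p =
      hder F (U d') (fun q => hconn F2 c' a' b' (pr2 q)) p + hder F (U d') (Nc2 F2 f c' a' b') p
      - hder F (U d') (Mc2 F2 f c' a' b') p.
    rewrite (hderB oA F _ (smoothD oA (sH2 c' a' b') (smooth_Nc2 c' a' b'))
      (smooth_Mc2 c' a' b') Ap).
    by rewrite (hderD F _ (sH2 c' a' b') (smooth_Nc2 c' a' b') Ap).
  have D_H2 c' a' b' d' : hder F (U d') (fun q => hconn F2 c' a' b' (pr2 q)) p =
      hder F2 d' (hconn F2 c' a' b') (pr2 p)
      - \sum_e Mt2 F2 f e d' p * dfib (U e) (fun q => hconn F2 c' a' b' (pr2 q)) p.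
    rewrite (hderU_pr2 _ _ Ap); apply: (congr1 (fun z => _ - z)); apply: eq_bigr => e _.
    by rewrite dfibU_tproj2.
  exact: (curvature_UUUU Ap D_eq K_sym f0n0 fuE gi1C K_XUU K_UXU K_UUU c a b d
    D_sum D_H2).
Qed.

End TwistedMetric.

(** * From charts of Finsler manifolds to the local statement *)

Lemma posdef_unitmx (R : realFieldType) d (g : 'M[R]_d) :
  (forall xi : 'rV[R]_d, xi != 0 -> 0 < \sum_a \sum_b g a b * xi 0 a * xi 0 b) ->
  g \in unitmx.
Proof.
(* If the determinant vanished, a nonzero v with v g = 0 would annihilate the quadratic form. *)
move=> pos; rewrite unitmxE unitfE; apply/negP => /det0P[v v0 vg].
have := pos v v0; rewrite exchange_big big1 ?ltxx // => b _ /=.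
have /rowP/(_ b) := vg; rewrite !mxE => vgb; rewrite -mulr_suml.
under eq_bigr do rewrite mulrC.
by rewrite vgb mul0r.
Qed.

Lemma open_neq0 (R : realType) d : open [set v : 'rV[R]_d | v != 0].
Proof.
rewrite (_ : [set v | _] = (fun v : 'rV[R]_d => `|v|) @^-1` [set x | 0 < x]).
  by apply: open_comp; [move=> v _; exact: norm_continuous|exact: open_gt].
by apply/seteqP; split => v /=; rewrite normr_gt0.
Qed.

Lemma open_prod (R : realType) (V W : normedModType R) (O : set V) (O' : set W) :
  open O -> open O' -> open (O `*` O').
Proof.
move=> oO oO'.
have o1 : open (fst @^-1` O : set (V * W)%type).
  by apply: open_comp => // p _; exact: cvg_fst.
have o2 : open (snd @^-1` O' : set (V * W)%type).
  by apply: open_comp => // p _; exact: cvg_snd.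
exact: (openI o1 o2).
Qed.

Section FinslerChart.
Variables (R : realType) (m : nat) (M : manifold R m) (Fin : finsler M).
Variables (c : chart R m M) (hc : atlas c).
Local Notation L := (fexpr Fin c).
Local Notation slit := [set p : 'rV[R]_m * 'rV[R]_m | ccod c p.1 /\ p.2 != 0].

Lemma open_slit : open slit.
Proof.
exact: (open_prod (@ccod_open _ _ _ c) (@open_neq0 R m)).
Qed.

Lemma chart_energy_smooth : smooth_on slit (energy L).
Proof.
have s := fexpr_smooth Fin hc.
have s2 := smoothX open_slit 2 s.
exact: s2.
Qed.

Lemma chart_fund_unit p : slit p -> \matrix_(i, j) fund L i j p \in unitmx.
Proof.
move=> [px py]; apply: posdef_unitmx => xi xi0.
have := fexpr_posdef Fin hc px py xi0; rewrite -surjective_pairing.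
by under [X in _ -> 0 < X]eq_bigr do under eq_bigr do rewrite mxE.
Qed.

Lemma chart_slit_cone p (t : R) : slit p -> 0 < t -> slit (p.1, t *: p.2).
Proof. by move=> [px py] t0; split=> //=; rewrite scaler_eq0 negb_or gt_eqF. Qed.

Lemma chart_energy_homog p (t : R) : slit p -> 0 < t ->
  energy L (p.1, t *: p.2) = t ^+ 2 * energy L p.
Proof.
move=> [px py] t0; rewrite /energy (fexpr_homog Fin _ hc px t0) exprMn.
by rewrite -surjective_pairing.
Qed.

End FinslerChart.

(** The radicand is a sum of products of squares, hence nonnegative, and squaring undoes the root at
    every point. *)
Lemma energy_twisted (R : realType) m n (F1 : 'rV[R]_m * 'rV[R]_m -> R)
    (F2 : 'rV[R]_n * 'rV[R]_n -> R) (f : 'rV[R]_m * 'rV[R]_n -> R) q :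
  energy (twisted F1 F2 f) q =
  energy F1 (tproj1 q) + f (tbase q) ^+ 2 * energy F2 (tproj2 q).
Proof.
rewrite {1}/energy /twisted sqr_sqrtr //.
by rewrite addr_ge0 ?sqr_ge0 // mulr_ge0 ?sqr_ge0.
Qed.

Theorem lemma5 (R : realType) (m n : nat)
    (M1 : manifold R m) (M2 : manifold R n)
    (Fin1 : finsler M1) (Fin2 : finsler M2) (f : M1 * M2 -> R)
    (f_gt0 : forall q, 0 < f q) (f_smooth : prod_smooth f)
    (c1 : chart R m M1) (c2 : chart R n M2)
    (hc1 : atlas c1) (hc2 : atlas c2)
    (x : 'rV[R]_m) (u : 'rV[R]_n) (y : 'rV[R]_m) (v : 'rV[R]_n)
    (hx : ccod c1 x) (hu : ccod c2 u) (hy : y != 0) (hv : v != 0) :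
  let p := (row_mx x u, row_mx y v) in
  let F1 := fexpr Fin1 c1 in
  let F2 := fexpr Fin2 c2 in
  let fl := prod_expr f c1 c2 in
  let F := twisted F1 F2 fl in
  let X (i : 'I_m) := lshift n i in
  let U (α : 'I_n) := rshift m α in
  let G a b q := nlconn F a b q in
  let dX i phi q := hder F (X i) phi q in
  let dU α phi q := hder F (U α) phi q in
  let bR b a c d q := hcurv F b a c d q in
  let pr1 := @tproj1 R m n in
  let pr2 := @tproj2 R m n in
  let bs := @tbase R m n in
  let gi1 i j q := fundinv F1 i j (pr1 q) in
  let C1 i j k q := cartan F1 i j k (pr1 q) in
  let Cu1 i j k q := cartan1 F1 i j k (pr1 q) in
  let H1 i j k q := hconn F1 i j k (pr1 q) in
  let R1 j i k l q := hcurv F1 j i k l (pr1 q) in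
  let g2 α β q := fund F2 α β (pr2 q) in
  let gi2 α β q := fundinv F2 α β (pr2 q) in
  let C2 α β γ q := cartan F2 α β γ (pr2 q) in
  let Cu2 γ α β q := cartan1 F2 γ α β (pr2 q) in
  let Cuu2 γ μ α q := cartan2 F2 γ μ α (pr2 q) in
  let H2 γ α β q := hconn F2 γ α β (pr2 q) in
  let R2 α γ β λ q := hcurv F2 α γ β λ (pr2 q) in
  let f0 q := fl (bs q) in
  let f1 i q := df1 fl i q in
  let fu i q := df1up F1 fl i q in
  let M1t r i q := Mt1 F1 F2 fl r i q in
  let M2t μ α q := Mt2 F2 fl μ α q in
  let M1c i j k q := Mc1 F1 F2 fl i j k q in
  let M2c γ α β q := Mc2 F2 fl γ α β q in
  let N γ α β q := Nc2 F2 fl γ α β q in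
  let kd (α β : 'I_n) : R := (α == β)%:R in
  (* R_j^i_kl *)
  (forall (i j k l : 'I_m),
    bR (X j) (X i) (X k) (X l) p =
      R1 j i k l p
      - skew (fun k l =>
          \sum_r M1t r l p * dfib (X r) (H1 i j k) p
          + dX l (M1c i j k) p
          + \sum_h H1 i l h p * M1c h j k p
          + \sum_h M1c i l h p * H1 h j k p
          - \sum_h M1c i l h p * M1c h j k p
          + \sum_α \sum_γ \sum_r \sum_s
              f0 p ^- 2 * gi2 α γ p * G (X r) (U α) p * G (X s) (U γ) p
              * Cu1 i l r p * C1 j k s p) k l)
  /\
  (* R_alpha^i_kl *)
  (forall (i k l : 'I_m) (α : 'I_n),
    bR (U α) (X i) (X k) (X l) p =
      skew (fun k l =>
        - dX l (fun q => \sum_r G (X r) (U α) q * Cu1 i k r q) p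
        - \sum_r \sum_s (H1 i r l p - M1c i r l p)
            * G (X s) (U α) p * Cu1 r k s p
        - \sum_β \sum_r (f0 p)^-1 * G (X r) (U β) p * Cu1 i l r p
            * f1 k p * kd β α
        + \sum_β \sum_r \sum_μ G (X r) (U β) p * G (U μ) (X k) p
            * Cu1 i l r p * Cu2 β α μ p) k l)
  /\
  (* R_j^i_beta,lambda *)
  (forall (i j : 'I_m) (β λ : 'I_n),
    bR (X j) (X i) (U β) (U λ) p =
      skew (fun β λ =>
        - dU λ (fun q => \sum_r G (X r) (U β) q * Cu1 i j r q) p
        + \sum_s \sum_l \sum_r G (X s) (U λ) p * G (X l) (U β) p
            * Cu1 i r s p * Cu1 r j l p
        - \sum_α
            (fu i p * g2 α λ p
             - \sum_μ \sum_h f0 p * G (U μ) (X h) p * gi1 i h p * C2 α λ μ p)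
            * (f1 j p * kd α β
               - \sum_ν f0 p * G (U ν) (X j) p * Cu2 α β ν p)) β λ)
  /\
  (* R_alpha^i_beta,l *)
  (forall (i l : 'I_m) (α β : 'I_n),
    bR (U α) (X i) (U β) (X l) p =
      dU β (fun q => \sum_r G (X r) (U α) q * Cu1 i l r q) p
      - dX l (fun q => f0 q *
            (fu i q * g2 α β q
             - \sum_λ \sum_h f0 q * G (U λ) (X h) q * gi1 i h q
                 * C2 α β λ q)) p
      - \sum_t \sum_s \sum_r G (X t) (U β) p * G (X s) (U α) p
          * Cu1 i r t p * Cu1 r l s p
      + \sum_μ
          (fu i p * g2 μ β p
           - \sum_λ \sum_h f0 p * G (U λ) (X h) p * gi1 i h p * C2 μ β λ p)
          * (f1 l p * kd μ α
             - \sum_ν f0 p * G (U ν) (X l) p * Cu2 μ α ν p)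
      - \sum_r \sum_h f0 p * gi1 r h p * (H1 i r l p - M1c i r l p)
          * (f1 h p * g2 α β p
             - \sum_λ f0 p * G (U λ) (X h) p * C2 α β λ p)
      - \sum_r \sum_μ G (X r) (U μ) p * Cu1 i l r p
          * (H2 μ α β p + N μ α β p - M2c μ α β p))
  /\
  (* R_j^i_beta,l *)
  (forall (i j l : 'I_m) (β : 'I_n),
    bR (X j) (X i) (U β) (X l) p =
      - dX l (fun q => \sum_r G (X r) (U β) q * Cu1 i j r q) p
      - dU β (fun q => H1 i j l q - M1c i j l q) p
      - \sum_r \sum_s (H1 i l r p - M1c i l r p)
          * G (X s) (U β) p * Cu1 r j s p
      - \sum_r \sum_α (f0 p)^-1 * G (X r) (U α) p * Cu1 i l r p
          * (f1 j p * kd α β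
             - \sum_μ f0 p * G (U μ) (X j) p * Cu2 α β μ p)
      + \sum_s \sum_r G (X s) (U β) p * Cu1 i r s p
          * (H1 r j l p - M1c r j l p)
      + \sum_r \sum_μ (f0 p)^-1 * G (X r) (U μ) p * C1 j l r p
          * (fu i p * kd μ β
             - \sum_λ \sum_h f0 p * G (U λ) (X h) p * gi1 i h p
                 * Cu2 μ β λ p))
  /\
  (* R_alpha^i_beta,lambda *)
  (forall (i : 'I_m) (α β λ : 'I_n),
    bR (U α) (X i) (U β) (U λ) p =
      skew (fun β λ =>
        - dU λ (fun q => f0 q * fu i q * g2 α β q
            - \sum_h \sum_μ f0 q ^+ 2 * gi1 i h q * G (U μ) (X h) q
                * C2 α β μ q) p
        + \sum_s \sum_r f0 p * G (X s) (U λ) p * Cu1 i r s p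
            * (fu r p * g2 α β p
               - \sum_μ \sum_l f0 p * G (U μ) (X l) p * C2 α β μ p
                   * gi1 r l p)
        - \sum_μ f0 p
            * (fu i p * g2 λ μ p
               - \sum_h \sum_κ f0 p * gi1 i h p * G (U κ) (X h) p
                   * C2 λ μ κ p)
            * (H2 μ α β p + N μ α β p - M2c μ α β p)) β λ)
  /\
  (* R_j^gamma_kl *)
  (forall (j k l : 'I_m) (γ : 'I_n),
    bR (X j) (U γ) (X k) (X l) p =
      skew (fun k l =>
        dX l (fun q => \sum_λ \sum_r f0 q ^- 2 * gi2 γ λ q
            * G (X r) (U λ) q * C1 j k r q) p
        + \sum_λ \sum_s \sum_r f0 p ^- 2 * gi2 γ λ p * G (X s) (U λ) p
            * C1 l r s p * (H1 r j k p - M1c r j k p)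
        + \sum_r \sum_μ f0 p ^- 3 * G (X r) (U μ) p * C1 j k r p
            * (f1 l p * gi2 γ μ p
               - \sum_α f0 p * G (U α) (X l) p * Cuu2 γ μ α p)) k l)
  /\
  (* R_j^gamma_beta,l *)
  (forall (j l : 'I_m) (γ β : 'I_n),
    bR (X j) (U γ) (U β) (X l) p =
      dX l (fun q => (f0 q)^-1 * f1 j q * kd γ β
          - \sum_α G (U α) (X j) q * Cu2 γ α β q) p
      - dU β (fun q => \sum_λ \sum_r f0 q ^- 2 * gi2 γ λ q
          * G (X r) (U λ) q * C1 j l r q) p
      - \sum_λ \sum_s \sum_t \sum_h f0 p ^- 2 * gi2 γ λ p
          * G (X s) (U λ) p * G (X t) (U β) p * Cu1 h l s p * C1 h j t p
      + \sum_μ f0 p ^- 2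
          * (f1 l p * kd γ μ
             - \sum_α f0 p * G (U α) (X l) p * Cu2 γ μ α p)
          * (f1 j p * kd μ β
             - \sum_ν f0 p * G (U ν) (X j) p * Cu2 μ β ν p)
      - \sum_r (f0 p)^-1
          * (f1 r p * kd γ β
             - \sum_α f0 p * G (U α) (X r) p * Cu2 γ β α p)
          * (H1 r j l p - M1c r j l p)
      - \sum_μ \sum_λ \sum_r f0 p ^- 2 * gi2 μ λ p * G (X r) (U λ) p
          * C1 j l r p * (H2 γ β μ p + N γ β μ p - M2c γ β μ p))
  /\
  (* R_alpha^gamma_beta,l *)
  (forall (l : 'I_m) (γ α β : 'I_n),
    bR (U α) (U γ) (U β) (X l) p =
      dX l (fun q => H2 γ α β q + N γ α β q - M2c γ α β q) p
      - dU β (fun q => (f0 q)^-1 * f1 l q * kd γ α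
          - \sum_μ G (U μ) (X l) q * Cu2 γ α μ q) p
      - \sum_λ \sum_s \sum_h (f0 p)^-1 * gi2 γ λ p * G (X s) (U λ) p
          * Cu1 h l s p
          * (f1 h p * g2 α β p
             - \sum_μ f0 p * G (U μ) (X h) p * C2 α β μ p)
      + \sum_μ (f0 p)^-1
          * (f1 l p * kd γ μ
             - \sum_κ f0 p * G (U κ) (X l) p * Cu2 γ μ κ p)
          * (H2 μ α β p + N μ α β p - M2c μ α β p)
      + \sum_s \sum_r (f0 p)^-1 * G (X s) (U α) p * Cu1 r l s p
          * (f1 r p * kd γ β
             - \sum_κ f0 p * G (U κ) (X r) p * Cu2 γ β κ p)
      - \sum_μ (f0 p)^-1
          * (f1 l p * kd μ α
             - \sum_κ f0 p * G (U κ) (X l) p * Cu2 μ α κ p)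
          * (H2 γ β μ p + N γ β μ p - M2c γ β μ p))
  /\
  (* R_j^gamma_beta,lambda *)
  (forall (j : 'I_m) (γ β λ : 'I_n),
    bR (X j) (U γ) (U β) (U λ) p =
      skew (fun β λ =>
        dU λ (fun q => (f0 q)^-1 * f1 j q * kd γ β
            - \sum_α G (U α) (X j) q * Cu2 γ α β q) p
        + \sum_α (f0 p)^-1
            * (H2 γ α λ p + N γ α λ p - M2c γ α λ p)
            * (f1 j p * kd α β
               - \sum_ν f0 p * G (U ν) (X j) p * Cu2 α β ν p)
        - \sum_s \sum_r (f0 p)^-1 * G (X s) (U β) p * Cu1 r j s p
            * (f1 r p * kd γ λ
               - \sum_α f0 p * G (U α) (X r) p * Cu2 γ λ α p)) β λ)
  /\
  (* R_alpha^gamma_kl *)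
  (forall (k l : 'I_m) (γ α : 'I_n),
    bR (U α) (U γ) (X k) (X l) p =
      skew (fun k l =>
        dX l (fun q => (f0 q)^-1 * f1 k q * kd γ α
            - \sum_μ G (U μ) (X k) q * Cu2 γ α μ q) p
        + \sum_β f0 p ^- 2
            * (f1 l p * kd γ β
               - \sum_κ f0 p * G (U κ) (X l) p * Cu2 γ β κ p)
            * (f1 k p * kd β α
               - \sum_ν f0 p * G (U ν) (X k) p * Cu2 β α ν p)
        - \sum_s \sum_μ \sum_t \sum_h f0 p ^- 2 * G (X s) (U μ) p
            * G (X t) (U α) p * gi2 γ μ p * Cu1 h l s p * C1 h k t p) k l)
  /\
  (* R_alpha^gamma_beta,lambda *)
  (forall (γ α β λ : 'I_n),
    bR (U α) (U γ) (U β) (U λ) p =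
      R2 α γ β λ p
      - skew (fun β λ =>
          \sum_κ M2t κ λ p * dfib (U κ) (H2 γ α β) p
          + dU λ (M2c γ α β) p
          + \sum_μ H2 γ λ μ p * M2c μ α β p
          + \sum_μ M2c γ λ μ p * H2 μ α β p
          - \sum_μ M2c γ λ μ p * M2c μ α β p
          + dU β (N γ α λ) p
          + \sum_μ H2 γ β μ p * N μ α λ p
          + \sum_μ N γ β μ p * H2 μ α λ p
          + \sum_μ N γ β μ p * N μ α λ p
          + \sum_μ N γ λ μ p * M2c μ α β p
          + \sum_μ N μ α β p * M2c γ λ μ p
          + \sum_r
              (\sum_s gi1 r s p * kd γ λ * f1 s p
               - \sum_s \sum_κ f0 p * gi1 r s p * G (U κ) (X s) p
                   * Cu2 γ λ κ p)
              * (g2 α β p * f1 r p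
                 - \sum_μ f0 p * G (U μ) (X r) p * C2 α β μ p)) β λ).
Proof.
(* The chosen tangent vector lies over both charts and has y and v nonzero; these conditions define
   the open set on which all the local identities hold. *)
have Ap : tdom [set q : 'rV[R]_m * 'rV[R]_m | ccod c1 q.1 /\ q.2 != 0]
    [set q : 'rV[R]_n * 'rV[R]_n | ccod c2 q.1 /\ q.2 != 0] (ccod c1 `*` ccod c2)
    (row_mx x u, row_mx y v).
  by rewrite /tdom /= /tproj1 /tproj2 /tbase /= !row_mxKl !row_mxKr.
have fn0 q : (ccod c1 `*` ccod c2) q -> prod_expr f c1 c2 q != 0.
  by move=> _; rewrite /prod_expr gt_eqF.
exact (twisted_curvature (@open_slit _ _ _ c1) (@open_slit _ _ _ c2)
  (open_prod (@ccod_open _ _ _ c1) (@ccod_open _ _ _ c2))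
  (chart_energy_smooth Fin1 hc1) (chart_energy_smooth Fin2 hc2)
  (f_smooth c1 c2 hc1 hc2) fn0 (chart_fund_unit Fin1 hc1) (chart_fund_unit Fin2 hc2)
  (@chart_slit_cone _ _ _ c2) (chart_energy_homog Fin2 hc2) (energy_twisted _ _ _) Ap).
Qed.
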